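(* There exist bounded domains $\Omega^\lambda\subset\mathbf C$ with smooth boundary and embeddings $\Gamma(\cdot,\lambda)$ from $\overline{\mathbb D}$ onto $\overline{\Omega^\lambda}$, $\lambda\in[0,1]$, such that $\Gamma$ is $\mathcal C^\infty$ on $E=\overline{\mathbb D}\times[0,1]$ and real analytic at $(1,0)\in E$, but for every family of Riemann mappings $R(\cdot,\lambda)$ from $\overline{\Omega^\lambda}$ onto $\overline{\mathbb D}$ ($\lambda\in[0,1]$), the function $(z,\lambda)\mapsto R(\Gamma(z,\lambda),\lambda)$ is not real analytic at $(1,0)\in E$.
   Context: $\mathbb D$ is the open unit disc in $\mathbf C$. Embeddings $\Gamma(\cdot,\lambda)$ are smooth embeddings up to the boundary (not assumed holomorphic). A Riemann mapping from $\overline{\Omega^\lambda}$ onto $\overline{\mathbb D}$ is a biholomorphic map from $\Omega^\lambda$ onto $\mathbb D$, extended as a homeomorphism between the closures. No regularity of the family $R(\cdot,\lambda)$ in $\lambda$ is assumed. A function on $E$ is real analytic at a point $p\in E$ if near $p$ it is the restriction to $E$ of a real analytic function defined in a full neighborhood of $p$ in $\mathbf C\times\mathbf R$. *)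

(* Defs.v *)
From Stdlib Require Import Reals.
From Coquelicot Require Import Coquelicot.
Open Scope R_scope.

(* [C] and [C * R] as real vector spaces. *)
Definition CR2 : NormedModule R_AbsRing := C_R_NormedModule.
Definition CxR : NormedModule R_AbsRing :=
  prod_NormedModule R_AbsRing C_R_NormedModule R_NormedModule.

Definition unit_disc (z : C) : Prop := Cmod z < 1.
Definition closed_unit_disc (z : C) : Prop := Cmod z <= 1.

Definition cylinder (p : C * R) : Prop :=
  closed_unit_disc (fst p) /\ 0 <= snd p <= 1.

Definition closure {T : UniformSpace} (A : T -> Prop) (x : T) : Prop :=
  forall P : T -> Prop, locally x P -> exists y, P y /\ A y.

Definition boundary {T : UniformSpace} (A : T -> Prop) (x : T) : Prop :=
  closure A x /\ closure (fun y => ~ A y) x.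

Definition connected_set {T : UniformSpace} (A : T -> Prop) : Prop :=
  forall P Q : T -> Prop, open P -> open Q ->
    (forall x, A x -> P x \/ Q x) ->
    (exists x, A x /\ P x) -> (exists x, A x /\ Q x) ->
    exists x, A x /\ P x /\ Q x.

Definition bounded_domain (Omega : C -> Prop) : Prop :=
  @open C_UniformSpace Omega /\
  (exists z, Omega z) /\
  @connected_set C_UniformSpace Omega /\
  (exists M : R, forall z, Omega z -> Cmod z <= M).

Definition dir_ex_derive {V : NormedModule R_AbsRing} (f : V -> R) (v p : V) : Prop :=
  ex_derive (fun s : R => f (plus p (scal s v))) 0.

Definition dir_derive {V : NormedModule R_AbsRing} (f : V -> R) (v p : V) : R :=
  Derive (fun s : R => f (plus p (scal s v))) 0.

(* The derivatives are taken in every direction [v], not only along a basis;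
   on an open subset of a finite-dimensional [V] (the only case used) this is
   the usual class C^k. *)
Fixpoint Ck_on {V : NormedModule R_AbsRing} (k : nat) (U : V -> Prop)
    (f : V -> R) : Prop :=
  (forall p, U p -> continuous f p) /\
  match k with
  | O => True
  | S m => forall v : V,
      (forall p, U p -> dir_ex_derive f v p) /\ Ck_on m U (dir_derive f v)
  end.

Definition smooth_on {V : NormedModule R_AbsRing} (U : V -> Prop) (f : V -> R) : Prop :=
  forall k : nat, Ck_on k U f.

Definition Csmooth_on {V : NormedModule R_AbsRing} (U : V -> Prop) (F : V -> C) : Prop :=
  smooth_on U (fun p => Re (F p)) /\ smooth_on U (fun p => Im (F p)).

Definition Cdir_derive {V : NormedModule R_AbsRing} (F : V -> C) (v p : V) : C :=
  (dir_derive (fun q => Re (F q)) v p, dir_derive (fun q => Im (F q)) v p).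

(* [G] is a smooth extension of [F] to an open neighbourhood of [E]. *)
Definition smooth_extension {V : NormedModule R_AbsRing} (E : V -> Prop)
    (F G : V -> C) : Prop :=
  exists U : V -> Prop, open U /\ (forall p, E p -> U p) /\
    Csmooth_on U G /\ (forall p, E p -> G p = F p).

Definition smooth_on_closed {V : NormedModule R_AbsRing} (E : V -> Prop)
    (F : V -> C) : Prop :=
  exists G : V -> C, smooth_extension E F G.

(* On the closed disc the differential of the extension [G] depends only on
   [gamma], since the disc is the closure of its interior.  A continuous injective map on
   this compact set is a homeomorphism onto its image. *)
Definition smooth_embedding_onto (gamma : C -> C) (K : C -> Prop) : Prop :=
  (forall z w, closed_unit_disc z -> closed_unit_disc w ->
     gamma z = gamma w -> z = w) /\
  (forall w, K w <-> exists z, closed_unit_disc z /\ gamma z = w) /\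
  exists G : CR2 -> C,
    smooth_extension (V := CR2) closed_unit_disc gamma G /\
    forall z v : C, closed_unit_disc z -> v <> RtoC 0 ->
      Cdir_derive (V := CR2) G v z <> RtoC 0.

Definition smooth_boundary (Omega : C -> Prop) : Prop :=
  forall p : C, @boundary C_UniformSpace Omega p ->
    exists (U : CR2 -> Prop) (rho : CR2 -> R),
      open U /\ U p /\ smooth_on U rho /\
      (forall q, U q -> (Omega q <-> rho q < 0)) /\
      (forall q, U q -> rho q = 0 -> exists v, dir_derive rho v q <> 0).

(* Partial sum over [0 <= i, j, k <= n]. *)
Definition cube_sum {V : AbelianMonoid} (n : nat) (b : nat -> nat -> nat -> V) : V :=
  sum_n (fun i => sum_n (fun j => sum_n (fun k => b i j k) n) n) n.

Definition monomial (a : nat -> nat -> nat -> C) (x y t : R) (i j k : nat) : C :=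
  Cmult (a i j k) (RtoC (x ^ i * y ^ j * t ^ k)).

(* Absolutely convergent power series in the real coordinates
   (Re z, Im z, lambda) around each point. *)
Definition real_analytic_on (U : C * R -> Prop) (F : C * R -> C) : Prop :=
  forall p : C * R, U p ->
    exists (a : nat -> nat -> nat -> C) (r : R), 0 < r /\
      forall x y t : R, Rabs x < r -> Rabs y < r -> Rabs t < r ->
        (exists M : R, forall n : nat,
           cube_sum n (fun i j k => Cmod (monomial a x y t i j k)) <= M) /\
        filterlim (fun n : nat => cube_sum n (monomial a x y t) : C) eventually
          (locally (F ((Re (fst p) + x, Im (fst p) + y), snd p + t))).

Definition real_analytic_at (E : C * R -> Prop) (F : C * R -> C) (p : C * R) : Prop :=
  E p /\
  exists (U : CxR -> Prop) (G : C * R -> C),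
    open U /\ U p /\ real_analytic_on U G /\
    (forall q, E q -> U q -> G q = F q).

Definition holomorphic_on (U : C -> Prop) (f : C -> C) : Prop :=
  forall z : C, U z -> @ex_derive C_AbsRing C_NormedModule f z.

Definition inverse_on (A B : C -> Prop) (f g : C -> C) : Prop :=
  (forall z, A z -> B (f z) /\ g (f z) = z) /\
  (forall w, B w -> A (g w) /\ f (g w) = w).

Definition biholomorphic_onto (U W : C -> Prop) (f : C -> C) : Prop :=
  holomorphic_on U f /\
  exists g : C -> C, inverse_on U W f g /\ holomorphic_on W g.

Definition homeomorphism_onto (A B : C -> Prop) (f : C -> C) : Prop :=
  @continuous_on C_UniformSpace C_UniformSpace A f /\
  exists g : C -> C,
    inverse_on A B f g /\ @continuous_on C_UniformSpace C_UniformSpace B g.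

Definition riemann_mapping (Omega : C -> Prop) (f : C -> C) : Prop :=
  biholomorphic_onto Omega unit_disc f /\
  homeomorphism_onto (@closure C_UniformSpace Omega) closed_unit_disc f.

(* Main.v *)
(** In the half-plane coordinate Z = i(1+z)/(1-z), which sends 1 to infinity,
    put g(Z) = exp(-s^2) with s = log((Z-1)/(Z+1)).  The function g is
    holomorphic on Im Z > 0, real on the real axis outside [-1,1], and its
    boundary values on (-1,1) are flat at -1 and 1.  With the flat parameter
    e = exp(-1/lambda), the map F = Z + e c g (c small) is a conformal map of
    the half-plane onto the region Im W > b(Re W) above the curve
    t + e c g(t), -1 <= t <= 1, continued by the rest of the real axis.  The
    same region is the image of Z + e c eta(Im Z) g(Re Z), with g(Re Z)
    replaced by 0 off [-1,1] and eta a bump function: this non-holomorphic map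
    is smooth and is the identity near infinity, and it provides Gamma.

    By the Schwarz lemma every Riemann mapping is a Moebius transformation of
    F^-1.  If R(Gamma(z,lambda),lambda) were analytic at (1,0), the defect
    between the cross ratio of its values at four points Z_j near infinity and
    that of the Z_j themselves would be analytic in lambda; it is also
    O(exp(-1/lambda)), hence zero.  So F^-1 preserves these cross ratios for
    small lambda > 0, and to first order in e this gives a linear relation
    between the difference quotients of g at the four points, which fails for
    suitable points on the imaginary axis. *)

Require Import Defs.
From Stdlib Require Import Reals Lra Lia Classical ClassicalEpsilon FunctionalExtensionality.
From Coquelicot Require Import Coquelicot.
Open Scope R_scope.

(** * Complex derivatives *)

(** Nothing links the Moebius factors of the Riemann mappings for different values of [lambda], so
    each [lambda] must be treated alone, through an expression that these factors do not affect. The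
    shape of g: near Z = 1 and Z = -1, |Re s| tends to infinity while Im s stays in [0, pi], so |g|
    <= exp(pi^2 - (Re s)^2) is below every power of the distance. Off [-1,1] g is real, so F slides
    the axis along itself, and cutting g off there does not change the region. The factor c makes
    all perturbations 1/4-Lipschitz and bounded by 1/4. Bijectivity, nonzero derivatives and the
    separation of the two sides of the curve then follow from contraction and intermediate value
    arguments. The Schwarz lemma is reached through Goursat, a mean value property and the maximum
    principle, without power series. Of the four points two stay at distance 1 and the others are
    far away. Three of the four difference quotients are then small because g is bounded, and the
    relation would force the last one to be small as well. *)

Definition cderiv (f : C -> C) (z d : C) : Prop :=
  forall e, 0 < e -> exists dl, 0 < dl /\ forall w,
    Cmod (w - z) < dl -> Cmod (f w - f z - d * (w - z)) <= e * Cmod (w - z).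

Lemma is_derive_cderiv (f : C -> C) (z d : C) :
  @is_derive C_AbsRing C_NormedModule f z d <-> cderiv f z d.
Proof.
  split.
  - intros [_ H] e He.
    specialize (H z (fun P HP => HP) (mkposreal e He)).
    destruct H as [dl H]. exists dl. split; [apply cond_pos|].
    intros w Hw. specialize (H w Hw).
    unfold norm in H; simpl in H. unfold minus, plus, opp, scal in H; simpl in H.
    unfold mult in H; simpl in H.
    replace (f w - f z - d * (w - z))%C
      with (f w + - f z + - ((w + - z) * d))%C by ring.
    exact H.
  - intros H. split.
    + apply is_linear_scal_l.
    + intros x Hx e.
      assert (x = z) as ->.
      { symmetry. apply (is_filter_lim_locally_unique (K := C_AbsRing)
          (V := AbsRing_NormedModule C_AbsRing) z x). exact Hx. }
      destruct (H e (cond_pos e)) as [dl [Hd H1]].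
      exists (mkposreal dl Hd). intros w Hw. specialize (H1 w Hw).
      unfold norm; simpl. unfold minus, plus, opp, scal; simpl.
      unfold mult; simpl.
      replace (f w + - f z + - ((w + - z) * d))%C with (f w - f z - d * (w - z))%C by ring.
      exact H1.
Qed.

Lemma ex_derive_cderiv (f : C -> C) (z : C) :
  @ex_derive C_AbsRing C_NormedModule f z <-> exists d, cderiv f z d.
Proof. split; intros [d H]; exists d; apply is_derive_cderiv; exact H. Qed.

Lemma Cmod_le_sum (z : C) : Cmod z <= Rabs (Re z) + Rabs (Im z).
Proof.
  destruct z as [x y]; unfold Cmod; simpl.
  apply Rsqr_incr_0_var; [|generalize (Rabs_pos x) (Rabs_pos y); lra].
  rewrite Rsqr_sqrt by nra. unfold Rsqr.
  generalize (Rabs_pos x) (Rabs_pos y) (Rsqr_abs x) (Rsqr_abs y). unfold Rsqr.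
  intros. nra.
Qed.

Lemma im_le_Cmod (z : C) : Rabs (Im z) <= Cmod z.
Proof. eapply Rle_trans; [|apply Rmax_Cmod]. apply Rmax_r. Qed.

Lemma Cmod_sub_sym (z w : C) : Cmod (z - w) = Cmod (w - z).
Proof. rewrite <- Cmod_opp. f_equal. ring. Qed.

Lemma Cmod_sub_ge (z w : C) : Cmod z - Cmod w <= Cmod (z - w).
Proof.
  generalize (Cmod_triangle (z - w) w). replace (z - w + w)%C with z by ring. lra.
Qed.

Lemma Cmod_sub_le (z w : C) : Cmod (z - w) <= Cmod z + Cmod w.
Proof. unfold Cminus. generalize (Cmod_triangle z (- w)). rewrite Cmod_opp. auto. Qed.

Definition ccont (f : C -> C) (z : C) : Prop :=
  forall e, 0 < e -> exists dl, 0 < dl /\ forall w,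
    Cmod (w - z) < dl -> Cmod (f w - f z) <= e.

Lemma cderiv_cont (f : C -> C) (z d : C) : cderiv f z d -> ccont f z.
Proof.
  intros H e He. destruct (H 1 Rlt_0_1) as [dl [Hd H1]].
  set (K := 1 + Cmod d). assert (0 < K) by (unfold K; generalize (Cmod_ge_0 d); lra).
  exists (Rmin dl (e / K)). split.
  { apply Rmin_pos; auto. apply Rdiv_lt_0_compat; auto. }
  intros w Hw.
  assert (Cmod (w - z) < dl) as H2 by (eapply Rlt_le_trans; [exact Hw|apply Rmin_l]).
  assert (Cmod (w - z) < e / K) as H3 by (eapply Rlt_le_trans; [exact Hw|apply Rmin_r]).
  specialize (H1 w H2).
  replace (f w - f z)%C with ((f w - f z - d * (w - z)) + d * (w - z))%C by ring.
  eapply Rle_trans; [apply Cmod_triangle|]. rewrite Cmod_mult.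
  assert (K * Cmod (w - z) <= e).
  { apply Rlt_le in H3. apply (Rmult_le_compat_l K) in H3; [|lra].
    replace (K * (e / K)) with e in H3 by (field; lra). exact H3. }
  unfold K in *. lra.
Qed.

Lemma cderiv_ext_loc (f g : C -> C) (z d : C) (r : R) : 0 < r ->
  (forall w, Cmod (w - z) < r -> f w = g w) -> cderiv f z d -> cderiv g z d.
Proof.
  intros Hr E H e He. destruct (H e He) as [dl [Hd H1]].
  exists (Rmin dl r). split; [apply Rmin_pos; auto|]. intros w Hw.
  rewrite <- !E.
  - apply H1. eapply Rlt_le_trans; [exact Hw|apply Rmin_l].
  - replace (z - z)%C with (RtoC 0) by ring. rewrite Cmod_0. exact Hr.
  - eapply Rlt_le_trans; [exact Hw|apply Rmin_r].
Qed.

Lemma cderiv_affine (a b z : C) : cderiv (fun w => a * w + b)%C z a.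
Proof.
  intros e He. exists 1. split; [lra|]. intros w _.
  replace (a * w + b - (a * z + b) - a * (w - z))%C with (RtoC 0) by ring.
  rewrite Cmod_0. generalize (Cmod_ge_0 (w - z)); nra.
Qed.

Lemma cderiv_const (a z : C) : cderiv (fun _ => a) z 0.
Proof.
  intros e He. exists 1. split; [lra|]. intros w _.
  replace (a - a - 0 * (w - z))%C with (RtoC 0) by ring.
  rewrite Cmod_0. generalize (Cmod_ge_0 (w - z)); nra.
Qed.

Lemma cderiv_id (z : C) : cderiv (fun w => w) z 1.
Proof.
  intros e He. exists 1. split; [lra|]. intros w _.
  replace (w - z - 1 * (w - z))%C with (RtoC 0) by ring.
  rewrite Cmod_0. generalize (Cmod_ge_0 (w - z)); nra.
Qed.

Lemma cderiv_plus (f g : C -> C) (z a b : C) :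
  cderiv f z a -> cderiv g z b -> cderiv (fun w => f w + g w)%C z (a + b)%C.
Proof.
  intros F G. apply is_derive_cderiv in F. apply is_derive_cderiv in G.
  apply is_derive_cderiv. exact (is_derive_plus (K := C_AbsRing) (V := C_NormedModule) f g z a b F G).
Qed.

Lemma cderiv_comp (f g : C -> C) (z a b : C) :
  cderiv g z b -> cderiv f (g z) a -> cderiv (fun w => f (g w)) z (a * b)%C.
Proof.
  intros G F e He.
  set (K := 1 + Cmod b). assert (0 < K) by (unfold K; generalize (Cmod_ge_0 b); lra).
  assert (0 < 1 + Cmod a) as HA by (generalize (Cmod_ge_0 a); lra).
  destruct (F (e / 2 / K)) as [d1 [Hd1 F1]]; [apply Rdiv_lt_0_compat; lra|].
  destruct (G (Rmin 1 (e / 2 / (1 + Cmod a)))) as [d2 [Hd2 G1]].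
  { apply Rmin_pos; [lra|]. apply Rdiv_lt_0_compat; lra. }
  exists (Rmin d2 (d1 / K)). split.
  { apply Rmin_pos; auto. apply Rdiv_lt_0_compat; auto. }
  intros w Hw.
  assert (Cmod (w - z) < d2) as H2 by (eapply Rlt_le_trans; [exact Hw|apply Rmin_l]).
  assert (Cmod (w - z) < d1 / K) as H3 by (eapply Rlt_le_trans; [exact Hw|apply Rmin_r]).
  specialize (G1 w H2). generalize (Cmod_ge_0 (w - z)); intro P.
  assert (Cmod (g w - g z) <= K * Cmod (w - z)) as GL.
  { replace (g w - g z)%C with ((g w - g z - b * (w - z)) + b * (w - z))%C by ring.
    eapply Rle_trans; [apply Cmod_triangle|]. rewrite Cmod_mult.
    generalize (Rmin_l 1 (e / 2 / (1 + Cmod a))); intro.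
    unfold K. nra. }
  assert (K * Cmod (w - z) < d1) as H4.
  { apply (Rmult_lt_compat_l K) in H3; [|lra].
    replace (K * (d1 / K)) with d1 in H3 by (field; lra). exact H3. }
  specialize (F1 (g w) ltac:(lra)).
  replace (f (g w) - f (g z) - a * b * (w - z))%C
    with ((f (g w) - f (g z) - a * (g w - g z)) + a * (g w - g z - b * (w - z)))%C by ring.
  eapply Rle_trans; [apply Cmod_triangle|]. rewrite Cmod_mult.
  assert (e / 2 / K * Cmod (g w - g z) <= e / 2 * Cmod (w - z)) as E1.
  { replace (e / 2 * Cmod (w - z)) with (e / 2 / K * (K * Cmod (w - z))) by (field; lra).
    apply Rmult_le_compat_l; [|exact GL]. left; apply Rdiv_lt_0_compat; lra. }
  assert (Cmod a * Cmod (g w - g z - b * (w - z)) <= e / 2 * Cmod (w - z)) as E2.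
  { eapply Rle_trans; [apply Rmult_le_compat_l; [apply Cmod_ge_0|exact G1]|].
    generalize (Rmin_r 1 (e / 2 / (1 + Cmod a))); intro Q.
    apply Rle_trans with (Cmod a * (e / 2 / (1 + Cmod a) * Cmod (w - z))).
    - apply Rmult_le_compat_l; [apply Cmod_ge_0|]. apply Rmult_le_compat_r; auto.
    - replace (Cmod a * (e / 2 / (1 + Cmod a) * Cmod (w - z)))
        with (Cmod a * / (1 + Cmod a) * (e / 2 * Cmod (w - z))) by (field; lra).
      rewrite <- (Rmult_1_l (e / 2 * Cmod (w - z))) at 2.
      apply Rmult_le_compat_r; [nra|].
      apply Rmult_le_reg_r with (1 + Cmod a); [lra|]. field_simplify; lra. }
  lra.
Qed.

Lemma cderiv_square (z : C) : cderiv (fun w => w * w)%C z (2 * z)%C.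
Proof.
  intros e He. exists e. split; [exact He|]. intros w Hw.
  replace (w * w - z * z - 2 * z * (w - z))%C with ((w - z) * (w - z))%C by ring.
  rewrite Cmod_mult. apply Rmult_le_compat_r; [apply Cmod_ge_0|lra].
Qed.

Lemma cderiv_scal (f : C -> C) (z a c : C) :
  cderiv f z a -> cderiv (fun w => c * f w)%C z (c * a)%C.
Proof.
  intros F. apply (cderiv_comp (fun w => c * w)%C f); auto.
  eapply cderiv_ext_loc with (f := fun w => (c * w + 0)%C) (r := 1);
    [lra| intros; ring | apply cderiv_affine].
Qed.

(** Polarization: the product is half of [(f + g)^2 - f^2 - g^2], so the chain rule and the
    derivative of the square suffice. *)
Lemma cderiv_mult (f g : C -> C) (z a b : C) :
  cderiv f z a -> cderiv g z b -> cderiv (fun w => f w * g w)%C z (a * g z + f z * b)%C.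
Proof.
  intros F G.
  assert (forall u c, cderiv u z c -> cderiv (fun w => u w * u w)%C z (2 * u z * c)%C) as SQ.
  { intros u c Hu. apply (cderiv_comp (fun w => w * w)%C u); auto. apply cderiv_square. }
  set (h := fun w => (/ 2 * ((f w + g w) * (f w + g w) + - (1) * (f w * f w + g w * g w)))%C).
  apply (cderiv_ext_loc h) with (r := 1); [lra| |].
  { intros w _. unfold h. field. }
  replace (a * g z + f z * b)%C
    with (/ 2 * (2 * (f z + g z) * (a + b) + - (1) * (2 * f z * a + 2 * g z * b)))%C by field.
  apply cderiv_scal. apply cderiv_plus.
  - apply (SQ (fun w => f w + g w)%C). apply cderiv_plus; auto.
  - apply cderiv_scal. apply cderiv_plus; apply SQ; auto.
Qed.

Lemma cderiv_inv (z : C) : z <> 0 -> cderiv (fun w => / w)%C z (- / (z * z))%C.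
Proof.
  intros Hz e He. assert (0 < Cmod z) as P by (apply Cmod_gt_0; exact Hz).
  exists (Rmin (Cmod z / 2) (e * (Cmod z * Cmod z * Cmod z) / 2)). split.
  { apply Rmin_pos; [lra|]. assert (0 < Cmod z * Cmod z * Cmod z) by (repeat apply Rmult_lt_0_compat; auto).
    nra. }
  intros w Hw.
  assert (Cmod (w - z) < Cmod z / 2) as H1 by (eapply Rlt_le_trans; [exact Hw|apply Rmin_l]).
  assert (Cmod (w - z) < e * (Cmod z * Cmod z * Cmod z) / 2) as H2
    by (eapply Rlt_le_trans; [exact Hw|apply Rmin_r]).
  assert (Cmod z / 2 < Cmod w) as H3.
  { generalize (Cmod_sub_ge z w). rewrite Cmod_sub_sym. lra. }
  assert (w <> 0) as Hw0 by (apply Cmod_gt_0; lra).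
  replace (/ w - / z - - / (z * z) * (w - z))%C with ((w - z) * (w - z) * / (w * z * z))%C
    by (field; auto).
  rewrite !Cmod_mult, Cmod_inv by (repeat apply Cmult_neq_0; auto). rewrite !Cmod_mult.
  generalize (Cmod_ge_0 (w - z)); intro P2.
  assert (Cmod z * Cmod z * Cmod z / 2 <= Cmod w * Cmod z * Cmod z).
  { assert (0 < Cmod z * Cmod z) by nra. nra. }
  assert (0 < Cmod z * Cmod z * Cmod z) by (repeat apply Rmult_lt_0_compat; auto).
  apply Rmult_le_reg_r with (Cmod w * Cmod z * Cmod z); [lra|].
  replace (Cmod (w - z) * Cmod (w - z) * / (Cmod w * Cmod z * Cmod z) *
    (Cmod w * Cmod z * Cmod z)) with (Cmod (w - z) * Cmod (w - z)) by (field; lra).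
  assert (Cmod (w - z) <= e * (Cmod w * Cmod z * Cmod z)) by nra.
  nra.
Qed.

Lemma cderiv_mobius (a b c d z : C) : (c * z + d)%C <> 0 ->
  cderiv (fun w => (a * w + b) / (c * w + d))%C z ((a * d - b * c) / ((c * z + d) * (c * z + d)))%C.
Proof.
  intros H.
  replace ((a * d - b * c) / ((c * z + d) * (c * z + d)))%C
    with (a * / (c * z + d) + (a * z + b) * (- / ((c * z + d) * (c * z + d)) * c))%C
    by (field; auto).
  apply (cderiv_mult (fun w => a * w + b)%C (fun w => / (c * w + d))%C).
  - apply cderiv_affine.
  - apply (cderiv_comp (fun w => / w)%C (fun w => c * w + d)%C).
    + apply cderiv_affine.
    + apply cderiv_inv; exact H.
Qed.

Lemma cderiv_inverse (f g : C -> C) (w d : C) (r : R) : 0 < r ->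
  (forall v, Cmod (v - w) < r -> f (g v) = v) ->
  ccont g w -> d <> 0 -> cderiv f (g w) d -> cderiv g w (/ d)%C.
Proof.
  intros Hr E Cg Hd F e He.
  assert (0 < Cmod d) as Pd by (apply Cmod_gt_0; exact Hd).
  set (e' := Rmin (Cmod d / 2) (e * Cmod d * Cmod d / 2)).
  assert (0 < e') as He'.
  { apply Rmin_pos; [lra|]. assert (0 < Cmod d * Cmod d) by nra. nra. }
  destruct (F e' He') as [d1 [Hd1 F1]].
  destruct (Cg (d1 / 2)) as [d2 [Hd2 C2]]; [lra|].
  exists (Rmin r d2). split; [apply Rmin_pos; auto|]. intros v Hv.
  assert (Cmod (v - w) < r) as H1 by (eapply Rlt_le_trans; [exact Hv|apply Rmin_l]).
  assert (Cmod (v - w) < d2) as H2 by (eapply Rlt_le_trans; [exact Hv|apply Rmin_r]).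
  specialize (C2 v H2). specialize (F1 (g v) ltac:(lra)).
  rewrite E in F1 by exact H1.
  rewrite E in F1 by (replace (w - w)%C with (RtoC 0) by ring; rewrite Cmod_0; exact Hr).
  set (u := (g v - g w)%C) in *.
  generalize (Cmod_ge_0 u) (Cmod_ge_0 (v - w)); intros Pu Pv.
  (* The error term absorbs at most half of [Cmod d * Cmod u], so the increment [u] is controlled by
     [v - w], and errors relative to [u] become errors relative to [v - w]. *)
  assert (Cmod u <= 2 / Cmod d * Cmod (v - w)) as HU.
  { assert (Cmod d * Cmod u <= Cmod (v - w) + Cmod d / 2 * Cmod u).
    { rewrite <- Cmod_mult.
      replace (d * u)%C with ((v - w) - (v - w - d * u))%C by ring.
      eapply Rle_trans; [apply Cmod_sub_le|].
      generalize (Rmin_l (Cmod d / 2) (e * Cmod d * Cmod d / 2)). fold e'. intro.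
      nra. }
    apply Rmult_le_reg_l with (Cmod d / 2); [lra|].
    replace (Cmod d / 2 * (2 / Cmod d * Cmod (v - w))) with (Cmod (v - w)) by (field; lra).
    lra. }
  replace (u - / d * (v - w))%C with (- (/ d) * (v - w - d * u))%C by (field; auto).
  rewrite Cmod_mult, Cmod_opp, Cmod_inv by auto.
  generalize (Rmin_r (Cmod d / 2) (e * Cmod d * Cmod d / 2)). fold e'. intro.
  apply Rle_trans with (/ Cmod d * (e' * (2 / Cmod d * Cmod (v - w)))).
  { apply Rmult_le_compat_l; [left; apply Rinv_0_lt_compat; auto|].
    eapply Rle_trans; [exact F1|]. apply Rmult_le_compat_l; lra. }
  apply Rle_trans with (/ Cmod d * ((e * Cmod d * Cmod d / 2) * (2 / Cmod d * Cmod (v - w)))).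
  { apply Rmult_le_compat_l; [left; apply Rinv_0_lt_compat; auto|].
    apply Rmult_le_compat_r; [|lra]. apply Rmult_le_pos; [|exact Pv].
    left; apply Rdiv_lt_0_compat; lra. }
  right; field; lra.
Qed.

(* By the mean value theorem for Re (conj(q) f) on the segment, with q = f b - f a. *)
Lemma cderiv_lipschitz (U : C -> Prop) (f f' : C -> C) (K : R) (a b : C) :
  (forall t, 0 <= t <= 1 -> U (a + t * (b - a))%C) ->
  (forall z, U z -> cderiv f z (f' z)) ->
  (forall z, U z -> Cmod (f' z) <= K) ->
  Cmod (f b - f a) <= K * Cmod (b - a).
Proof.
  intros HU D B.
  assert (0 <= K) as HK.
  { eapply Rle_trans; [apply Cmod_ge_0|apply (B (a + 0 * (b - a))%C)]. apply HU; lra. }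
  destruct (Rle_lt_or_eq_dec 0 (Cmod (f b - f a)) (Cmod_ge_0 _)) as [P|P];
    [|rewrite <- P; apply Rmult_le_pos; auto; apply Cmod_ge_0].
  set (q := Cconj (f b - f a)%C).
  set (h := fun t : R => Re (q * f (a + t * (b - a)))%C).
  set (h' := fun t : R => Re (q * (f' (a + t * (b - a)) * (b - a)))%C).
  assert (forall t, 0 <= t <= 1 -> is_derive h t (h' t)) as Dh.
  { intros t Ht. apply is_derive_Reals. intros e He.
    set (L := 1 + Cmod q * Cmod (b - a)).
    assert (0 < L) as HL by (unfold L; generalize (Cmod_ge_0 q) (Cmod_ge_0 (b - a)); nra).
    destruct (D _ (HU t Ht) (e / 2 / L)) as [dl [Hd H]]; [apply Rdiv_lt_0_compat; lra|].
    set (M := 1 + Cmod (b - a)). assert (0 < M) as HM by (unfold M; generalize (Cmod_ge_0 (b - a)); lra).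
    assert (0 < dl / M) as HdM by (apply Rdiv_lt_0_compat; auto).
    exists (mkposreal _ HdM). intros s Hs0 Hs. simpl in Hs.
    specialize (H (a + (t + s)%R * (b - a))%C).
    replace (a + (t + s)%R * (b - a) - (a + t * (b - a)))%C with (s * (b - a))%C in H
      by (rewrite RtoC_plus; ring).
    rewrite Cmod_mult, Cmod_R in H.
    assert (0 < Rabs s) by (apply Rabs_pos_lt; auto).
    assert (Rabs s * Cmod (b - a) < dl) as H1.
    { apply (Rmult_lt_compat_r M) in Hs; [|lra].
      replace (dl / M * M) with dl in Hs by (field; lra). unfold M in Hs. nra. }
    specialize (H H1).
    unfold h, h'.
    replace ((Re (q * f (a + (t + s)%R * (b - a)))%C - Re (q * f (a + t * (b - a)))%C) / s -
      Re (q * (f' (a + t * (b - a)) * (b - a)))%C) with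
      (/ s * Re (q * (f (a + (t + s)%R * (b - a)) - f (a + t * (b - a)) -
         f' (a + t * (b - a)) * (s * (b - a))))%C).
    2:{ generalize (f (a + (t + s)%R * (b - a))%C) (f (a + t * (b - a))%C) (f' (a + t * (b - a))%C).
        intros [x1 y1] [x2 y2] [x3 y3]. clearbody q. destruct q as [q1 q2].
        destruct (b - a)%C as [e1 e2]. simpl. field. exact Hs0. }
    rewrite Rabs_mult, Rabs_inv by auto.
    apply Rmult_lt_reg_l with (Rabs s); auto.
    rewrite <- Rmult_assoc, Rinv_r, Rmult_1_l by lra.
    eapply Rle_lt_trans; [apply re_le_Cmod|]. rewrite Cmod_mult.
    apply Rle_lt_trans with (Cmod q * (e / 2 / L * (Rabs s * Cmod (b - a)))).
    { apply Rmult_le_compat_l; [apply Cmod_ge_0|exact H]. }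
    replace (Cmod q * (e / 2 / L * (Rabs s * Cmod (b - a)))) with
      (Rabs s * (e / 2) * ((L - 1) / L)) by (unfold L; field; fold L; lra).
    apply Rle_lt_trans with (Rabs s * (e / 2)).
    - rewrite <- (Rmult_1_r (Rabs s * (e / 2))) at 2. apply Rmult_le_compat_l; [nra|].
      apply Rmult_le_reg_r with L; auto. unfold Rdiv. rewrite Rmult_assoc, Rinv_l by lra. lra.
    - nra. }
  destruct (MVT_gen h 0 1 h') as [c [Hc E]].
  { intros x Hx. rewrite Rmin_left, Rmax_right in Hx by lra. apply Dh; lra. }
  { intros x Hx. rewrite Rmin_left, Rmax_right in Hx by lra.
    apply continuity_pt_filterlim.
    apply (ex_derive_continuous (V := R_NormedModule)). exists (h' x). apply Dh; lra. }
  rewrite Rmin_left, Rmax_right in Hc by lra.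
  assert (h 1 - h 0 = Cmod (f b - f a) * Cmod (f b - f a)) as E1.
  { unfold h. replace (a + 1 * (b - a))%C with b by ring.
    replace (a + 0 * (b - a))%C with a by ring.
    replace (Re (q * f b)%C - Re (q * f a)%C) with (Re (Cconj (f b - f a) * (f b - f a))%C).
    - rewrite Cmult_comm. rewrite <- Cmod2_conj. simpl. ring.
    - fold q. clearbody q. destruct q, (f a), (f b); simpl; ring. }
  assert (h 1 - h 0 <= Cmod (f b - f a) * (K * Cmod (b - a))) as E2.
  { rewrite E. unfold h'. replace (1 - 0) with 1 by ring. rewrite Rmult_1_r.
    eapply Rle_trans; [apply Rle_abs|]. eapply Rle_trans; [apply re_le_Cmod|].
    rewrite !Cmod_mult. unfold q. rewrite Cmod_conj.
    apply Rmult_le_compat_l; [apply Cmod_ge_0|].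
    apply Rmult_le_compat_r; [apply Cmod_ge_0|]. apply B, HU; lra. }
  rewrite E1 in E2. apply Rmult_le_reg_l in E2; auto.
Qed.

(** * Goursat's lemma and the mean value property *)

Section SquareInduction.
Variable P : R -> R -> R -> Prop.

(** Picks a quarter on which [P] fails. The fourth one is the default: if [P] holds on the other
    three and fails on the whole square, it must fail there. *)
Definition quarter (s : R * R * R) : R * R * R :=
  let '(a, b, l) := s in
  if excluded_middle_informative (P a b (l / 2)) then
    if excluded_middle_informative (P (a + l / 2) b (l / 2)) then
      if excluded_middle_informative (P a (b + l / 2) (l / 2)) then (a + l / 2, b + l / 2, l / 2)
      else (a, b + l / 2, l / 2)
    else (a + l / 2, b, l / 2)
  else (a, b, l / 2).

(** Bisection in the style of Cousin: nested failing squares would shrink to a point, where the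
    local hypothesis is violated. This yields both Goursat's lemma and the compactness of closed
    discs. *)
Lemma square_induction (a b l : R) : 0 < l ->
  (forall a b l, 0 < l -> P a b (l / 2) -> P (a + l / 2) b (l / 2) ->
     P a (b + l / 2) (l / 2) -> P (a + l / 2) (b + l / 2) (l / 2) -> P a b l) ->
  (forall x y, a <= x <= a + l -> b <= y <= b + l -> exists d, 0 < d /\
     forall a' b' l', 0 < l' < d -> a' <= x <= a' + l' -> b' <= y <= b' + l' -> P a' b' l') ->
  P a b l.
Proof.
  intros Hl Hq Hloc. apply NNPP. intro HN.
  set (sq := fun n => Nat.iter n quarter (a, b, l)).
  set (A := fun n => fst (fst (sq n))). set (B := fun n => snd (fst (sq n))).
  set (L := fun n => snd (sq n)).
  assert (forall n, L (S n) = L n / 2 /\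
    (A (S n) = A n \/ A (S n) = A n + L n / 2) /\ (B (S n) = B n \/ B (S n) = B n + L n / 2)) as Hstep.
  { intro n. unfold L, A, B, sq. simpl.
    destruct (Nat.iter n quarter (a, b, l)) as [[u v] w]. simpl.
    repeat destruct excluded_middle_informative; simpl; auto. }
  assert (forall n, 0 < L n) as HL.
  { induction n; [exact Hl|]. destruct (Hstep n) as [-> _]. lra. }
  assert (forall n, ~ P (A n) (B n) (L n)) as HNP.
  { induction n; [exact HN|]. revert IHn. specialize (HL n). revert HL.
    unfold L, A, B, sq. simpl.
    destruct (Nat.iter n quarter (a, b, l)) as [[u v] w]. simpl. intros Hw HP.
    repeat destruct excluded_middle_informative; simpl; auto. }
  assert (forall n, L n = l / 2 ^ n) as HLn.
  { induction n; [unfold L, sq; simpl; field|]. destruct (Hstep n) as [-> _]. rewrite IHn.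
    simpl. field. apply pow_nonzero; lra. }
  assert (forall n m, A n <= A (n + m)%nat /\ A (n + m)%nat + L (n + m)%nat <= A n + L n) as HA.
  { intros n m. induction m; [rewrite Nat.add_0_r; lra|]. rewrite Nat.add_succ_r.
    destruct (Hstep (n + m)%nat) as [-> [[->| ->] _]]; specialize (HL (n + m)%nat); lra. }
  assert (forall n m, B n <= B (n + m)%nat /\ B (n + m)%nat + L (n + m)%nat <= B n + L n) as HB.
  { intros n m. induction m; [rewrite Nat.add_0_r; lra|]. rewrite Nat.add_succ_r.
    destruct (Hstep (n + m)%nat) as [-> [_ [->| ->]]]; specialize (HL (n + m)%nat); lra. }
  assert (forall S : nat -> R, (forall n m, S n <= S (n + m)%nat /\ S (n + m)%nat + L (n + m)%nat <= S n + L n) ->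
    exists x, forall n, S n <= x <= S n + L n) as lim.
  { intros S HS.
    destruct (completeness (fun z => exists n, z = S n)) as [x [Hx1 Hx2]].
    - exists (S O + L O). intros z [n ->]. generalize (HS O n) (HL n). simpl. lra.
    - exists (S O). exists O. reflexivity.
    - exists x. intro n. split; [apply Hx1; exists n; reflexivity|].
      apply Hx2. intros z [m ->].
      destruct (Nat.le_ge_cases n m) as [Hm|Hm].
      + replace m with (n + (m - n))%nat by lia. generalize (HS n (m - n)%nat) (HL (n + (m - n))%nat). lra.
      + generalize (HS m (n - m)%nat) (HL n). replace (m + (n - m))%nat with n by lia. lra. }
  destruct (lim A HA) as [x Hx]. destruct (lim B HB) as [y Hy].
  destruct (Hloc x y) as [d [Hd Hd']]; [apply (Hx O)|apply (Hy O)|].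
  assert (exists n, L n < d) as [n Hn].
  { assert (is_lim_seq (fun n => l * (/ 2) ^ n) (Rbar_mult l 0)) as Hlim.
    { apply is_lim_seq_scal_l. apply is_lim_seq_geom. rewrite Rabs_pos_eq; lra. }
    simpl in Hlim. rewrite Rmult_0_r in Hlim.
    apply is_lim_seq_spec in Hlim. destruct (Hlim (mkposreal d Hd)) as [N HNN].
    exists N. specialize (HNN N (le_n N)). simpl in HNN.
    rewrite Rminus_0_r, pow_inv in HNN. rewrite HLn. eapply Rle_lt_trans; [apply Rle_abs|exact HNN]. }
  apply (HNP n). apply Hd'; auto.
Qed.
End SquareInduction.

Lemma RInt_near_const (f : R -> R) (a l c k : R) : 0 <= l -> ex_RInt f a (a + l) ->
  (forall x, a <= x <= a + l -> Rabs (f x - c) <= k) ->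
  Rabs (RInt f a (a + l) - l * c) <= l * k.
Proof.
  intros Hl I B.
  assert (is_RInt (fun x => minus (f x) c) a (a + l) (minus (RInt f a (a + l)) (scal (a + l - a) c))) as I2.
  { apply (is_RInt_minus (V := R_NormedModule)); [apply (RInt_correct (V := R_CompleteNormedModule)); exact I|].
    apply (is_RInt_const (V := R_NormedModule)). }
  replace (RInt f a (a + l) - l * c) with (minus (RInt f a (a + l)) (scal (a + l - a) c)).
  2:{ unfold minus, scal, plus, opp; simpl. unfold mult; simpl. ring. }
  replace (l * k) with ((a + l - a) * k) by ring.
  apply (norm_RInt_le_const (V := R_NormedModule) (fun x => minus (f x) c) a (a + l)); [lra| |exact I2].
  intros x Hx. exact (B x Hx).
Qed.

Lemma ccont_continuous_line (h : C -> C) (p : R -> C) (F : C -> R) (t : R) :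
  (forall z w, Rabs (F z - F w) <= Cmod (z - w)) ->
  (forall s s', Cmod (p s - p s') <= Rabs (s - s')) ->
  ccont h (p t) -> continuous (fun s => F (h (p s))) t.
Proof.
  intros HF Hp Hc. apply continuity_pt_filterlim. intros e He.
  destruct (Hc (e / 2)) as [d [Hd H]]; [lra|].
  exists d. split; [exact Hd|]. intros s [_ Hs]. simpl in *. unfold R_dist in *.
  eapply Rle_lt_trans; [apply HF|]. eapply Rle_lt_trans; [apply H|lra].
  eapply Rle_lt_trans; [apply Hp|exact Hs].
Qed.

Lemma Re_dist (z w : C) : Rabs (Re z - Re w) <= Cmod (z - w).
Proof. replace (Re z - Re w) with (Re (z - w)%C) by (destruct z, w; reflexivity). apply re_le_Cmod. Qed.
Lemma Im_dist (z w : C) : Rabs (Im z - Im w) <= Cmod (z - w).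
Proof. replace (Im z - Im w) with (Im (z - w)%C) by (destruct z, w; reflexivity). apply im_le_Cmod. Qed.
Lemma hline_dist (y s s' : R) : Cmod (((s, y) : C) - (s', y)) <= Rabs (s - s').
Proof.
  eapply Rle_trans; [apply Cmod_le_sum|]. simpl.
  replace (y + - y) with 0 by ring. rewrite Rabs_R0. unfold Rminus. lra.
Qed.
Lemma vline_dist (x s s' : R) : Cmod (((x, s) : C) - (x, s')) <= Rabs (s - s').
Proof.
  eapply Rle_trans; [apply Cmod_le_sum|]. simpl.
  replace (x + - x) with 0 by ring. rewrite Rabs_R0. unfold Rminus. lra.
Qed.

Section Goursat.
Variables (h : C -> C) (c : R).
Hypothesis Dh : forall x y, x < c -> exists d, cderiv h (x, y) d.

(* Im of the integral of h around the square, i.e. of (Re h) dy + (Im h) dx. *)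
Definition circulation (a b l : R) : R :=
  RInt (fun y => Re (h (a + l, y)) - Re (h (a, y))) b (b + l)
  - RInt (fun x => Im (h (x, b + l)) - Im (h (x, b))) a (a + l).

Lemma ccont_h (x y : R) : x < c -> ccont h (x, y).
Proof. intro H. destruct (Dh x y H) as [d Hd]. eapply cderiv_cont; eauto. Qed.

Lemma ex_RInt_Re (x b b' : R) : x < c -> ex_RInt (fun y => Re (h (x, y))) b b'.
Proof.
  intros H. apply (ex_RInt_continuous (V := R_CompleteNormedModule)). intros y _.
  apply (ccont_continuous_line h (fun y => (x, y)) Re); [apply Re_dist|apply vline_dist|].
  apply ccont_h, H.
Qed.

Lemma ex_RInt_Im (y a a' : R) : a < c -> a' < c -> ex_RInt (fun x => Im (h (x, y))) a a'.
Proof.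
  intros H H'. apply (ex_RInt_continuous (V := R_CompleteNormedModule)). intros x Hx.
  apply (ccont_continuous_line h (fun x => (x, y)) Im); [apply Im_dist|apply hline_dist|].
  apply ccont_h. eapply Rle_lt_trans; [apply Hx|]. apply Rmax_lub_lt; auto.
Qed.

Lemma circulation_split (a b l : R) : 0 < l -> a + l < c ->
  circulation a b l =
  RInt (fun y => Re (h (a + l, y))) b (b + l) - RInt (fun y => Re (h (a, y))) b (b + l)
  - (RInt (fun x => Im (h (x, b + l))) a (a + l) - RInt (fun x => Im (h (x, b))) a (a + l)).
Proof.
  intros Hl H. unfold circulation. f_equal.
  - apply (RInt_minus (V := R_CompleteNormedModule)); apply ex_RInt_Re; lra.
  - f_equal. apply (RInt_minus (V := R_CompleteNormedModule)); apply ex_RInt_Im; lra.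
Qed.

(** The bound is proportional to the area, hence additive over quarter squares. On a small square
    [h] is nearly affine with slope [d], and for an affine function both integrals equal
    [l * (l * Re d)] and cancel. *)
Lemma circulation_le (e a b l : R) : 0 < e -> 0 < l -> a + l < c ->
  Rabs (circulation a b l) <= e * l ^ 2.
Proof.
  intros He Hl. apply (square_induction (fun a b l => a + l < c -> Rabs (circulation a b l) <= e * l ^ 2));
    [exact Hl| |].
  - clear a b l Hl. intros a b l Hl H1 H2 H3 H4 H.
    specialize (H1 ltac:(lra)). specialize (H2 ltac:(lra)).
    specialize (H3 ltac:(lra)). specialize (H4 ltac:(lra)).
    rewrite circulation_split in * by lra.
    replace (a + l / 2 + l / 2) with (a + l) in * by field.
    replace (b + l / 2 + l / 2) with (b + l) in * by field.
    assert (forall x, x < c -> RInt (fun y => Re (h (x, y))) b (b + l) =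
      RInt (fun y => Re (h (x, y))) b (b + l / 2) + RInt (fun y => Re (h (x, y))) (b + l / 2) (b + l)) as SR.
    { intros x Hx. symmetry. apply (RInt_Chasles (V := R_CompleteNormedModule)); apply ex_RInt_Re; lra. }
    assert (forall y, RInt (fun x => Im (h (x, y))) a (a + l) =
      RInt (fun x => Im (h (x, y))) a (a + l / 2) + RInt (fun x => Im (h (x, y))) (a + l / 2) (a + l)) as SI.
    { intros y. symmetry. apply (RInt_Chasles (V := R_CompleteNormedModule)); apply ex_RInt_Im; lra. }
    rewrite !SR, !SI by lra.
    apply Rabs_le_between in H1, H2, H3, H4. apply Rabs_le_between. nra.
  - intros x y _ _. destruct (Rlt_dec x c) as [Hx|Hx].
    (* No square with [a + l < c] contains such a point, so any radius does. *)
    2:{ exists 1. split; [lra|]. intros; lra. }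
    (* Points of the square are within [2 * l] of [(x, y)], which gives an error [e / 4 * l] per
       point; two points per integrand and two integrals of length [l] add up to [e * l ^ 2]. *)
    destruct (Dh x y Hx) as [d Hd]. destruct (Hd (e / 8)) as [dl [Hdl D]]; [lra|].
    exists (dl / 2). split; [lra|]. clear a b l Hl. intros a b l Hl Ha Hb H.
    assert (forall z : C, a <= Re z <= a + l -> b <= Im z <= b + l ->
      Cmod (h z - h (x, y) - d * (z - (x, y))) <= e / 4 * l) as E.
    { intros z Hz1 Hz2.
      assert (Cmod (z - (x, y)) <= 2 * l) as Hz.
      { eapply Rle_trans; [apply Cmod_le_sum|]. destruct z as [z1 z2]; simpl in *.
        assert (Rabs (z1 + - x) <= l) by (apply Rabs_le_between; lra).
        assert (Rabs (z2 + - y) <= l) by (apply Rabs_le_between; lra). lra. }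
      eapply Rle_trans; [apply D; lra|]. nra. }
    unfold circulation.
    assert (Rabs (RInt (fun y => Re (h (a + l, y)) - Re (h (a, y))) b (b + l) - l * (l * Re d)) <= l * (e / 2 * l)) as B1.
    { apply RInt_near_const; [lra| |].
      { apply (ex_RInt_minus (V := R_CompleteNormedModule)); apply ex_RInt_Re; lra. }
      intros v Hv.
      replace (Re (h (a + l, v)) - Re (h (a, v)) - l * Re d) with
        (Re ((h ((a + l)%R, v) - h (x, y) - d * (((a + l)%R, v) - (x, y))) -
             (h (a, v) - h (x, y) - d * ((a, v) - (x, y))))%C).
      2:{ destruct (h (a + l, v)), (h (a, v)), (h (x, y)), d; simpl; ring. }
      eapply Rle_trans; [apply re_le_Cmod|]. eapply Rle_trans; [apply Cmod_sub_le|].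
      generalize (E (a + l, v)) (E (a, v)); simpl. intros E1 E2.
      specialize (E1 ltac:(lra) ltac:(lra)). specialize (E2 ltac:(lra) ltac:(lra)). lra. }
    assert (Rabs (RInt (fun x => Im (h (x, b + l)) - Im (h (x, b))) a (a + l) - l * (l * Re d)) <= l * (e / 2 * l)) as B2.
    { apply RInt_near_const; [lra| |].
      { apply (ex_RInt_minus (V := R_CompleteNormedModule)); apply ex_RInt_Im; lra. }
      intros u Hu.
      replace (Im (h (u, b + l)) - Im (h (u, b)) - l * Re d) with
        (Im ((h (u, (b + l)%R) - h (x, y) - d * ((u, (b + l)%R) - (x, y))) -
             (h (u, b) - h (x, y) - d * ((u, b) - (x, y))))%C).
      2:{ destruct (h (u, b + l)), (h (u, b)), (h (x, y)), d; simpl; ring. }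
      eapply Rle_trans; [apply im_le_Cmod|]. eapply Rle_trans; [apply Cmod_sub_le|].
      generalize (E (u, b + l)) (E (u, b)); simpl. intros E1 E2.
      specialize (E1 ltac:(lra) ltac:(lra)). specialize (E2 ltac:(lra) ltac:(lra)). lra. }
    apply Rabs_le_between in B1, B2. apply Rabs_le_between. nra.
Qed.

Lemma goursat_square (a b l : R) : 0 < l -> a + l < c -> circulation a b l = 0.
Proof.
  intros Hl H. destruct (Req_dec (circulation a b l) 0) as [E|E]; [exact E|exfalso].
  apply Rabs_pos_lt in E. assert (0 < l ^ 2) by (apply pow_lt; auto).
  generalize (circulation_le (Rabs (circulation a b l) / 2 / l ^ 2) a b l
    ltac:(apply Rdiv_lt_0_compat; lra) Hl H).
  replace (Rabs (circulation a b l) / 2 / l ^ 2 * l ^ 2) with (Rabs (circulation a b l) / 2)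
    by (field; lra). lra.
Qed.
End Goursat.

(** * The complex exponential and averages over circles *)

Definition cexp (z : C) : C := (exp (Re z) * cos (Im z), exp (Re z) * sin (Im z)).

Lemma Cmod_cexp (z : C) : Cmod (cexp z) = exp (Re z).
Proof.
  destruct z as [x y]. unfold Cmod, cexp. simpl.
  replace (exp x * cos y * (exp x * cos y * 1) + exp x * sin y * (exp x * sin y * 1)) with
    (exp x * exp x * (Rsqr (sin y) + Rsqr (cos y))) by (unfold Rsqr; ring).
  rewrite sin2_cos2, Rmult_1_r. apply sqrt_square. left; apply exp_pos.
Qed.

Lemma cexp_plus (z w : C) : cexp (z + w) = (cexp z * cexp w)%C.
Proof.
  destruct z as [x y], w as [u v]. unfold cexp, Cmult, Cplus. simpl.
  rewrite exp_plus, cos_plus, sin_plus. f_equal; ring.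
Qed.

Lemma is_derive_small (f : R -> R) (x d e : R) : is_derive f x d -> 0 < e ->
  exists dl, 0 < dl /\ forall h, Rabs h < dl -> Rabs (f (x + h) - f x - d * h) <= e * Rabs h.
Proof.
  intros [_ H] He. specialize (H x (fun P HP => HP) (mkposreal e He)).
  destruct H as [dl H]. exists dl. split; [apply cond_pos|]. intros h Hh.
  assert (ball x dl (x + h)) as Hb.
  { unfold ball; simpl. unfold AbsRing_ball, abs, minus, plus, opp; simpl.
    replace (x + h + - x) with h by ring. exact Hh. }
  specialize (H (x + h) Hb). unfold norm, minus, plus, opp, scal in H; simpl in H.
  unfold abs, mult in H; simpl in H.
  replace (f (x + h) - f x - d * h) with (f (x + h) + - f x + - ((x + h + - x) * d)) by ring.
  replace (Rabs h) with (Rabs (x + h + - x)) by (f_equal; ring). exact H.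
Qed.

Lemma cderiv_cexp_0 : cderiv cexp 0 1.
Proof.
  intros e He. set (k := Rmin 1 (e / 8)).
  assert (0 < k) as Hk by (apply Rmin_pos; lra).
  assert (k <= 1) by apply Rmin_l. assert (k <= e / 8) by apply Rmin_r.
  destruct (is_derive_small exp 0 1 k) as [d1 [Hd1 E1]]; auto.
  { generalize (is_derive_exp 0). rewrite exp_0. auto. }
  destruct (is_derive_small sin 0 1 k) as [d2 [Hd2 E2]]; auto.
  { generalize (is_derive_sin 0). rewrite cos_0. auto. }
  destruct (is_derive_small cos 0 0 k) as [d3 [Hd3 E3]]; auto.
  { generalize (is_derive_cos 0). rewrite sin_0, Ropp_0. auto. }
  exists (Rmin (Rmin d1 d2) (Rmin d3 k)). split; [repeat apply Rmin_pos; auto; lra|].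
  intros w Hw. replace (w - 0)%C with w in * by ring.
  apply Rmin_Rgt_l in Hw. destruct Hw as [Hw1 Hw2].
  apply Rmin_Rgt_l in Hw1, Hw2.
  generalize (re_le_Cmod w) (im_le_Cmod w). destruct w as [x y]. simpl. intros Hx Hy.
  specialize (E1 x ltac:(lra)). specialize (E2 y ltac:(lra)). specialize (E3 y ltac:(lra)).
  rewrite Rplus_0_l in E1, E2, E3. rewrite exp_0 in E1. rewrite sin_0 in E2. rewrite cos_0 in E3.
  set (m := Cmod (x, y)) in *. assert (0 <= m) by apply Cmod_ge_0.
  eapply Rle_trans; [apply Cmod_le_sum|].
  replace (cexp 0) with (RtoC 1).
  2:{ unfold cexp. simpl. rewrite exp_0, cos_0, sin_0. unfold RtoC. f_equal; ring. }
  unfold cexp; simpl.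
  assert (Rabs (cos y) <= 1) by (apply Rabs_le; generalize (COS_bound y); lra).
  assert (Rabs (exp x - 1 - 1 * x) <= k * m) by nra.
  assert (Rabs (cos y - 1 - 0 * y) <= k * m) by nra.
  assert (Rabs (sin y - 0 - 1 * y) <= k * m) by nra.
  assert (Rabs (1 + x) <= 2).
  { eapply Rle_trans; [apply Rabs_triang|]. rewrite Rabs_R1. lra. }
  assert (Rabs (exp x - 1) <= 2 * m).
  { replace (exp x - 1) with (exp x - 1 - 1 * x + x) by ring.
    eapply Rle_trans; [apply Rabs_triang|]. nra. }
  assert (Rabs (sin y) <= 2 * k).
  { replace (sin y) with (sin y - 0 - 1 * y + y) by ring.
    eapply Rle_trans; [apply Rabs_triang|]. nra. }
  assert (Rabs (exp x * cos y + - (1) + - (1 * x - 0 * y)) <= 3 * k * m).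
  { replace (exp x * cos y + - (1) + - (1 * x - 0 * y)) with
      ((exp x - 1 - 1 * x) * cos y + (1 + x) * (cos y - 1 - 0 * y)) by ring.
    eapply Rle_trans; [apply Rabs_triang|]. rewrite !Rabs_mult.
    generalize (Rabs_pos (cos y)) (Rabs_pos (exp x - 1 - 1 * x)) (Rabs_pos (1 + x)) (Rabs_pos (cos y - 1 - 0 * y)).
    nra. }
  assert (Rabs (exp x * sin y + - 0 + - (1 * y + 0 * x)) <= 5 * k * m).
  { replace (exp x * sin y + - 0 + - (1 * y + 0 * x)) with
      ((exp x - 1) * sin y + (sin y - 0 - 1 * y)) by ring.
    eapply Rle_trans; [apply Rabs_triang|]. rewrite !Rabs_mult.
    generalize (Rabs_pos (exp x - 1)) (Rabs_pos (sin y)). nra. }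
  nra.
Qed.

Lemma cderiv_cexp (z : C) : cderiv cexp z (cexp z).
Proof.
  apply (cderiv_ext_loc (fun w => cexp z * cexp (w + - z))%C) with (r := 1); [lra| |].
  { intros w _. rewrite <- cexp_plus. f_equal. ring. }
  assert (cderiv (fun w => cexp (w + - z)) z (1 * 1))%C as H.
  2:{ generalize (cderiv_scal _ _ _ (cexp z) H). rewrite !Cmult_1_r. auto. }
  apply (cderiv_comp cexp (fun w => w + - z)%C).
  - apply (cderiv_ext_loc (fun w => 1 * w + - z)%C) with (r := 1); [lra| |apply cderiv_affine].
    intros; ring.
  - replace (z + - z)%C with (RtoC 0) by ring. apply cderiv_cexp_0.
Qed.

Definition circ (a : C) (r t : R) : C := (a + cexp (ln r, t))%C.

Lemma Cmod_circ (a : C) (r t : R) : 0 < r -> Cmod (circ a r t - a) = r.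
Proof.
  intros Hr. unfold circ. replace (a + cexp (ln r, t) - a)%C with (cexp (ln r, t)) by ring.
  rewrite Cmod_cexp. simpl. apply exp_ln, Hr.
Qed.

(* In the coordinate log(z - a) circles about a become vertical segments of
   length 2 pi, and the horizontal sides of the Goursat square cancel. *)
Lemma mean_value (f : C -> C) (a : C) (r0 r : R) : 0 < r < r0 ->
  (forall z, 0 < Cmod (z - a) < r0 -> exists d, cderiv f z d) -> ccont f a ->
  is_RInt (fun t => Re (f (circ a r t))) 0 (2 * PI) (2 * PI * Re (f a)).
Proof.
  intros Hr D Hc. generalize PI_RGT_0; intro HPI.
  set (h := fun w => f (a + cexp w)%C).
  assert (forall x y, x < ln r0 -> exists d, cderiv h (x, y) d) as Dh.
  { intros x y Hx.
    destruct (D (a + cexp (x, y))%C) as [d Hd].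
    { replace (a + cexp (x, y) - a)%C with (cexp (x, y)) by ring. rewrite Cmod_cexp. simpl.
      split; [apply exp_pos|]. rewrite <- (exp_ln r0) by lra. apply exp_increasing, Hx. }
    exists (d * (0 + cexp (x, y)))%C. apply (cderiv_comp f (fun w => a + cexp w)%C); auto.
    apply cderiv_plus; [apply cderiv_const|apply cderiv_cexp]. }
  set (I := fun x => RInt (fun y => Re (h (x, y))) 0 (2 * PI)).
  assert (forall x, x < ln r0 -> I x = I (x - 2 * PI)) as HI.
  { intros x Hx.
    generalize (goursat_square h (ln r0) Dh (x - 2 * PI) 0 (2 * PI) ltac:(lra) ltac:(lra)).
    rewrite (circulation_split h (ln r0) Dh) by lra.
    replace (x - 2 * PI + 2 * PI) with x by ring. rewrite Rplus_0_l. unfold I.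
    rewrite (RInt_ext (fun x0 => Im (h (x0, 2 * PI))) (fun x0 => Im (h (x0, 0)))); [lra|].
    intros t _. unfold h, cexp. simpl. rewrite cos_2PI, sin_2PI, cos_0, sin_0. reflexivity. }
  assert (forall n x, x < ln r0 -> I x = I (x - INR n * (2 * PI))) as HIn.
  { induction n; intros x Hx.
    - f_equal. simpl. ring.
    - rewrite IHn by auto. rewrite HI.
      + f_equal. rewrite S_INR. ring.
      + generalize (pos_INR n). nra. }
  assert (forall y, continuous (fun y => Re (h (ln r, y))) y) as CI.
  { intro y. apply (ccont_continuous_line h (fun y => (ln r, y)) Re); [apply Re_dist|apply vline_dist|].
    apply (ccont_h h (ln r0) Dh). apply ln_increasing; lra. }
  assert (I (ln r) = 2 * PI * Re (f a)) as E.
  { apply Rminus_diag_uniq. apply NNPP. intro N. apply Rabs_pos_lt in N.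
    set (e := Rabs (I (ln r) - 2 * PI * Re (f a)) / 2 / (2 * PI)).
    assert (0 < e) as He by (unfold e; apply Rdiv_lt_0_compat; lra).
    destruct (Hc e He) as [dl [Hdl Hcl]].
    (* Enough shifts by [2 * PI] lead to a circle of radius below [dl], where continuity at [a]
       gives the average up to [e]. *)
    destruct (INR_unbounded ((ln r - ln dl) / (2 * PI))) as [n Hn].
    set (x := ln r - INR n * (2 * PI)).
    assert (x < ln dl) as Hx.
    { unfold x. apply (Rmult_lt_compat_r (2 * PI)) in Hn; [|lra].
      replace ((ln r - ln dl) / (2 * PI) * (2 * PI)) with (ln r - ln dl) in Hn by (field; lra). lra. }
    assert (ln r < ln r0) as Hlr by (apply ln_increasing; lra).
    assert (x < ln r0) as Hx0 by (unfold x; generalize (pos_INR n); nra).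
    assert (Rabs (I x - 2 * PI * Re (f a)) <= 2 * PI * e) as B.
    { unfold I. generalize (RInt_near_const (fun y => Re (h (x, y))) 0 (2 * PI) (Re (f a)) e).
      rewrite Rplus_0_l. intro B. apply B; [lra| |].
      - apply (ex_RInt_Re h (ln r0) Dh); exact Hx0.
      - intros y _. eapply Rle_trans; [apply Re_dist|]. unfold h. apply Hcl.
        replace (a + cexp (x, y) - a)%C with (cexp (x, y)) by ring. rewrite Cmod_cexp. simpl.
        rewrite <- (exp_ln dl) by lra. apply exp_increasing, Hx. }
    rewrite (HIn n (ln r)) in N by auto. fold x in N.
    unfold e in B. rewrite (HIn n (ln r)) in B by auto. fold x in B.
    replace (2 * PI * (Rabs (I x - 2 * PI * Re (f a)) / 2 / (2 * PI))) with
     (Rabs (I x - 2 * PI * Re (f a)) / 2) in B by (field; lra). lra. }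
  rewrite <- E. apply (RInt_correct (V := R_CompleteNormedModule)).
  apply (ex_RInt_continuous (V := R_CompleteNormedModule)). intros y _. exact (CI y).
Qed.

(** * The maximum principle and the automorphisms of the disc *)

(** Compactness of the disc, phrased for local upper bounds. The class [ok] is left open so that the
    same statement gives boundedness and, for bounds below the supremum, attainment. *)
Lemma disc_finite_cover (ok : R -> Prop) (v : C -> R) (r : R) : 0 < r ->
  (exists M, ok M) -> (forall M M', ok M -> ok M' -> ok (Rmax M M')) ->
  (forall p, Cmod p <= r -> exists M d, ok M /\ 0 < d /\
     forall w, Cmod w <= r -> Cmod (w - p) < d -> v w <= M) ->
  exists M, ok M /\ forall w, Cmod w <= r -> v w <= M.
Proof.
  intros Hr [M0 HM0] Hmax Hloc.
  destruct (square_induction (fun a b l => exists M, ok M /\ forall w, Cmod w <= r ->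
    a <= Re w <= a + l -> b <= Im w <= b + l -> v w <= M) (- r) (- r) (2 * r)) as [M [H1 H2]].
  - lra.
  - intros a b l Hl [M1 [O1 H1]] [M2 [O2 H2]] [M3 [O3 H3]] [M4 [O4 H4]].
    exists (Rmax (Rmax M1 M2) (Rmax M3 M4)). split; [auto|]. intros w Hw Ha Hb.
    generalize (Rmax_l (Rmax M1 M2) (Rmax M3 M4)) (Rmax_r (Rmax M1 M2) (Rmax M3 M4))
      (Rmax_l M1 M2) (Rmax_r M1 M2) (Rmax_l M3 M4) (Rmax_r M3 M4). intros.
    destruct (Rle_dec (Re w) (a + l / 2)), (Rle_dec (Im w) (b + l / 2)).
    + specialize (H1 w Hw ltac:(lra) ltac:(lra)). lra.
    + specialize (H3 w Hw ltac:(lra) ltac:(lra)). lra.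
    + specialize (H2 w Hw ltac:(lra) ltac:(lra)). lra.
    + specialize (H4 w Hw ltac:(lra) ltac:(lra)). lra.
  - intros x y _ _.
    assert (forall d, 0 < d -> forall a b l, 0 < l < d / 2 -> a <= x <= a + l -> b <= y <= b + l ->
      forall w, a <= Re w <= a + l -> b <= Im w <= b + l -> Cmod (w - (x, y)) < d) as near.
    { intros d Hd a b l Hl Ha Hb [w1 w2] H1 H2. simpl in *.
      eapply Rle_lt_trans; [apply Cmod_le_sum|]. simpl.
      assert (Rabs (w1 + - x) <= l) by (apply Rabs_le_between; lra).
      assert (Rabs (w2 + - y) <= l) by (apply Rabs_le_between; lra). lra. }
    destruct (Rle_dec (Cmod (x, y)) r) as [Hp|Hp].
    + destruct (Hloc _ Hp) as [M [d [HM [Hd H]]]]. exists (d / 2). split; [lra|].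
      intros a b l Hl Ha Hb. exists M. split; [exact HM|]. intros w Hw H1 H2.
      apply H; [exact Hw|]. eapply near; eauto.
    (* A point outside the disc has a neighbourhood that misses the disc, so any admissible bound
       serves there. *)
    + exists ((Cmod (x, y) - r) / 2). split; [lra|]. intros a b l Hl Ha Hb. exists M0.
      split; [exact HM0|]. intros w Hw H1 H2. exfalso.
      assert (Cmod (w - (x, y)) < Cmod (x, y) - r) as H3 by (eapply near; eauto; lra).
      generalize (Cmod_sub_ge (x, y) w). rewrite Cmod_sub_sym. lra.
  - exists M. split; [exact H1|]. intros w Hw.
    generalize (re_le_Cmod w) (im_le_Cmod w). intros A B.
    apply Rabs_le_between in A. apply Rabs_le_between in B. apply H2; lra.
Qed.

(** If the supremum were not attained, semicontinuity would give every point a local bound strictly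
    below it, and the covering lemma a global one. *)
Lemma disc_max (v : C -> R) (r : R) : 0 < r ->
  (forall p, Cmod p <= r -> forall e, 0 < e -> exists d, 0 < d /\
     forall w, Cmod w <= r -> Cmod (w - p) < d -> v w <= v p + e) ->
  exists a, Cmod a <= r /\ forall z, Cmod z <= r -> v z <= v a.
Proof.
  intros Hr Hc.
  destruct (disc_finite_cover (fun _ => True) v r Hr) as [M0 [_ HM0]]; auto.
  { exists 0. auto. }
  { intros p Hp. destruct (Hc p Hp 1 Rlt_0_1) as [d [Hd H]]. exists (v p + 1), d. auto. }
  destruct (completeness (fun y => exists z, Cmod z <= r /\ y = v z)) as [M [HM1 HM2]].
  - exists M0. intros y [z [Hz ->]]. auto.
  - exists (v 0), 0%C. rewrite Cmod_0. split; [lra|reflexivity].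
  - apply NNPP. intro N.
    assert (forall p, Cmod p <= r -> v p < M) as Hlt.
    { intros p Hp. destruct (Rlt_dec (v p) M) as [H|H]; [exact H|exfalso].
      apply N. exists p. split; [exact Hp|]. intros z Hz.
      apply Rle_trans with M; [|lra]. apply HM1. exists z. auto. }
    destruct (disc_finite_cover (fun M' => M' < M) v r Hr) as [M' [H1 H2]].
    + exists (M - 1). lra.
    + intros x y Hx Hy. apply Rmax_lub_lt; auto.
    + intros p Hp. generalize (Hlt p Hp). intro L.
      destruct (Hc p Hp ((M - v p) / 2)) as [d [Hd H]]; [lra|].
      exists (v p + (M - v p) / 2), d. split; [lra|]. auto.
    + apply (Rlt_irrefl M). eapply Rle_lt_trans; [|exact H1].
      apply HM2. intros y [z [Hz ->]]. auto.
Qed.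

(** On a circle |z|^2 is a trigonometric polynomial of degree one; this computes its mean. *)
Lemma is_RInt_trig (k a b : R) :
  is_RInt (fun t => k + a * cos t + b * sin t) 0 (2 * PI) (2 * PI * k).
Proof.
  assert (is_RInt (fun t => k + a * cos t + b * sin t) 0 (2 * PI)
    (minus ((fun t => k * t + a * sin t - b * cos t) (2 * PI))
           ((fun t => k * t + a * sin t - b * cos t) 0))) as H.
  { apply (is_RInt_derive (V := R_CompleteNormedModule) (fun t => k * t + a * sin t - b * cos t)).
    - intros x _. auto_derive; auto. ring.
    - intros x _. apply (ex_derive_continuous (V := R_NormedModule)). auto_derive. auto. }
  replace (2 * PI * k) with (minus ((fun t => k * t + a * sin t - b * cos t) (2 * PI))
           ((fun t => k * t + a * sin t - b * cos t) 0)); [exact H|].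
  unfold minus, plus, opp; simpl. rewrite sin_2PI, cos_2PI, sin_0, cos_0. ring.
Qed.

(* A removable singularity at 0 is allowed, to cover f(z) / z.  Adding
   d |z|^2 to |G| makes the sub-mean-value inequality strict. *)
Lemma max_principle (G : C -> C) (r0 r B : R) : 0 < r < r0 ->
  (forall z, 0 < Cmod z < r0 -> exists d, cderiv G z d) ->
  ccont G 0 ->
  (forall z, Cmod z = r -> Cmod (G z) <= B) ->
  forall z, Cmod z <= r -> Cmod (G z) <= B.
Proof.
  intros Hr D C0 HB z0 Hz0. apply Rnot_lt_le. intro N.
  assert (forall z, Cmod z < r0 -> ccont G z) as HC.
  { intros z Hz. destruct (Rle_lt_or_eq_dec 0 (Cmod z) (Cmod_ge_0 z)) as [P|P].
    - destruct (D z (conj P Hz)) as [d Hd]. eapply cderiv_cont; eauto.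
    - symmetry in P. apply Cmod_eq_0 in P. rewrite P. exact C0. }
  (* The added term is at most [dl * r ^ 2], which is less than the excess at [z0]; hence the
     maximum of the sum is not on the boundary circle. *)
  set (dl := (Cmod (G z0) - B) / (2 * r ^ 2)).
  assert (0 < r ^ 2) by (apply pow_lt; lra).
  assert (0 < dl) as Hdl by (apply Rdiv_lt_0_compat; lra).
  assert (dl * r ^ 2 < Cmod (G z0) - B) as Hdr.
  { unfold dl. replace ((Cmod (G z0) - B) / (2 * r ^ 2) * r ^ 2) with ((Cmod (G z0) - B) / 2)
      by (field; lra). lra. }
  destruct (disc_max (fun z => Cmod (G z) + dl * Cmod z ^ 2) r) as [a [Ha Hmax]]; [lra| |].
  { intros p Hp e He. destruct (HC p ltac:(lra) (e / 2)) as [d1 [Hd1 H1]]; [lra|].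
    set (k := 1 + dl * (2 * r)). assert (0 < k) as Hk by (unfold k; nra).
    exists (Rmin d1 (e / 2 / k)). split; [apply Rmin_pos; auto; apply Rdiv_lt_0_compat; lra|].
    intros w Hw Hd. apply Rmin_Rgt_l in Hd. destruct Hd as [Hw1 Hw2].
    specialize (H1 w Hw1).
    generalize (Cmod_sub_ge (G w) (G p)) (Cmod_sub_ge w p) (Cmod_ge_0 w) (Cmod_ge_0 p). intros.
    assert (dl * Cmod w ^ 2 <= dl * Cmod p ^ 2 + e / 2); [|lra].
    apply (Rmult_gt_compat_l k) in Hw2; [|lra].
    replace (k * (e / 2 / k)) with (e / 2) in Hw2 by (field; lra).
    assert (dl * (2 * r) * Cmod (w - p) <= e / 2) by (unfold k in Hw2; generalize (Cmod_ge_0 (w - p)); nra).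
    assert (Cmod w ^ 2 - Cmod p ^ 2 <= 2 * r * Cmod (w - p)).
    { replace (Cmod w ^ 2 - Cmod p ^ 2) with ((Cmod w + Cmod p) * (Cmod w - Cmod p)) by ring.
      generalize (Cmod_ge_0 (w - p)). nra. }
    nra. }
  generalize (Hmax z0 Hz0). intro Hva.
  generalize (Cmod_ge_0 a); intro Pa. assert (0 <= dl * Cmod z0 ^ 2) by (generalize (pow2_ge_0 (Cmod z0)); nra).
  assert (Cmod a < r) as Har.
  { destruct (Rle_lt_or_eq_dec _ _ Ha) as [L|E]; [exact L|exfalso].
    generalize (HB a E). rewrite E in Hva. lra. }
  assert (0 < Cmod (G a)) as PG.
  { assert (dl * Cmod a ^ 2 <= dl * r ^ 2).
    { apply Rmult_le_compat_l; [lra|]. apply pow_incr. lra. }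
    assert (0 <= B \/ B < 0) as [P|P] by lra; [lra|].
    generalize (HB (RtoC r)). rewrite Cmod_R, Rabs_pos_eq by lra.
    generalize (Cmod_ge_0 (G r)). lra. }
  (* The punctured disc of radius [q] about [a] has to avoid the singularity 0: either
     [q <= Cmod a], or [a] is 0 and is itself the removed centre. *)
  assert (exists q, 0 < q < r /\ Cmod a + q <= r /\
    forall z, 0 < Cmod (z - a) < q -> 0 < Cmod z < r0) as [q [Hq [Haq Hq']]].
  { destruct (Rle_lt_or_eq_dec 0 (Cmod a) Pa) as [P|P].
    - exists (Rmin (Cmod a) (r - Cmod a)).
      generalize (Rmin_l (Cmod a) (r - Cmod a)) (Rmin_r (Cmod a) (r - Cmod a)). intros.
      assert (0 < Rmin (Cmod a) (r - Cmod a)) by (apply Rmin_pos; lra).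
      split; [lra|]. split; [lra|]. intros z Hz.
      generalize (Cmod_sub_ge a z) (Cmod_sub_ge z a). rewrite (Cmod_sub_sym a z). lra.
    - exists (r / 2). split; [lra|]. split; [lra|]. intros z Hz.
      symmetry in P. apply Cmod_eq_0 in P. subst a. replace (z - 0)%C with z in Hz by ring. lra. }
  (* A rotation after which the value at [a] is the positive number [Cmod (G a)], so that its real
     part is the full modulus. *)
  set (c := (Cconj (G a) / Cmod (G a))%C).
  assert (RtoC (Cmod (G a)) <> 0) as NG by (intro E; apply RtoC_inj in E; lra).
  assert (Cmod c = 1) as Hc.
  { unfold c. rewrite Cmod_div, Cmod_conj, Cmod_R, Rabs_pos_eq by (auto; lra). field. lra. }
  set (rho := q / 2).
  generalize (mean_value (fun z => c * G z)%C a q rho). intro MV.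
  assert (is_RInt (fun t => Re (c * G (circ a rho t))%C) 0 (2 * PI) (2 * PI * Cmod (G a))) as I1.
  { replace (Cmod (G a)) with (Re (c * G a)%C).
    - apply MV; [unfold rho; lra| |].
      + intros z Hz. destruct (D z (Hq' z Hz)) as [d Hd]. exists (c * d)%C. apply cderiv_scal, Hd.
      + intros e He. destruct (HC a ltac:(lra) e He) as [d [Hd H1]]. exists d. split; [exact Hd|].
        intros w Hw. replace (c * G w - c * G a)%C with (c * (G w - G a))%C by ring.
        rewrite Cmod_mult, Hc, Rmult_1_l. auto.
    - unfold c. replace (Cconj (G a) / Cmod (G a) * G a)%C with
        (G a * Cconj (G a) / Cmod (G a))%C by (field; auto).
      rewrite <- Cmod2_conj. unfold Cdiv. rewrite <- RtoC_inv, <- RtoC_mult by lra. simpl. field. lra. }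
  generalize (is_RInt_trig (Cmod (G a) - dl * rho ^ 2) (- dl * (2 * rho * Re a)) (- dl * (2 * rho * Im a))).
  intro I2.
  (* The left side is the integral of [Re (c * G)] over the circle. Maximality at [a] bounds the
     integrand by a trigonometric polynomial, whose integral is the right side. *)
  assert (2 * PI * Cmod (G a) <= 2 * PI * (Cmod (G a) - dl * rho ^ 2)) as Hcontra.
  { refine (is_RInt_le _ _ 0 (2 * PI) _ _ _ I1 I2 _); [generalize PI_RGT_0; lra|].
    intros t _. eapply Rle_trans; [apply Rle_abs|]. eapply Rle_trans; [apply re_le_Cmod|].
    rewrite Cmod_mult, Hc, Rmult_1_l.
    assert (Cmod (circ a rho t) <= r) as Hcr.
    { replace (circ a rho t) with (a + (circ a rho t - a))%C by ring.
      eapply Rle_trans; [apply Cmod_triangle|]. rewrite Cmod_circ by (unfold rho; lra). unfold rho; lra. }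
    generalize (Hmax _ Hcr). intro H1.
    assert (Cmod (circ a rho t) ^ 2 = Cmod a ^ 2 + rho ^ 2 + 2 * rho * Re a * cos t + 2 * rho * Im a * sin t) as E.
    { rewrite !Cmod2_alt. unfold circ, cexp. destruct a as [a1 a2]. simpl.
      rewrite exp_ln by (unfold rho; lra). generalize (sin2_cos2 t). unfold Rsqr. intro S.
      transitivity (a1 * a1 + a2 * a2 + rho * rho * (sin t * sin t + cos t * cos t)
        + 2 * rho * a1 * cos t + 2 * rho * a2 * sin t); [ring|]. rewrite S. ring. }
    rewrite E in H1. lra. }
  assert (0 < dl * rho ^ 2).
  { apply Rmult_lt_0_compat; [lra|]. apply pow_lt. unfold rho; lra. }
  generalize PI_RGT_0. nra.
Qed.

(** * The Schwarz lemma and its rigidity case *)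

Definition holo_disc (F : C -> C) : Prop := forall z, Cmod z < 1 -> exists d, cderiv F z d.

Definition quotient_at_0 (F : C -> C) (d z : C) : C :=
  if excluded_middle_informative (z = 0) then d else (F z / z)%C.

Lemma quotient_ne (F : C -> C) (d z : C) : z <> 0 -> quotient_at_0 F d z = (F z / z)%C.
Proof. intro H. unfold quotient_at_0. destruct excluded_middle_informative; [contradiction|reflexivity]. Qed.

Lemma quotient_ccont (F : C -> C) (d : C) : F 0 = 0 -> cderiv F 0 d -> ccont (quotient_at_0 F d) 0.
Proof.
  intros F0 D e He. destruct (D e He) as [dl [Hdl H]]. exists dl. split; [exact Hdl|].
  intros w Hw. unfold quotient_at_0 at 2. destruct excluded_middle_informative as [_|N]; [|exfalso; apply N; reflexivity].
  destruct (classic (w = 0)) as [->|Hw0].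
  - unfold quotient_at_0. destruct excluded_middle_informative as [_|N]; [|exfalso; apply N; reflexivity].
    replace (d - d)%C with (RtoC 0) by ring. rewrite Cmod_0. lra.
  - rewrite quotient_ne by exact Hw0. specialize (H w Hw). rewrite F0 in H.
    replace (w - 0)%C with w in H by ring. replace (F w - 0 - d * w)%C with ((F w / w - d) * w)%C in H by (field; exact Hw0).
    rewrite Cmod_mult in H. apply Cmod_gt_0 in Hw0.
    apply Rmult_le_reg_r with (Cmod w); auto.
Qed.

Lemma quotient_cderiv (F : C -> C) (d z d' : C) : z <> 0 -> cderiv F z d' ->
  cderiv (quotient_at_0 F d) z (d' * / z + F z * - / (z * z))%C.
Proof.
  intros Hz D. assert (0 < Cmod z) as P by (apply Cmod_gt_0; exact Hz).
  apply (cderiv_ext_loc (fun w => F w * / w)%C) with (r := Cmod z); [exact P| |].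
  - intros w Hw. rewrite quotient_ne; [reflexivity|]. intros ->.
    rewrite Cmod_sub_sym in Hw. replace (z - 0)%C with z in Hw by ring. lra.
  - apply cderiv_mult; [exact D|]. apply cderiv_inv, Hz.
Qed.

(** The maximum principle for [F z / z] on the disc of radius [r] gives the bound [/ r], and [r] may
    be taken arbitrarily close to 1. *)
Lemma schwarz (F : C -> C) : holo_disc F -> (forall z, Cmod z < 1 -> Cmod (F z) <= 1) -> F 0 = 0 ->
  forall z, Cmod z < 1 -> Cmod (F z) <= Cmod z.
Proof.
  intros D B F0 z Hz.
  destruct (classic (z = 0)) as [->|Hz0]; [rewrite F0; lra|].
  destruct (D 0) as [d Hd]; [rewrite Cmod_0; lra|].
  assert (0 < Cmod z) as P by (apply Cmod_gt_0; exact Hz0).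
  assert (forall r, Cmod z < r < 1 -> r * Cmod (F z) <= Cmod z) as HR.
  { intros r Hr.
    assert (Cmod (quotient_at_0 F d z) <= / r) as H.
    { apply (max_principle (quotient_at_0 F d) 1 r); try lra.
      - intros w Hw. destruct (D w ltac:(lra)) as [d' Hd']. eexists.
        apply quotient_cderiv; [apply Cmod_gt_0; lra|exact Hd'].
      - apply quotient_ccont; auto.
      - intros w Hw. assert (w <> 0) by (apply Cmod_gt_0; lra).
        rewrite quotient_ne, Cmod_div, Hw by auto. specialize (B w ltac:(lra)).
        unfold Rdiv. rewrite <- (Rmult_1_l (/ r)) at 2. apply Rmult_le_compat_r; [|exact B].
        left; apply Rinv_0_lt_compat; lra. }
    rewrite quotient_ne, Cmod_div in H by auto.
    apply (Rmult_le_compat_r (r * Cmod z)) in H; [|nra].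
    replace (Cmod (F z) / Cmod z * (r * Cmod z)) with (r * Cmod (F z)) in H by (field; lra).
    replace (/ r * (r * Cmod z)) with (Cmod z) in H by (field; lra). exact H. }
  apply Rnot_lt_le. intro N.
  set (m := Cmod z / Cmod (F z)).
  assert (m < 1) as Hm.
  { unfold m. apply Rmult_lt_reg_r with (Cmod (F z)); [lra|].
    unfold Rdiv. rewrite Rmult_assoc, Rinv_l; lra. }
  (* Strictly between [Cmod z / Cmod (F z)] and 1, so that [r * Cmod (F z)] exceeds [Cmod z]. *)
  set (r := (Rmax m (Cmod z) + 1) / 2).
  assert (Rmax m (Cmod z) < 1) by (apply Rmax_lub_lt; lra).
  generalize (Rmax_l m (Cmod z)) (Rmax_r m (Cmod z)). intros.
  specialize (HR r ltac:(unfold r; lra)).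
  assert (m * Cmod (F z) = Cmod z) by (unfold m; field; lra).
  assert (m < r) by (unfold r; lra). nra.
Qed.

(** With [d] nonzero, a step of length proportional to [t] along [G z / d] would raise the modulus
    to [1 + t] up to an error of [t / 2]. *)
Lemma cderiv_unimodular (G : C -> C) (z d : C) (r : R) : 0 < r ->
  (forall w, Cmod (w - z) < r -> Cmod (G w) = 1) -> cderiv G z d -> d = 0.
Proof.
  intros Hr H D. apply NNPP. intro Hd. assert (0 < Cmod d) as P by (apply Cmod_gt_0; exact Hd).
  destruct (D (Cmod d / 2)) as [dl [Hdl D1]]; [lra|].
  set (t := Rmin r dl * Cmod d / 2).
  assert (0 < Rmin r dl) as Hm by (apply Rmin_pos; auto).
  assert (0 < t) as Ht by (unfold t; nra).
  assert (Cmod (G z) = 1) as Gz.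
  { apply H. replace (z - z)%C with (RtoC 0) by ring. rewrite Cmod_0; auto. }
  set (w := (z + t * (G z / d))%C).
  assert (Cmod (w - z) = t / Cmod d) as Hw.
  { unfold w. replace (z + t * (G z / d) - z)%C with (t * (G z / d))%C by ring.
    rewrite Cmod_mult, Cmod_R, Cmod_div, Gz, Rabs_pos_eq by (auto; lra). field. lra. }
  assert (t / Cmod d < Rmin r dl) as Hw2 by (unfold t; replace (Rmin r dl * Cmod d / 2 / Cmod d) with (Rmin r dl / 2) by (field; lra); lra).
  generalize (Rmin_l r dl) (Rmin_r r dl). intros.
  specialize (D1 w ltac:(lra)). rewrite Hw in D1.
  specialize (H w ltac:(lra)).
  replace (Cmod d / 2 * (t / Cmod d)) with (t / 2) in D1 by (field; lra).
  assert (Cmod (G z + d * (w - z)) = 1 + t) as E.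
  { unfold w. replace (G z + d * (z + t * (G z / d) - z))%C with ((1 + t)%R * G z)%C.
    - rewrite Cmod_mult, Cmod_R, Gz, Rabs_pos_eq; lra.
    - rewrite RtoC_plus. field. exact Hd. }
  generalize (Cmod_sub_ge (G z + d * (w - z)) (G w)). rewrite Cmod_sub_sym.
  replace (G w - (G z + d * (w - z)))%C with (G w - G z - d * (w - z))%C by ring. lra.
Qed.

(** The Schwarz lemma for [A] and for its inverse gives |A z| = |z|. So [A z / z] is unimodular, has
    derivative 0, and is constant. *)
Lemma automorphism_rotation (A B : C -> C) : holo_disc A -> holo_disc B ->
  (forall z, Cmod z < 1 -> Cmod (A z) < 1 /\ B (A z) = z) ->
  (forall z, Cmod z < 1 -> Cmod (B z) < 1) ->
  A 0 = 0 -> exists u, forall z, Cmod z < 1 -> A z = (u * z)%C.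
Proof.
  intros DA DB HA HB A0.
  assert (forall z, Cmod z < 1 -> Cmod (A z) = Cmod z) as E.
  { intros z Hz. apply Rle_antisym.
    - apply schwarz; auto. intros; left; apply HA; auto.
    - rewrite <- (proj2 (HA z Hz)) at 1. apply schwarz; auto.
      + intros; left; auto.
      + transitivity (B (A 0)); [rewrite A0; reflexivity|]. apply HA. rewrite Cmod_0; lra.
      + apply HA; auto. }
  destruct (DA 0) as [u Hu]; [rewrite Cmod_0; lra|]. exists u. intros z Hz.
  destruct (classic (z = 0)) as [->|Hz0]; [rewrite A0; ring|].
  set (G := quotient_at_0 A u).
  assert (0 < Cmod z) as P by (apply Cmod_gt_0; exact Hz0).
  assert (forall w, 0 < Cmod w < 1 -> cderiv G w 0) as DG.
  { intros w Hw. assert (w <> 0) as Hw0 by (apply Cmod_gt_0; lra).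
    destruct (DA w ltac:(lra)) as [d Hd]. generalize (quotient_cderiv A u w d Hw0 Hd). fold G. intro D.
    assert (d * / w + A w * - / (w * w) = 0)%C as E0; [|rewrite E0 in D; exact D].
    refine (cderiv_unimodular G w _ (Rmin (Cmod w) (1 - Cmod w)) _ _ D).
    - apply Rmin_pos; lra.
    - intros v Hv. apply Rmin_Rgt_l in Hv. destruct Hv as [Hv1 Hv2].
      generalize (Cmod_sub_ge v w) (Cmod_sub_ge w v). rewrite (Cmod_sub_sym w v). intros.
      assert (v <> 0) by (apply Cmod_gt_0; lra).
      unfold G. rewrite quotient_ne, Cmod_div, E by (auto; lra). field. apply Rgt_not_eq; lra. }
  (* The segment from [z] towards 0 stops short of 0, where [G] is only known to be continuous;
     letting [s] tend to 0 afterwards identifies the constant as [u]. *)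
  assert (forall s, 0 < s <= 1 -> Cmod (G (s * z) - G z) <= 0)%C as HG.
  { intros s Hs. replace 0 with (0 * Cmod (s * z - z)) by ring.
    apply (cderiv_lipschitz (fun w => 0 < Cmod w < 1) G (fun _ => 0)).
    - intros t Ht. replace (z + t * (s * z - z))%C with ((1 - t + t * s)%R * z)%C.
      + assert (0 < 1 - t + t * s <= 1) as K.
        { assert (t * (1 - s) <= 1 * (1 - s)) by (apply Rmult_le_compat_r; lra). nra. }
        rewrite Cmod_mult, Cmod_R, Rabs_pos_eq by lra. split; nra.
      + rewrite RtoC_plus, RtoC_minus, RtoC_mult. ring.
    - exact DG.
    - intros _ _. rewrite Cmod_0; lra. }
  assert (G z = u) as Gu.
  { apply NNPP. intro N.
    assert (0 < Cmod (G z - u)) as P2.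
    { apply Cmod_gt_0. intro H. apply N. replace (G z) with (G z - u + u)%C by ring. rewrite H. ring. }
    destruct (quotient_ccont A u A0 Hu (Cmod (G z - u) / 2)) as [d [Hd Hc]]; [lra|]. fold G in Hc.
    set (s := Rmin 1 (d / 2)). assert (0 < s) by (apply Rmin_pos; lra).
    assert (s <= 1) by apply Rmin_l. assert (s <= d / 2) by apply Rmin_r.
    specialize (HG s ltac:(lra)). specialize (Hc (s * z)%C).
    replace (s * z - 0)%C with (s * z)%C in Hc by ring.
    rewrite Cmod_mult, Cmod_R, Rabs_pos_eq in Hc by lra. specialize (Hc ltac:(nra)).
    replace (G 0) with u in Hc.
    2:{ unfold G, quotient_at_0. destruct excluded_middle_informative as [_|Q]; [reflexivity|exfalso; apply Q; reflexivity]. }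
    replace (G z - u)%C with (- (G (s * z) - G z) + (G (s * z) - u))%C in P2 at 1 by ring.
    assert (Cmod (G z - u) <= Cmod (G (s * z) - G z) + Cmod (G (s * z) - u))%C.
    { replace (G z - u)%C with (- (G (s * z) - G z) + (G (s * z) - u))%C at 1 by ring.
      eapply Rle_trans; [apply Cmod_triangle|]. rewrite Cmod_opp. lra. }
    assert (0 < Cmod (G z - u)). { replace (G z - u)%C with (- (G (s * z) - G z) + (G (s * z) - u))%C by ring. exact P2. }
    lra. }
  unfold G in Gu. rewrite quotient_ne in Gu by auto. rewrite <- Gu. field. exact Hz0.
Qed.

(* Satisfied by z |-> (a z + b) / (c z + e), with [h z = 1 / (c z + e)];
   this functional form is all that invariance of cross ratios needs, and it
   is visibly stable under composition. *)
Definition mobius_like (S : C -> Prop) (A : C -> C) : Prop :=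
  exists d h, forall z w, S z -> S w -> (A z - A w = d * (z - w) * h z * h w)%C.

Lemma mobius_like_comp (S T : C -> Prop) (A B : C -> C) :
  mobius_like T A -> mobius_like S B -> (forall z, S z -> T (B z)) ->
  mobius_like S (fun z => A (B z)).
Proof.
  intros [d [h H]] [d' [h' H']] M. exists (d * d')%C, (fun z => h (B z) * h' z)%C.
  intros z w Hz Hw. rewrite (H _ _ (M z Hz) (M w Hw)), (H' z w Hz Hw). ring.
Qed.

Lemma mobius_like_ext (S : C -> Prop) (A B : C -> C) :
  (forall z, S z -> A z = B z) -> mobius_like S A -> mobius_like S B.
Proof.
  intros E [d [h H]]. exists d, h. intros z w Hz Hw. rewrite <- !E by auto. auto.
Qed.

Lemma mobius_like_fraction (S : C -> Prop) (a b c e : C) :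
  (forall z, S z -> c * z + e <> 0)%C -> mobius_like S (fun z => (a * z + b) / (c * z + e))%C.
Proof.
  intros H. exists (a * e - b * c)%C, (fun z => / (c * z + e))%C. intros z w Hz Hw.
  field. split; apply H; auto.
Qed.

(** The disc automorphism taking [b] to 0. The literal coefficients match the pattern of
    [cderiv_mobius] and [mobius_like_fraction]. *)
Definition blaschke (b z : C) : C := ((1 * z + - b) / (- Cconj b * z + 1))%C.

Lemma blaschke_denom (b z : C) : Cmod b < 1 -> Cmod z < 1 -> (- Cconj b * z + 1)%C <> 0.
Proof.
  intros Hb Hz. apply Cmod_gt_0.
  replace (- Cconj b * z + 1)%C with (1 - Cconj b * z)%C by ring.
  generalize (Cmod_sub_ge 1 (Cconj b * z)). rewrite Cmod_1, Cmod_mult, Cmod_conj.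
  generalize (Cmod_ge_0 b) (Cmod_ge_0 z). nra.
Qed.

Lemma blaschke_disc (b z : C) : Cmod b < 1 -> Cmod z < 1 -> Cmod (blaschke b z) < 1.
Proof.
  intros Hb Hz. generalize (blaschke_denom b z Hb Hz). intro N. unfold blaschke.
  rewrite Cmod_div by exact N.
  assert (0 < Cmod (- Cconj b * z + 1)) as P by (apply Cmod_gt_0; exact N).
  apply Rmult_lt_reg_r with (Cmod (- Cconj b * z + 1)); [exact P|].
  unfold Rdiv. rewrite Rmult_assoc, Rinv_l, Rmult_1_r, Rmult_1_l by lra.
  apply Rsqr_incrst_0; [|apply Cmod_ge_0|lra]. rewrite !Rsqr_pow2, !Cmod2_alt.
  generalize (Cmod2_alt b) (Cmod2_alt z) (Cmod_ge_0 b) (Cmod_ge_0 z).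
  destruct b as [b1 b2], z as [z1 z2]. simpl. intros.
  (* This product is the difference of the squared moduli of denominator and numerator. *)
  assert (0 < (1 - (b1 * b1 + b2 * b2)) * (1 - (z1 * z1 + z2 * z2))).
  { apply Rmult_lt_0_compat; nra. }
  nra.
Qed.

Lemma blaschke_inv (b z : C) : Cmod b < 1 -> Cmod z < 1 -> blaschke (- b) (blaschke b z) = z.
Proof.
  intros Hb Hz. generalize (blaschke_denom b z Hb Hz) (blaschke_denom (- b) (blaschke b z)).
  intros N1 N2. specialize (N2 ltac:(rewrite Cmod_opp; auto) (blaschke_disc b z Hb Hz)).
  unfold blaschke at 1.
  replace (Cconj (- b)) with (- Cconj b)%C in * by (destruct b; unfold Cconj, Copp; simpl; reflexivity).
  unfold blaschke in *. revert N1 N2. generalize (Cconj b). intros k N1 N2.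
  field. split; [exact N1|].
  intro E. apply N2.
  replace (- - k * ((1 * z + - b) / (- k * z + 1)) + 1)%C with
    ((k * (1 * z + - b) + (- k * z + 1)) / (- k * z + 1))%C by (field; exact N1).
  unfold Cdiv. replace (k * (1 * z + - b) + (- k * z + 1))%C with (RtoC 0); [ring|].
  rewrite <- E. ring.
Qed.

Lemma blaschke_holo (b z : C) : Cmod b < 1 -> Cmod z < 1 -> exists d, cderiv (blaschke b) z d.
Proof. intros. eexists. apply cderiv_mobius. apply blaschke_denom; auto. Qed.

(** Composing with the Blaschke factor of [A 0] makes 0 a fixed point, which reduces the claim to
    rotations. *)
Lemma automorphism_mobius (A B : C -> C) : holo_disc A -> holo_disc B ->
  (forall z, Cmod z < 1 -> Cmod (A z) < 1 /\ B (A z) = z) ->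
  (forall z, Cmod z < 1 -> Cmod (B z) < 1) ->
  mobius_like (fun z => Cmod z < 1) A.
Proof.
  intros DA DB HA HB.
  assert (Cmod 0 < 1) as H0 by (rewrite Cmod_0; lra).
  set (b := A 0). assert (Cmod b < 1) as Hb by (apply HA; auto).
  assert (Cmod (- b) < 1) as Hb' by (rewrite Cmod_opp; auto).
  destruct (automorphism_rotation (fun z => blaschke b (A z)) (fun w => B (blaschke (- b) w))) as [u Hu].
  - intros z Hz. destruct (DA z Hz) as [d Hd].
    destruct (blaschke_holo b (A z) Hb (proj1 (HA z Hz))) as [d' Hd'].
    exists (d' * d)%C. apply cderiv_comp; auto.
  - intros z Hz. destruct (blaschke_holo (- b) z Hb' Hz) as [d Hd].
    destruct (DB (blaschke (- b) z) (blaschke_disc _ _ Hb' Hz)) as [d' Hd'].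
    exists (d' * d)%C. apply cderiv_comp; auto.
  - intros z Hz. destruct (HA z Hz) as [H1 H2]. split; [apply blaschke_disc; auto|].
    rewrite blaschke_inv; auto.
  - intros z Hz. apply HB, blaschke_disc; auto.
  - fold b. unfold blaschke. replace (1 * b + - b)%C with (RtoC 0) by ring. unfold Cdiv. ring.
  - apply (mobius_like_ext _ (fun z => blaschke (- b) (u * z))%C).
    + intros z Hz. rewrite <- Hu by auto. apply blaschke_inv; auto. apply HA, Hz.
    + apply (mobius_like_comp _ (fun z => Cmod z < 1)).
      * apply mobius_like_fraction. intros z Hz. apply blaschke_denom; auto.
      * exists u, (fun _ => 1). intros z w _ _. ring.
      * intros z Hz. rewrite <- Hu by auto. apply blaschke_disc; auto. apply HA, Hz.
Qed.

(** * Functions of class C^k *)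

(* [Ck_on] with existential directional derivatives, so that closure properties
   need no computation of [Derive]. *)
Fixpoint Cn {V : NormedModule R_AbsRing} (k : nat) (U : V -> Prop) (f : V -> R) : Prop :=
  (forall p, U p -> continuous f p) /\
  match k with
  | O => True
  | S m => forall v : V, exists f' : V -> R,
      (forall p, U p -> is_derive (fun s : R => f (plus p (scal s v))) 0 (f' p)) /\ Cn m U f'
  end.

Section Smooth.
Context {V : NormedModule R_AbsRing}.
Implicit Types (U W : V -> Prop) (f g : V -> R).

Lemma line_at_0 (p v : V) : plus p (scal 0 v) = p.
Proof. transitivity (plus p zero); [f_equal; exact (scal_zero_l v)|apply plus_zero_r]. Qed.

Lemma line_continuous (p v : V) : continuous (fun s : R => plus p (scal s v)) 0.
Proof.
  apply (continuous_plus (U := R_UniformSpace) (V := V) (fun _ => p) (fun s : R => scal s v)).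
  - apply continuous_const.
  - apply (continuous_scal (U := R_UniformSpace) (V := V) (fun s : R => s) (fun _ => v)).
    + apply continuous_id.
    + apply continuous_const.
Qed.

Lemma line_locally (p v : V) (P : V -> Prop) : locally p P ->
  locally 0 (fun s : R => P (plus p (scal s v))).
Proof.
  intros H. apply (line_continuous p v). rewrite line_at_0. exact H.
Qed.

Lemma Ck_on_Cn k U f : Ck_on k U f -> Cn k U f.
Proof.
  revert f. induction k; intros f [H1 H2]; (split; [exact H1|]); [exact I|].
  intros v. destruct (H2 v) as [H3 H4]. exists (dir_derive f v). split; [|apply IHk, H4].
  intros p Hp. apply Derive_correct, H3, Hp.
Qed.

Lemma continuous_ext_open U f g p : open U -> U p -> (forall q, U q -> f q = g q) ->
  continuous f p -> continuous g p.
Proof.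
  intros HU Hp E Hc. apply (continuous_ext_loc g f p); [|exact Hc].
  apply (filter_imp U); [|apply HU, Hp]. exact E.
Qed.

Lemma line_ext U f g p v l : open U -> U p -> (forall q, U q -> f q = g q) ->
  is_derive (fun s : R => f (plus p (scal s v))) 0 l ->
  is_derive (fun s : R => g (plus p (scal s v))) 0 l.
Proof.
  intros HU Hp E. apply is_derive_ext_loc.
  apply (filter_imp (fun s : R => U (plus p (scal s v)))).
  - intros s Hs. auto.
  - apply line_locally. apply HU, Hp.
Qed.

Lemma Cn_ext k U f g : open U -> (forall p, U p -> f p = g p) -> Cn k U f -> Cn k U g.
Proof.
  intros HU E. destruct k; intros [H1 H2].
  - split; auto. intros p Hp. apply (continuous_ext_open U f); auto.
  - split; [intros p Hp; apply (continuous_ext_open U f); auto|].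
    intros v. destruct (H2 v) as [f' [H3 H4]]. exists f'. split; [|exact H4].
    intros p Hp. apply (line_ext U f); auto.
Qed.

Lemma Cn_Ck_on k U f : open U -> Cn k U f -> Ck_on k U f.
Proof.
  intros HU. revert f. induction k; intros f [H1 H2]; (split; [exact H1|]); [exact I|].
  intros v. destruct (H2 v) as [f' [H3 H4]]. split.
  - intros p Hp. exists (f' p). apply H3, Hp.
  - apply IHk. apply (Cn_ext k U f'); auto.
    intros p Hp. symmetry. apply is_derive_unique, H3, Hp.
Qed.

Lemma Cn_continuous k U f p : Cn k U f -> U p -> continuous f p.
Proof. destruct k; intros [H _]; apply H. Qed.

Lemma Cn_S k U f : Cn (S k) U f -> Cn k U f.
Proof.
  revert f. induction k; intros f [H1 H2]; (split; [exact H1|]); [exact I|].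
  intros v. destruct (H2 v) as [f' [H3 H4]]. exists f'. auto.
Qed.

Lemma Cn_subset k U W f : (forall p, W p -> U p) -> Cn k U f -> Cn k W f.
Proof.
  intros HW. revert f. induction k; intros f [H1 H2]; (split; [auto|]); [exact I|].
  intros v. destruct (H2 v) as [f' [H3 H4]]. exists f'. auto.
Qed.

(** Gluing is done for [Ck_on], whose derivatives are canonical functions; the derivatives chosen
    existentially in [Cn] could depend on the neighbourhood. *)
Lemma Ck_on_local k U f :
  (forall p, U p -> exists W, W p /\ Ck_on k W f) -> Ck_on k U f.
Proof.
  revert f. induction k; intros f H.
  - split; [|exact I]. intros p Hp. destruct (H p Hp) as [W [Hw [H1 _]]]. auto.
  - split.
    + intros p Hp. destruct (H p Hp) as [W [Hw [H1 _]]]. auto.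
    + intros v. split.
      * intros p Hp. destruct (H p Hp) as [W [Hw [_ H1]]]. apply (H1 v), Hw.
      * apply IHk. intros p Hp. destruct (H p Hp) as [W [Hw [_ H1]]]. exists W.
        split; [exact Hw|]. apply (H1 v).
Qed.

Lemma Cn_local k U f : open U ->
  (forall p, U p -> exists W, open W /\ W p /\ Cn k W f) -> Cn k U f.
Proof.
  intros HU H. apply Ck_on_Cn. apply Ck_on_local. intros p Hp.
  destruct (H p Hp) as [W [HW [Hp' HC]]]. exists W. split; [exact Hp'|]. apply Cn_Ck_on; auto.
Qed.

Lemma Cn_const k U (c : R) : Cn k U (fun _ => c).
Proof.
  revert c. induction k; intros c; (split; [intros; apply continuous_const|]); [exact I|].
  intros v. exists (fun _ => 0). split; [|apply IHk]. intros p _. exact (is_derive_const (K := R_AbsRing) (V := R_NormedModule) c 0).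
Qed.

Lemma Cn_linear k U f : (forall p, continuous f p) ->
  (forall p s v, f (plus p (scal s v)) = f p + s * f v) -> Cn k U f.
Proof.
  intros Hc Hl. destruct k; (split; [auto|]); [exact I|].
  intros v. exists (fun _ => f v). split; [|apply Cn_const].
  intros p _. apply (is_derive_ext (fun s => f p + s * f v)); [intros; symmetry; apply Hl|].
  auto_derive; auto. ring.
Qed.

Lemma Cn_plus k U f g : Cn k U f -> Cn k U g -> Cn k U (fun p => f p + g p).
Proof.
  revert f g. induction k; intros f g [F1 F2] [G1 G2].
  - split; [|exact I]. intros p Hp. apply (continuous_plus (V := R_NormedModule) f g); auto.
  - split; [intros p Hp; apply (continuous_plus (V := R_NormedModule) f g); auto|].
    intros v. destruct (F2 v) as [f' [F3 F4]]. destruct (G2 v) as [g' [G3 G4]].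
    exists (fun p => f' p + g' p). split; [|auto].
    intros p Hp. apply (is_derive_plus (V := R_NormedModule)); auto.
Qed.

Lemma Cn_mult k U f g : Cn k U f -> Cn k U g -> Cn k U (fun p => f p * g p).
Proof.
  revert f g. induction k; intros f g HF HG; generalize HF HG; intros [F1 F2] [G1 G2].
  - split; [|exact I]. intros p Hp. apply (continuous_mult (K := R_AbsRing) f g); auto.
  - split; [intros p Hp; apply (continuous_mult (K := R_AbsRing) f g); auto|].
    intros v. destruct (F2 v) as [f' [F3 F4]]. destruct (G2 v) as [g' [G3 G4]].
    exists (fun p => f' p * g p + f p * g' p). split.
    + intros p Hp. generalize (is_derive_mult (K := R_AbsRing)
        (fun s : R => f (plus p (scal s v))) (fun s : R => g (plus p (scal s v))) 0 _ _ (F3 p Hp) (G3 p Hp) Rmult_comm).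
      rewrite line_at_0. auto.
    + apply Cn_plus; apply IHk; auto; apply Cn_S; auto.
Qed.

Lemma Cn_scal k U (c : R) f : Cn k U f -> Cn k U (fun p => c * f p).
Proof. intros. apply Cn_mult; auto. apply Cn_const. Qed.
End Smooth.

Lemma Cn_R_derive k (O : R -> Prop) (f f' : R -> R) :
  (forall x, O x -> is_derive f x (f' x)) -> Cn (V := R_NormedModule) k O f' ->
  Cn (V := R_NormedModule) (S k) O f.
Proof.
  intros D H. split.
  - intros x Hx. apply (ex_derive_continuous (V := R_NormedModule)). exists (f' x). auto.
  - intros v. exists (fun x => v * f' x). split; [|apply Cn_scal, H].
    intros x Hx. specialize (D x Hx).
    apply (is_derive_comp (V := R_NormedModule) f (fun s : R => plus x (scal s v)) 0 (f' x) v).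
    + rewrite (line_at_0 (V := R_NormedModule)). exact D.
    + unfold plus, scal; simpl. unfold mult; simpl. auto_derive; auto. ring.
Qed.

Lemma Cn_R_inv k (O : R -> Prop) (f : R -> R) : Cn (V := R_NormedModule) (S k) O f ->
  exists f', (forall x, O x -> is_derive f x (f' x)) /\ Cn (V := R_NormedModule) k O f'.
Proof.
  intros [_ H]. destruct (H 1) as [f' [H1 H2]]. exists f'. split; [|exact H2].
  intros x Hx. specialize (H1 x Hx).
  apply (is_derive_ext (fun y => f (plus x (scal (y - x) 1)))).
  { intros y. unfold plus, scal; simpl. unfold mult; simpl. f_equal. ring. }
  replace (f' x) with (scal 1 (f' x)) by (unfold scal; simpl; unfold mult; simpl; ring).
  apply (is_derive_comp (V := R_NormedModule) (fun s => f (plus x (scal s 1))) (fun y => y - x) x (f' x) 1).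
  - rewrite Rminus_diag. exact H1.
  - auto_derive; auto.
Qed.

Lemma Cn_comp {V : NormedModule R_AbsRing} k (O : R -> Prop) (U : V -> Prop) (phi : R -> R) (f : V -> R) :
  (forall p, U p -> O (f p)) ->
  Cn (V := R_NormedModule) k O phi -> Cn k U f -> Cn k U (fun p => phi (f p)).
Proof.
  intros HO. revert phi. induction k; intros phi HP HF; generalize HP HF; intros [P1 P2] [F1 F2].
  - split; [|exact I]. intros p Hp. apply (continuous_comp f phi); auto.
  - split; [intros p Hp; apply (continuous_comp f phi); auto|].
    destruct (Cn_R_inv _ _ _ HP) as [phi' [P3 P4]].
    intros v. destruct (F2 v) as [f' [F3 F4]].
    exists (fun p => f' p * phi' (f p)). split.
    + intros p Hp. apply (is_derive_comp (V := R_NormedModule) phi (fun s : R => f (plus p (scal s v)))).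
      * rewrite line_at_0. auto.
      * auto.
    + apply Cn_mult; auto. apply IHk; auto. apply Cn_S; auto.
Qed.

Lemma Cn_inv k : Cn (V := R_NormedModule) k (fun x => x <> 0) Rinv.
Proof.
  induction k.
  - split; [|exact I]. intros x Hx. apply (ex_derive_continuous (V := R_NormedModule)). auto_derive. exact Hx.
  - apply Cn_R_derive with (f' := fun x => -1 * (/ x * / x)).
    + intros x Hx. auto_derive; [exact Hx|]. field. exact Hx.
    + apply Cn_scal. apply Cn_mult; auto.
Qed.

Lemma Cn_div {V : NormedModule R_AbsRing} k (U : V -> Prop) (f g : V -> R) :
  (forall p, U p -> g p <> 0) -> Cn k U f -> Cn k U g -> Cn k U (fun p => f p / g p).
Proof.
  intros H HF HG. apply Cn_mult; [exact HF|]. apply (Cn_comp k (fun x => x <> 0)); auto. apply Cn_inv.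
Qed.

Lemma Cn_id k (O : R -> Prop) : Cn (V := R_NormedModule) k O (fun x => x).
Proof.
  apply (Cn_linear (V := R_NormedModule)).
  - intros. apply continuous_id.
  - intros. unfold plus, scal; simpl. unfold mult; simpl. ring.
Qed.

(** * Flat functions *)

Lemma exp_le_compat (x y : R) : x <= y -> exp x <= exp y.
Proof. intros [H| ->]; [left; apply exp_increasing, H|right; reflexivity]. Qed.

Lemma exp_INR_mult (n : nat) (x : R) : exp (INR n * x) = exp x ^ n.
Proof.
  induction n; [simpl; rewrite Rmult_0_l; apply exp_0|].
  rewrite S_INR, Rmult_plus_distr_r, Rmult_1_l, exp_plus, IHn. simpl. ring.
Qed.

Lemma pow_le_exp (m : nat) : exists K, 0 < K /\ forall u, 0 <= u -> u ^ m <= K * exp u.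
Proof.
  destruct m as [|m].
  - exists 1. split; [lra|]. intros u Hu. simpl.
    generalize (exp_ineq1_le u). lra.
  - assert (0 < INR (S m)) as Hm by (apply lt_0_INR; lia).
    (* With n = [INR (S m)]: the inequality [u / n <= exp (u / n)] raised to the power [S m] gives
       the constant n^n. *)
    exists (INR (S m) ^ S m). split; [apply pow_lt; auto|]. intros u Hu.
    assert (exp u = exp (u / INR (S m)) ^ S m) as E.
    { rewrite <- (exp_INR_mult (S m) (u / INR (S m))). f_equal. field. lra. }
    rewrite E, <- Rpow_mult_distr. apply pow_incr. split; [exact Hu|].
    apply Rle_trans with (INR (S m) * (u / INR (S m))); [right; field; lra|].
    apply Rmult_le_compat_l; [lra|]. generalize (exp_ineq1_le (u / INR (S m))). lra.
Qed.

Lemma is_derive_flat (f : R -> R) (a K : R) :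
  (forall x, Rabs (f x) <= K * (x - a) ^ 2) -> is_derive f a 0.
Proof.
  intros H. apply is_derive_Reals. intros e He.
  assert (f a = 0) as Fa.
  { specialize (H a). replace (K * (a - a) ^ 2) with 0 in H by ring.
    apply Rabs_eq_0. generalize (Rabs_pos (f a)). lra. }
  set (K' := Rabs K + 1). assert (0 < K') as HK by (unfold K'; generalize (Rabs_pos K); lra).
  assert (0 < e / K') as Hd by (apply Rdiv_lt_0_compat; auto).
  exists (mkposreal _ Hd). intros h Hh0 Hh. simpl in Hh. rewrite Fa.
  replace ((f (a + h) - 0) / h - 0) with (f (a + h) / h) by (field; exact Hh0).
  unfold Rdiv. rewrite Rabs_mult, Rabs_inv.
  assert (0 < Rabs h) by (apply Rabs_pos_lt; exact Hh0).
  apply Rmult_lt_reg_r with (Rabs h); [lra|]. rewrite Rmult_assoc, Rinv_l, Rmult_1_r by lra.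
  specialize (H (a + h)). replace (a + h - a) with h in H by ring.
  apply (Rmult_lt_compat_l K') in Hh; [|lra].
  replace (K' * (e / K')) with e in Hh by (field; lra).
  eapply Rle_lt_trans; [exact H|].
  apply Rle_lt_trans with (K' * Rabs h * Rabs h); [|nra].
  replace (h ^ 2) with (Rabs h * Rabs h) by (rewrite <- Rabs_mult, Rabs_pos_eq; [ring|nra]).
  rewrite <- Rmult_assoc. apply Rmult_le_compat_r; [lra|]. apply Rmult_le_compat_r; [lra|].
  unfold K'. generalize (Rle_abs K). lra.
Qed.

(** The powers of [/ x] make the family stable under differentiation, so that smoothness of all
    orders is a single induction. *)
Definition flat_exp_pow (n : nat) (x : R) : R :=
  if Rle_dec x 0 then 0 else (/ x) ^ n * exp (- / x).

Lemma flat_exp_pow_pos n x : 0 < x -> flat_exp_pow n x = (/ x) ^ n * exp (- / x).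
Proof. intros H. unfold flat_exp_pow. destruct Rle_dec; [lra|reflexivity]. Qed.

Lemma flat_exp_pow_neg n x : x <= 0 -> flat_exp_pow n x = 0.
Proof. intros H. unfold flat_exp_pow. destruct Rle_dec; [reflexivity|lra]. Qed.

Lemma flat_exp_pow_flat (n k : nat) : exists K, 0 < K /\ forall x, Rabs (flat_exp_pow n x) <= K * Rabs x ^ k.
Proof.
  destruct (pow_le_exp (n + k)) as [K [HK H]]. exists K. split; [exact HK|]. intros x.
  destruct (Rle_lt_dec x 0) as [Hx|Hx].
  - rewrite flat_exp_pow_neg, Rabs_R0 by exact Hx. apply Rmult_le_pos; [lra|]. apply pow_le, Rabs_pos.
  - rewrite flat_exp_pow_pos by exact Hx. assert (0 < / x) as Hi by (apply Rinv_0_lt_compat; exact Hx).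
    specialize (H (/ x) ltac:(lra)). rewrite pow_add in H.
    rewrite (Rabs_pos_eq x) by lra. rewrite Rabs_pos_eq.
    2:{ apply Rmult_le_pos; [apply pow_le; lra|left; apply exp_pos]. }
    rewrite exp_Ropp. apply Rmult_le_reg_r with (exp (/ x)); [apply exp_pos|].
    rewrite Rmult_assoc, Rinv_l, Rmult_1_r by (apply Rgt_not_eq, exp_pos).
    assert ((/ x) ^ k * x ^ k = 1) as E by (rewrite <- Rpow_mult_distr, Rinv_l, pow1; lra).
    apply (Rmult_le_compat_r (x ^ k)) in H; [|apply pow_le; lra].
    rewrite Rmult_assoc, E in H. lra.
Qed.

Lemma is_derive_flat_exp_pow n x :
  is_derive (flat_exp_pow n) x (flat_exp_pow (S (S n)) x + - INR n * flat_exp_pow (S n) x).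
Proof.
  destruct (total_order_T x 0) as [[Hx|Hx]|Hx].
  - rewrite !flat_exp_pow_neg by lra. rewrite Rmult_0_r, Rplus_0_r.
    apply (is_derive_ext_loc (fun _ => 0)); [|exact (is_derive_const (K := R_AbsRing) (V := R_NormedModule) 0 x)].
    assert (0 < - x) as P by lra. exists (mkposreal _ P). intros y Hy.
    unfold ball in Hy; simpl in Hy; unfold AbsRing_ball, abs, minus, plus, opp in Hy; simpl in Hy.
    apply Rabs_lt_between in Hy. rewrite flat_exp_pow_neg; lra.
  - subst x. rewrite !flat_exp_pow_neg by lra. rewrite Rmult_0_r, Rplus_0_r.
    destruct (flat_exp_pow_flat n 2) as [K [_ HK]]. apply (is_derive_flat _ _ K). intros y.
    rewrite Rminus_0_r. specialize (HK y). rewrite RPow_abs in HK.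
    rewrite (Rabs_pos_eq (y ^ 2)) in HK by apply pow2_ge_0. exact HK.
  - rewrite !flat_exp_pow_pos by lra.
    apply (is_derive_ext_loc (fun x => (/ x) ^ n * exp (- / x))).
    + exists (mkposreal _ Hx). intros y Hy.
      unfold ball in Hy; simpl in Hy; unfold AbsRing_ball, abs, minus, plus, opp in Hy; simpl in Hy.
      apply Rabs_lt_between in Hy. rewrite flat_exp_pow_pos; lra.
    + auto_derive; [lra|]. destruct n; simpl; field; lra.
Qed.

Lemma Cn_flat_exp_pow k n O : Cn (V := R_NormedModule) k O (flat_exp_pow n).
Proof.
  revert n. induction k; intros n.
  - split; [|exact I]. intros x _. apply (ex_derive_continuous (V := R_NormedModule)).
    eexists. apply is_derive_flat_exp_pow.
  - eapply Cn_R_derive; [intros x _; apply is_derive_flat_exp_pow|].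
    apply Cn_plus; [apply IHk|]. apply Cn_scal, IHk.
Qed.

Definition flat_exp (x : R) : R := flat_exp_pow 0 x.

Lemma Cn_flat_exp k O : Cn (V := R_NormedModule) k O flat_exp.
Proof. exact (Cn_flat_exp_pow k 0 O). Qed.

Lemma flat_exp_neg x : x <= 0 -> flat_exp x = 0.
Proof. apply flat_exp_pow_neg. Qed.

Lemma flat_exp_pos x : 0 < x -> 0 < flat_exp x.
Proof. intros H. unfold flat_exp. rewrite flat_exp_pow_pos by exact H. simpl. rewrite Rmult_1_l. apply exp_pos. Qed.

Lemma flat_exp_range x : 0 <= flat_exp x <= 1.
Proof.
  destruct (Rle_lt_dec x 0) as [H|H]; [rewrite flat_exp_neg; lra|].
  split; [left; apply flat_exp_pos, H|]. unfold flat_exp. rewrite flat_exp_pow_pos by exact H. simpl.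
  rewrite Rmult_1_l, <- exp_0. left. apply exp_increasing.
  generalize (Rinv_0_lt_compat x H). lra.
Qed.

Lemma flat_exp_flat k : exists K, 0 < K /\ forall x, flat_exp x <= K * Rabs x ^ k.
Proof.
  destruct (flat_exp_pow_flat 0 k) as [K [HK H]]. exists K. split; [exact HK|].
  intros x. eapply Rle_trans; [apply Rle_abs|apply H].
Qed.

Lemma flat_exp_derive_bound : exists K, 0 < K /\ forall x y, Rabs (flat_exp x - flat_exp y) <= K * Rabs (x - y).
Proof.
  destruct (flat_exp_pow_flat 2 0) as [K [HK H]]. exists K. split; [exact HK|]. intros x y.
  destruct (MVT_gen flat_exp y x (flat_exp_pow 2)) as [c [_ E]].
  - intros z _. generalize (is_derive_flat_exp_pow 0 z). simpl.
    rewrite Ropp_0, Rmult_0_l, Rplus_0_r. auto.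
  - intros z _. apply continuity_pt_filterlim. apply (ex_derive_continuous (V := R_NormedModule)).
    eexists. apply is_derive_flat_exp_pow.
  - rewrite E, Rabs_mult. apply Rmult_le_compat_r; [apply Rabs_pos|].
    specialize (H c). simpl in H. lra.
Qed.

(* For -1 < t < 1 the boundary value of s = log((Z-1)/(Z+1)) at t is
   [slog t] + i pi.  The functions [gauss m j b (slog t)] span a space that
   contains Re and Im of exp(-s^2) and is closed under d/dt. *)
Definition slog (t : R) : R := ln (1 - t) - ln (1 + t).
Definition gauss (m : R) (j : nat) (b L : R) : R := exp (m * L - L * L) * L ^ j * cos (2 * PI * L + b).
Definition gauss_slog (m : R) (j : nat) (b t : R) : R :=
  if Rlt_dec (Rabs t) 1 then gauss m j b (slog t) else 0.

Lemma gauss_slog_in m j b t : -1 < t < 1 -> gauss_slog m j b t = gauss m j b (slog t).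
Proof. intros H. unfold gauss_slog. destruct Rlt_dec as [|N]; [reflexivity|]. exfalso. apply N, Rabs_lt_between; lra. Qed.

Lemma gauss_slog_out m j b t : t <= -1 \/ 1 <= t -> gauss_slog m j b t = 0.
Proof. intros H. unfold gauss_slog. destruct Rlt_dec as [P|]; [|reflexivity]. apply Rabs_lt_between in P. lra. Qed.

Lemma gauss_bound m j b : exists K, 0 < K /\ forall L, Rabs (gauss m j b L) <= K * exp (- (2 * Rabs L)).
Proof.
  destruct (pow_le_exp j) as [K [HK H]].
  (* Completing the square: [(Rabs m + 3) * Rabs L - L * L <= q * q]. The share [Rabs m] pays for
     the linear exponent, 1 for the power [L ^ j], and 2 for the decay claimed. *)
  set (q := (Rabs m + 3) / 2). exists (K * exp (q * q)). split.
  { apply Rmult_lt_0_compat; [exact HK|apply exp_pos]. }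
  intros L. unfold gauss. rewrite !Rabs_mult, <- RPow_abs.
  rewrite (Rabs_pos_eq (exp _)) by (left; apply exp_pos).
  specialize (H (Rabs L) (Rabs_pos L)).
  assert (Rabs (cos (2 * PI * L + b)) <= 1) by (apply Rabs_le; generalize (COS_bound (2 * PI * L + b)); lra).
  apply Rle_trans with (exp (m * L - L * L) * (K * exp (Rabs L)) * 1).
  { apply Rmult_le_compat; auto.
    - apply Rmult_le_pos; [left; apply exp_pos|apply pow_le, Rabs_pos].
    - apply Rabs_pos.
    - apply Rmult_le_compat_l; [left; apply exp_pos|exact H]. }
  replace (exp (m * L - L * L) * (K * exp (Rabs L)) * 1) with (K * (exp (m * L - L * L) * exp (Rabs L))) by ring.
  rewrite Rmult_assoc. apply Rmult_le_compat_l; [lra|]. rewrite <- !exp_plus.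
  apply exp_le_compat. unfold q.
  assert (m * L <= Rabs m * Rabs L) by (rewrite <- Rabs_mult; apply Rle_abs).
  assert (L * L = Rabs L * Rabs L) as E by (rewrite <- Rabs_mult, Rabs_pos_eq; nra).
  rewrite E. generalize (Rabs m) (Rabs L) H1. intros u v. clear. intros.
  assert (0 <= ((u + 3) / 2 - v) * ((u + 3) / 2 - v)) by apply Rle_0_sqr. lra.
Qed.

(** The left side is exactly (1 - |t|) / (1 + |t|). *)
Lemma slog_exp_bound t : -1 < t < 1 -> exp (- Rabs (slog t)) <= 1 - Rabs t.
Proof.
  intros Ht. unfold slog.
  assert (forall u, 0 <= u < 1 -> exp (- Rabs (ln (1 - u) - ln (1 + u))) <= 1 - u) as H.
  { intros u Hu. rewrite Rabs_left1.
    - replace (- - (ln (1 - u) - ln (1 + u))) with (ln (1 - u) + - ln (1 + u)) by ring.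
      rewrite exp_plus, exp_Ropp, !exp_ln by lra.
      rewrite <- (Rmult_1_r (1 - u)) at 2. apply Rmult_le_compat_l; [lra|].
      rewrite <- Rinv_1. apply Rinv_le_contravar; lra.
    - assert (ln (1 - u) <= ln (1 + u)) by (apply ln_le; lra). lra. }
  destruct (Rle_dec 0 t) as [P|P].
  - rewrite (Rabs_pos_eq t) by lra. apply H. lra.
  - rewrite (Rabs_left t) by lra. specialize (H (- t) ltac:(lra)).
    rewrite <- Rabs_Ropp. replace (- (ln (1 - t) - ln (1 + t))) with (ln (1 - - t) - ln (1 + - t)); [exact H|].
    replace (1 - - t) with (1 + t) by ring. replace (1 + - t) with (1 - t) by ring. ring.
Qed.

(** Decay like [exp (- (2 * Rabs (slog t)))] means decay like (1 - |t|)^2, the order that makes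
    derivatives at 1 and -1 vanish by [is_derive_flat]. *)
Lemma gauss_slog_flat m j b : exists K, 0 < K /\ forall t,
  Rabs (gauss_slog m j b t) <= K * (t - 1) ^ 2 /\ Rabs (gauss_slog m j b t) <= K * (t - -1) ^ 2.
Proof.
  destruct (gauss_bound m j b) as [K [HK H]]. exists K. split; [exact HK|]. intros t.
  destruct (Rlt_dec (Rabs t) 1) as [P|P].
  - apply Rabs_lt_between in P. rewrite gauss_slog_in by lra. specialize (H (slog t)).
    generalize (slog_exp_bound t ltac:(lra)) (exp_pos (- Rabs (slog t))). intros E1 E2.
    replace (- (2 * Rabs (slog t))) with (- Rabs (slog t) + - Rabs (slog t)) in H by ring.
    rewrite exp_plus in H. generalize (Rle_abs t) (Rle_abs (- t)). rewrite Rabs_Ropp. intros A1 A2.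
    set (e := exp (- Rabs (slog t))) in *.
    split; (eapply Rle_trans; [exact H|]; apply Rmult_le_compat_l; [lra|]; nra).
  - rewrite gauss_slog_out.
    + rewrite Rabs_R0. split; (apply Rmult_le_pos; [lra|apply pow2_ge_0]).
    + destruct (Rle_dec 1 t); [right; lra|left]. apply Rnot_lt_le. intro. apply P, Rabs_lt_between. lra.
Qed.

(** The derivative of [gauss] in [L], with the coefficient [a] kept apart from the exponent [m]:
    multiplying by [exp L] or [exp (- L)] shifts [m] by one but leaves [a]. For [j = 0] the term
    with [pred j] has coefficient 0; the sine is a cosine with phase [b + PI / 2]. *)
Definition gauss_slog_comb (a m : R) (j : nat) (b t : R) : R :=
  a * gauss_slog m j b t + -2 * gauss_slog m (S j) b t
  + (INR j * gauss_slog m (pred j) b t + 2 * PI * gauss_slog m j (b + PI / 2) t).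

(** The derivative of [slog], -2 / (1 - t^2), equals - (1 + cosh (slog t)); in this form the chain
    rule stays inside the span of the [gauss_slog]. *)
Definition gauss_slog_deriv (m : R) (j : nat) (b t : R) : R :=
  -1 * (gauss_slog_comb m m j b t
    + (/ 2 * gauss_slog_comb m (m + 1) j b t + / 2 * gauss_slog_comb m (m - 1) j b t)).

Lemma is_derive_gauss m j b L : is_derive (gauss m j b) L
  (m * gauss m j b L + -2 * gauss m (S j) b L + (INR j * gauss m (pred j) b L + 2 * PI * gauss m j (b + PI / 2) L)).
Proof.
  unfold gauss. replace (2 * PI * L + (b + PI / 2)) with (PI / 2 + (2 * PI * L + b)) by ring.
  rewrite (cos_plus (PI / 2)), cos_PI2, sin_PI2. auto_derive; [auto|].
  unfold Rminus. rewrite <- tech_pow_Rmult. generalize (L ^ Nat.pred j) (L ^ j). intros. ring.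
Qed.

Lemma is_derive_gauss_slog m j b t : is_derive (gauss_slog m j b) t (gauss_slog_deriv m j b t).
Proof.
  assert (forall a, t = a -> (a = 1 \/ a = -1) -> is_derive (gauss_slog m j b) t (gauss_slog_deriv m j b t)) as HE.
  { intros a -> Ha. unfold gauss_slog_deriv, gauss_slog_comb.
    rewrite !gauss_slog_out by lra. rewrite !Rmult_0_r, !Rplus_0_r, !Rmult_0_r, ?Rplus_0_r, ?Rmult_0_r.
    destruct (gauss_slog_flat m j b) as [K [_ HK]]. apply (is_derive_flat _ _ K). intros x.
    destruct Ha as [-> | ->]; apply HK. }
  destruct (Req_dec t 1) as [E|N1]; [apply (HE 1); auto|].
  destruct (Req_dec t (-1)) as [E|N2]; [apply (HE (-1)); auto|]. clear HE.
  destruct (Rlt_dec (Rabs t) 1) as [P|P].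
  - apply Rabs_lt_between in P.
    apply (is_derive_ext_loc (fun x => gauss m j b (slog x))).
    { assert (0 < Rmin (1 - t) (1 + t)) as Hd by (apply Rmin_pos; lra).
      exists (mkposreal _ Hd). intros y Hy.
      unfold ball in Hy; simpl in Hy; unfold AbsRing_ball, abs, minus, plus, opp in Hy; simpl in Hy.
      apply Rabs_lt_between in Hy. generalize (Rmin_l (1 - t) (1 + t)) (Rmin_r (1 - t) (1 + t)). intros.
      rewrite gauss_slog_in; lra. }
    assert (is_derive slog t (- (1 + / 2 * exp (slog t) + / 2 * exp (- slog t)))) as DL.
    { unfold slog. replace (- (ln (1 - t) - ln (1 + t))) with (ln (1 + t) + - ln (1 - t)) by ring.
      unfold Rminus at 3. rewrite !exp_plus, !exp_Ropp, !exp_ln by lra.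
      auto_derive; [lra|]. field. lra. }
    generalize (is_derive_comp (V := R_NormedModule) (gauss m j b) slog t _ _ (is_derive_gauss m j b (slog t)) DL).
    intro H. match type of H with is_derive _ _ ?d => replace (gauss_slog_deriv m j b t) with d; [exact H|] end.
    unfold scal; simpl. unfold mult; simpl. unfold gauss_slog_deriv, gauss_slog_comb.
    rewrite !gauss_slog_in by lra. unfold gauss. generalize (slog t). intro L.
    replace ((m + 1) * L - L * L) with ((m * L - L * L) + L) by ring.
    replace ((m - 1) * L - L * L) with ((m * L - L * L) + - L) by ring.
    rewrite !exp_plus. ring.
  - assert (t < -1 \/ 1 < t) as Ht.
    { destruct (Rlt_dec 1 t); [right; lra|left]. apply Rnot_le_lt. intro. apply P, Rabs_lt_between. lra. }
    unfold gauss_slog_deriv, gauss_slog_comb.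
    rewrite !gauss_slog_out by lra. rewrite !Rmult_0_r, !Rplus_0_r, !Rmult_0_r, ?Rplus_0_r, ?Rmult_0_r.
    apply (is_derive_ext_loc (fun _ => 0)); [|exact (is_derive_const (K := R_AbsRing) (V := R_NormedModule) 0 t)].
    assert (0 < Rmax (t - 1) (-1 - t)) as Hd.
    { destruct Ht; [eapply Rlt_le_trans; [|apply Rmax_r]; lra|eapply Rlt_le_trans; [|apply Rmax_l]; lra]. }
    exists (mkposreal _ Hd). intros y Hy.
    unfold ball in Hy; simpl in Hy; unfold AbsRing_ball, abs, minus, plus, opp in Hy; simpl in Hy.
    apply Rabs_lt_between in Hy. rewrite gauss_slog_out; [reflexivity|].
    destruct Ht as [Ht|Ht]; [rewrite Rmax_right in Hy by lra|rewrite Rmax_left in Hy by lra]; lra.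
Qed.

Lemma Cn_gauss_slog k m j b O : Cn (V := R_NormedModule) k O (gauss_slog m j b).
Proof.
  revert m j b. induction k; intros m j b.
  - split; [|exact I]. intros x _. apply (ex_derive_continuous (V := R_NormedModule)).
    eexists. apply is_derive_gauss_slog.
  - eapply Cn_R_derive; [intros x _; apply is_derive_gauss_slog|].
    unfold gauss_slog_deriv, gauss_slog_comb.
    repeat first [apply Cn_scal; [] | apply Cn_plus | apply IHk | apply Cn_mult; [apply Cn_const|] ].
Qed.

(** * The holomorphic field exp(-log((Z-1)/(Z+1))^2) *)

(** On the upper half-plane the argument is the arc cotangent of [Re w / Im w], one formula without
    case distinction and with values between 0 and pi. *)
Definition clog (w : C) : C := (ln (Cmod w), PI / 2 - atan (Re w / Im w)).

Lemma cexp_clog (w : C) : 0 < Im w -> cexp (clog w) = w.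
Proof.
  intros H. destruct w as [u v]. simpl in H. unfold clog, cexp. simpl.
  assert (0 < Cmod (u, v)) as P by (eapply Rlt_le_trans; [|apply im_le_Cmod]; simpl; rewrite Rabs_pos_eq; lra).
  rewrite exp_ln by exact P. rewrite cos_minus, sin_minus, cos_PI2, sin_PI2, sin_atan, cos_atan.
  assert (sqrt (1 + (u / v)²) = Cmod (u, v) / v) as E.
  { transitivity (sqrt ((u ^ 2 + v ^ 2) / (v * v))).
    - f_equal. unfold Rsqr. field. lra.
    - rewrite sqrt_div_alt, sqrt_square by nra. reflexivity. }
  rewrite E. f_equal; field; split; lra.
Qed.

Lemma Cmod_continuous_pt (F : C -> R) (z : C) : @continuous C_UniformSpace R_UniformSpace F z ->
  forall e, 0 < e -> exists d, 0 < d /\ forall w, Cmod (w - z) < d -> Rabs (F w - F z) < e.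
Proof.
  intros H e He. destruct (proj1 (filterlim_locally F (F z)) H (mkposreal e He)) as [d Hd].
  exists d. split; [apply cond_pos|]. intros w Hw. apply (Hd w).
  split; (eapply Rle_lt_trans; [|exact Hw]).
  - exact (re_le_Cmod (w - z)).
  - exact (im_le_Cmod (w - z)).
Qed.

Lemma Cmod_continuous (z : C) : @continuous C_UniformSpace R_UniformSpace Cmod z.
Proof.
  apply (proj2 (filterlim_locally Cmod (Cmod z))). intros e.
  assert (0 < e / 2) as He by (generalize (cond_pos e); lra).
  exists (mkposreal _ He). intros w [H1 H2].
  change (Rabs (Cmod w - Cmod z) < e).
  assert (Cmod (w - z) < e).
  { eapply Rle_lt_trans; [apply Cmod_le_sum|].
    replace (pos e) with (e / 2 + e / 2) by field. apply Rplus_lt_compat; [exact H1|exact H2]. }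
  generalize (Cmod_sub_ge w z) (Cmod_sub_ge z w). rewrite (Cmod_sub_sym z w). intros.
  apply Rabs_lt_between. lra.
Qed.

Lemma clog_ccont (w : C) : 0 < Im w -> ccont clog w.
Proof.
  intros H e He.
  assert (0 < Cmod w) as P by (eapply Rlt_le_trans; [exact H|]; eapply Rle_trans; [apply Rle_abs|apply im_le_Cmod]).
  destruct (Cmod_continuous_pt (fun w => ln (Cmod w)) w) with (e := e / 2) as [d1 [Hd1 H1]]; [|lra|].
  { apply (continuous_comp Cmod ln); [apply Cmod_continuous|].
    apply (ex_derive_continuous (V := R_NormedModule)). auto_derive. exact P. }
  destruct (Cmod_continuous_pt (fun w => PI / 2 - atan (Re w / Im w)) w) with (e := e / 2) as [d2 [Hd2 H2]]; [|lra|].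
  { apply (continuous_comp (fun w : C => Re w / Im w) (fun x => PI / 2 - atan x)).
    - apply (continuous_mult (K := R_AbsRing) (fun w : C => Re w) (fun w : C => / Im w)).
      + apply continuous_fst.
      + apply (continuous_comp (fun w : C => Im w) Rinv); [apply continuous_snd|].
        apply (ex_derive_continuous (V := R_NormedModule)). auto_derive. lra.
    - apply (ex_derive_continuous (V := R_NormedModule)). auto_derive. auto. }
  exists (Rmin d1 d2). split; [apply Rmin_pos; auto|]. intros v Hv.
  apply Rmin_Rgt_l in Hv. destruct Hv as [Hv1 Hv2].
  eapply Rle_trans; [apply Cmod_le_sum|]. unfold clog; simpl.
  specialize (H1 v Hv1). specialize (H2 v Hv2). unfold Rminus in *. lra.
Qed.

Lemma cderiv_clog (w : C) : 0 < Im w -> cderiv clog w (/ w)%C.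
Proof.
  intros H. apply (cderiv_inverse cexp clog w w (Im w)); [exact H| |apply clog_ccont, H| |].
  - intros v Hv. apply cexp_clog.
    generalize (im_le_Cmod (v - w)). destruct v, w. simpl in *. intro Q.
    apply Rle_lt_trans with (2 := Hv) in Q. apply Rabs_lt_between in Q. lra.
  - intros ->. simpl in H. lra.
  - generalize (cderiv_cexp (clog w)). rewrite cexp_clog by exact H. auto.
Qed.

Lemma carg_range (w : C) : 0 <= Im (clog w) <= PI.
Proof. unfold clog; simpl. generalize (atan_bound (Re w / Im w)). lra. Qed.

Definition upper (z : C) : Prop := 0 < Im z.

Lemma upper_ne (z : C) (x : R) : upper z -> (z + x)%C <> 0.
Proof. unfold upper. destruct z as [u v]; simpl. intros H E. apply (f_equal snd) in E. simpl in E. lra. Qed.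

Definition ratio (z : C) : C := ((1 * z + - (1)) / (1 * z + 1))%C.

Lemma ratio_upper (z : C) : upper z -> 0 < Im (ratio z).
Proof.
  intros H. unfold upper in H. unfold ratio. destruct z as [x y]. simpl in *.
  assert (0 < (1 * x - 0 * y + 1) ^ 2 + (1 * y + 0 * x + 0) ^ 2).
  { generalize (pow2_ge_0 (1 * x - 0 * y + 1)). nra. }
  match goal with |- 0 < ?e => replace e with
    (2 * y / ((1 * x - 0 * y + 1) ^ 2 + (1 * y + 0 * x + 0) ^ 2)) by (field; generalize (Rle_0_sqr (x + 1)); unfold Rsqr; intro; apply Rgt_not_eq; nra) end.
  apply Rdiv_lt_0_compat; lra.
Qed.

Lemma ratio_quot (x y : R) : 0 < y -> Re (ratio (x, y)) / Im (ratio (x, y)) = (x ^ 2 + y ^ 2 - 1) / (2 * y).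
Proof.
  intros H. unfold ratio. simpl. field. repeat split; generalize (Rle_0_sqr (x + 1)); unfold Rsqr; intro; apply Rgt_not_eq; nra.
Qed.

Lemma ratio_denom (z : C) : upper z -> (1 * z + 1)%C <> 0.
Proof. intros H. rewrite Cmult_1_l. apply upper_ne, H. Qed.

Definition slogC (z : C) : C := clog (ratio z).
Definition gfun (z : C) : C := cexp (- (slogC z * slogC z)).

(** The derivative 2 / (Z^2 - 1) of s is expressed by [ratio z], which is exp(s). It is thus bounded
    by a multiple of exp|Re s|, which the Gaussian factor dominates. *)
Lemma cderiv_gfun (z : C) : upper z ->
  cderiv gfun z (gfun z * (- (1) * (2 * slogC z * ((ratio z + / ratio z - 2) / 2))))%C.
Proof.
  intros H. apply (cderiv_comp cexp (fun z => - (slogC z * slogC z))%C); [|apply cderiv_cexp].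
  apply (cderiv_ext_loc (fun z => - (1) * (slogC z * slogC z))%C) with (r := 1); [lra|intros; ring|].
  apply cderiv_scal. apply (cderiv_comp (fun w => w * w)%C slogC); [|apply cderiv_square].
  replace ((ratio z + / ratio z - 2) / 2)%C with
    (/ ratio z * ((1 * 1 - - (1) * 1) / ((1 * z + 1) * (1 * z + 1))))%C.
  - apply (cderiv_comp clog ratio).
    + apply cderiv_mobius. apply ratio_denom, H.
    + apply cderiv_clog, ratio_upper, H.
  - unfold ratio. field. split; [rewrite <- (Cmult_1_l z); apply ratio_denom, H|].
    exact (upper_ne z (-1) H).
Qed.

(** The modulus is exp((Im s)^2 - (Re s)^2), and Im s is an argument in [0, pi]. *)
Lemma Cmod_gfun (z : C) : upper z -> Cmod (gfun z) <= exp (PI * PI - Re (slogC z) * Re (slogC z)).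
Proof.
  intros H. unfold gfun. rewrite Cmod_cexp. apply exp_le_compat.
  generalize (carg_range (ratio z)). fold (slogC z). destruct (slogC z) as [a b]. simpl. nra.
Qed.

Lemma gfun_bounded : exists B, forall z, upper z -> Cmod (gfun z) <= B.
Proof.
  exists (exp (PI * PI)). intros z H. eapply Rle_trans; [apply Cmod_gfun, H|].
  apply exp_le_compat. nra.
Qed.

Lemma Re_slogC (z : C) : upper z -> exp (Re (slogC z)) = Cmod (ratio z).
Proof.
  intros H. unfold slogC, clog. simpl. apply exp_ln. apply Cmod_gt_0.
  intros E. generalize (ratio_upper z H). rewrite E. simpl. lra.
Qed.

Lemma gfun_lipschitz_upper : exists K, 0 < K /\ forall z w, upper z -> upper w ->
  Cmod (gfun w - gfun z) <= K * Cmod (w - z).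
Proof.
  (* With a = |Re s| the factors of the derivative are at most exp(pi^2 - a^2), 2 exp(a + pi) and 2
     exp(a), and 2a - a^2 <= 1. *)
  exists (4 * exp (PI + PI * PI + 1)). split; [generalize (exp_pos (PI + PI * PI + 1)); lra|].
  intros z w Hz Hw.
  apply (cderiv_lipschitz upper gfun
    (fun z => gfun z * (- (1) * (2 * slogC z * ((ratio z + / ratio z - 2) / 2))))%C).
  - intros t Ht. unfold upper in *. destruct z as [x y], w as [u v]. simpl in *. nra.
  - intros p Hp. apply cderiv_gfun, Hp.
  - clear z w Hz Hw. intros z H. generalize (Cmod_gfun z H) (Re_slogC z H) (carg_range (ratio z)). fold (slogC z).
    intros HG HE HA.
    assert (ratio z <> 0) as Hr.
    { intros E. generalize (ratio_upper z H). rewrite E. simpl. lra. }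
    assert (Cmod (/ ratio z) = exp (- Re (slogC z))) as HE'.
    { rewrite Cmod_inv, <- HE, exp_Ropp by exact Hr. reflexivity. }
    set (s := slogC z) in *. set (a := Rabs (Re s)).
    assert (Cmod s <= a + PI) as Hs.
    { eapply Rle_trans; [apply Cmod_le_sum|]. fold a. rewrite (Rabs_pos_eq (Im s)); lra. }
    assert (Cmod (ratio z) <= exp a) as H1.
    { rewrite <- HE. apply exp_le_compat, Rle_abs. }
    assert (Cmod (/ ratio z) <= exp a) as H2.
    { rewrite HE'. apply exp_le_compat. unfold a. rewrite <- Rabs_Ropp. apply Rle_abs. }
    assert (0 <= a) as Ha by apply Rabs_pos.
    assert (1 <= exp a) as H3 by (rewrite <- exp_0; apply exp_le_compat, Ha).
    assert (Cmod ((ratio z + / ratio z - 2) / 2)%C <= 2 * exp a) as H4.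
    { unfold Cdiv. rewrite <- RtoC_inv by lra. rewrite Cmod_mult, Cmod_R, (Rabs_pos_eq (/ 2)) by lra.
      assert (Cmod (ratio z + / ratio z - 2) <= exp a + exp a + 2); [|lra].
      eapply Rle_trans; [apply Cmod_sub_le|]. rewrite Cmod_R, (Rabs_pos_eq 2) by lra.
      generalize (Cmod_triangle (ratio z) (/ ratio z)). lra. }
    rewrite !Cmod_mult, Cmod_opp, !Cmod_R, (Rabs_pos_eq 2), Rabs_R1 by lra.
    apply Rle_trans with (exp (PI * PI - a * a) * (1 * (2 * exp (a + PI) * (2 * exp a)))).
    { apply Rmult_le_compat; [apply Cmod_ge_0| | |].
      - rewrite Rmult_1_l. repeat apply Rmult_le_pos; try apply Cmod_ge_0; lra.
      - eapply Rle_trans; [exact HG|]. apply exp_le_compat. unfold a.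
        rewrite <- Rabs_mult, (Rabs_pos_eq (Re s * Re s)) by nra. lra.
      - rewrite !Rmult_1_l. apply Rmult_le_compat; try apply Cmod_ge_0.
        + generalize (Cmod_ge_0 s); lra.
        + assert (Cmod s <= exp (a + PI)); [|lra].
          eapply Rle_trans; [exact Hs|]. generalize (exp_ineq1_le (a + PI)). lra.
        + exact H4. }
    replace (exp (PI * PI - a * a) * (1 * (2 * exp (a + PI) * (2 * exp a)))) with
      (4 * (exp (PI * PI - a * a) * exp (a + PI) * exp a)) by ring.
    rewrite <- !exp_plus. apply Rmult_le_compat_l; [lra|]. apply exp_le_compat.
    generalize (Rle_0_sqr (a - 1)). unfold Rsqr. lra.
Qed.

(** On (-1,1) one has s = [slog t] + i pi, so -s^2 = pi^2 - [slog t]^2 - 2 pi i [slog t]; the sine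
    of the imaginary part becomes a cosine with phase [PI / 2]. *)
Definition kappa (t : R) : C :=
  (exp (PI * PI) * gauss_slog 0 0 0 t, exp (PI * PI) * gauss_slog 0 0 (PI / 2) t).

Definition boundary_value (x : R) : C :=
  if Rlt_dec 1 (Rabs x) then RtoC (exp (- (ln (Rabs (x - 1)) - ln (Rabs (x + 1))) ^ 2)) else kappa x.

Lemma kappa_out (t : R) : 1 <= Rabs t -> kappa t = 0.
Proof.
  intros H. unfold kappa. rewrite !gauss_slog_out.
  - rewrite !Rmult_0_r. reflexivity.
  - destruct (Rle_dec 1 t); [right; lra|left]. unfold Rabs in H. destruct Rcase_abs in H; lra.
  - destruct (Rle_dec 1 t); [right; lra|left]. unfold Rabs in H. destruct Rcase_abs in H; lra.
Qed.

Lemma boundary_value_in (x : R) : Rabs x <= 1 -> boundary_value x = kappa x.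
Proof. intros H. unfold boundary_value. destruct Rlt_dec; [lra|reflexivity]. Qed.

Lemma boundary_value_out (x : R) : 1 <= Rabs x -> Im (boundary_value x) = 0.
Proof.
  intros H. unfold boundary_value. destruct Rlt_dec; [reflexivity|]. rewrite kappa_out by exact H. reflexivity.
Qed.

Definition slog_re (x y : R) : R := / 2 * ln ((x - 1) ^ 2 + y ^ 2) - / 2 * ln ((x + 1) ^ 2 + y ^ 2).

Lemma Cmod_sq_ln (u v : R) : 0 < u ^ 2 + v ^ 2 -> ln (Cmod (u, v)) = / 2 * ln (u ^ 2 + v ^ 2).
Proof.
  intros H. unfold Cmod. simpl fst. simpl snd. rewrite <- Rpower_sqrt by exact H. unfold Rpower.
  apply ln_exp.
Qed.

Lemma Re_slogC_formula (x y : R) : 0 < y -> Re (slogC (x, y)) = slog_re x y.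
Proof.
  intros H. unfold slogC, clog, ratio. simpl Re.
  assert (forall c : R, 0 < (x + c) ^ 2 + y ^ 2) as P by (intro c; generalize (pow2_ge_0 (x + c)); nra).
  assert ((1 * (x, y) + 1)%C <> 0) as N by (apply ratio_denom; exact H).
  rewrite Cmod_div by exact N.
  replace (1 * (x, y) + - (1))%C with ((x - 1, y) : C) by (unfold Cplus, Cmult, Copp; simpl; f_equal; ring).
  replace (1 * (x, y) + 1)%C with ((x + 1, y) : C) by (unfold Cplus, Cmult; simpl; f_equal; ring).
  unfold Rdiv. rewrite ln_mult, ln_Rinv, !Cmod_sq_ln.
  - unfold slog_re. ring.
  - apply (P 1).
  - apply (P (- 1)).
  - apply Cmod_gt_0. intro E. apply (f_equal snd) in E. simpl in E. lra.
  - apply Cmod_gt_0. intro E. apply (f_equal snd) in E. simpl in E. lra.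
  - apply Rinv_0_lt_compat. apply Cmod_gt_0. intro E. apply (f_equal snd) in E. simpl in E. lra.
Qed.

Lemma atan_reflect (q : R) : q <> 0 -> PI / 2 - atan q = (if Rlt_dec q 0 then PI else 0) + atan (/ q).
Proof.
  intros H. destruct Rlt_dec as [N|N].
  - assert (0 < - q) as P by lra. generalize (atan_inv (- q) P). rewrite Rinv_opp, !atan_opp. lra.
  - assert (0 < q) as P by lra. generalize (atan_inv q P). lra.
Qed.

(** The quotient inside [clog] blows up as y tends to 0. Reciprocating it gives an expression
    regular at y = 0 for |x| <> 1, with an extra pi inside the unit circle. *)
Lemma gfun_formula (x y : R) : 0 < y -> x ^ 2 + y ^ 2 <> 1 ->
  gfun (x, y) = cexp (- ((slog_re x y, (if Rlt_dec (x ^ 2 + y ^ 2) 1 then PI else 0) + atan (2 * y / (x ^ 2 + y ^ 2 - 1))) *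
     (slog_re x y, (if Rlt_dec (x ^ 2 + y ^ 2) 1 then PI else 0) + atan (2 * y / (x ^ 2 + y ^ 2 - 1))))).
Proof.
  intros H N. unfold gfun. do 2 f_equal.
  assert (slogC (x, y) = (slog_re x y, (if Rlt_dec (x ^ 2 + y ^ 2) 1 then PI else 0) + atan (2 * y / (x ^ 2 + y ^ 2 - 1)))) as E;
    [|rewrite E; reflexivity].
  rewrite <- Re_slogC_formula by exact H. apply injective_projections; [reflexivity|].
  unfold slogC, clog. cbn [snd].
  rewrite ratio_quot by exact H.
  assert (x ^ 2 + y ^ 2 - 1 <> 0) as N' by lra.
  assert ((x ^ 2 + y ^ 2 - 1) / (2 * y) <> 0) as Nq.
  { apply Rmult_integral_contrapositive_currified; [exact N'|]. apply Rinv_neq_0_compat; lra. }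
  rewrite atan_reflect by exact Nq. f_equal.
  - assert (0 < / (2 * y)) by (apply Rinv_0_lt_compat; lra). unfold Rdiv.
    destruct Rlt_dec as [A|A], Rlt_dec as [B|B]; try reflexivity; exfalso; nra.
  - f_equal. field. split; lra.
Qed.

Lemma half_ln_sq (a : R) : a <> 0 -> / 2 * ln (a ^ 2 + 0 ^ 2) = ln (Rabs a).
Proof.
  intros H. assert (0 < Rabs a) by (apply Rabs_pos_lt; exact H).
  replace (a ^ 2 + 0 ^ 2) with (Rabs a * Rabs a).
  - rewrite ln_mult by auto. field.
  - rewrite <- Rabs_mult, Rabs_pos_eq; [ring|nra].
Qed.

Lemma continuous_trig_square (f A B : R -> R) (t : R) : (forall z, ex_derive f z) ->
  ex_derive A t -> ex_derive B t ->
  continuous (fun y => exp (- (A y * A y - B y * B y)) * f (- (A y * B y + B y * A y))) t.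
Proof.
  intros Df DA DB. apply (ex_derive_continuous (V := R_NormedModule)). auto_derive. repeat split; auto.
Qed.

Lemma gfun_limit_regular (x : R) (e : R) : 0 < e -> Rabs x <> 1 -> exists d, 0 < d /\
  forall y, 0 < y < d -> Cmod (gfun (x, y) - boundary_value x) <= e.
Proof.
  intros He Hx.
  assert (x - 1 <> 0) as N1 by (intro E; apply Hx; replace x with 1 by lra; apply Rabs_R1).
  assert (x + 1 <> 0) as N2 by (intro E; apply Hx; replace x with (- (1)) by lra; rewrite Rabs_Ropp; apply Rabs_R1).
  (* The limit of Im s at the real axis: the argument of the real number (x - 1) / (x + 1). *)
  set (c := if Rlt_dec (Rabs x) 1 then PI else 0).
  set (A := fun y => slog_re x y). set (B := fun y => c + atan (2 * y / (x ^ 2 + y ^ 2 - 1))).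
  assert (x ^ 2 = Rabs x * Rabs x) as Ex by (rewrite <- Rabs_mult, Rabs_pos_eq; [ring|nra]).
  assert (exists d, 0 < d /\ forall y, 0 < y < d -> gfun (x, y) = cexp (- ((A y, B y) * (A y, B y)))) as [d0 [Hd0 HF]].
  { generalize (Rabs_pos x). intro Pa. destruct (Rlt_dec (Rabs x) 1) as [L|L].
    - exists (1 - Rabs x). split; [lra|]. intros y Hy. rewrite gfun_formula by (try lra; nra).
      unfold A, B, c. destruct Rlt_dec as [_|Q]; [reflexivity|]. exfalso. apply Q. nra.
    - exists 1. split; [lra|]. intros y Hy. rewrite gfun_formula by (try lra; nra).
      unfold A, B, c. destruct Rlt_dec as [Q|_]; [exfalso; nra|reflexivity]. }
  set (P := fun y => exp (- (A y * A y - B y * B y)) * cos (- (A y * B y + B y * A y))).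
  set (Q := fun y => exp (- (A y * A y - B y * B y)) * sin (- (A y * B y + B y * A y))).
  assert (0 < (x - 1) ^ 2 + 0 ^ 2) by nra. assert (0 < (x + 1) ^ 2 + 0 ^ 2) by nra.
  assert (x ^ 2 + 0 ^ 2 - 1 <> 0) as N3 by nra.
  assert (ex_derive A 0) as DA by (unfold A, slog_re; auto_derive; simpl in *; repeat split; lra).
  assert (ex_derive B 0) as DB by (unfold B; auto_derive; simpl in *; repeat split; lra).
  assert (continuous P 0) as CP.
  { apply (continuous_trig_square cos); auto. intros z. auto_derive. auto. }
  assert (continuous Q 0) as CQ.
  { apply (continuous_trig_square sin); auto. intros z. auto_derive. auto. }
  assert (boundary_value x = (P 0, Q 0)) as E.
  { assert (A 0 = ln (Rabs (x - 1)) - ln (Rabs (x + 1))) as EA.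
    { unfold A, slog_re. rewrite !half_ln_sq by auto. reflexivity. }
    assert (B 0 = c) as EB by (unfold B; rewrite Rmult_0_r; unfold Rdiv; rewrite Rmult_0_l, atan_0; ring).
    unfold P, Q. rewrite EB, EA. unfold boundary_value, c.
    destruct (Rlt_dec 1 (Rabs x)) as [L|L]; destruct (Rlt_dec (Rabs x) 1) as [L'|L'];
      [exfalso; lra| | |exfalso; apply Hx; lra].
    - unfold RtoC. set (u := ln (Rabs (x - 1)) - ln (Rabs (x + 1))).
      replace (- (u * 0 + 0 * u)) with 0 by ring.
      replace (- (u * u - 0 * 0)) with (- u ^ 2) by ring. rewrite cos_0, sin_0. f_equal; ring.
    - apply Rabs_lt_between in L'.
      replace (Rabs (x - 1)) with (1 - x) by (rewrite Rabs_left; lra).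
      replace (Rabs (x + 1)) with (1 + x) by (rewrite Rabs_pos_eq; lra).
      fold (slog x). unfold kappa. rewrite !gauss_slog_in by lra. unfold gauss. set (u := slog x).
      replace (- (u * u - PI * PI)) with (PI * PI + (0 * u - u * u)) by ring.
      rewrite exp_plus. replace (- (u * PI + PI * u)) with (- (2 * PI * u)) by ring.
      rewrite cos_neg, sin_neg, Rplus_0_r.
      replace (2 * PI * u + PI / 2) with (PI / 2 + 2 * PI * u) by ring.
      rewrite (cos_plus (PI / 2)), cos_PI2, sin_PI2. simpl. f_equal; ring. }
  destruct (proj1 (filterlim_locally P (P 0)) CP (mkposreal (e / 2) ltac:(lra))) as [d1 H1].
  destruct (proj1 (filterlim_locally Q (Q 0)) CQ (mkposreal (e / 2) ltac:(lra))) as [d2 H2].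
  exists (Rmin d0 (Rmin d1 d2)). split.
  { repeat apply Rmin_pos; auto; apply cond_pos. }
  intros y Hy.
  generalize (Rmin_l d0 (Rmin d1 d2)) (Rmin_r d0 (Rmin d1 d2)) (Rmin_l d1 d2) (Rmin_r d1 d2). intros.
  rewrite HF, E by lra. eapply Rle_trans; [apply Cmod_le_sum|].
  assert (forall d : posreal, y < d -> ball 0 d y) as Hb.
  { intros d Hd. change (Rabs (y - 0) < d). rewrite Rminus_0_r, Rabs_pos_eq; lra. }
  specialize (H1 y (Hb d1 ltac:(lra))). specialize (H2 y (Hb d2 ltac:(lra))).
  change (Rabs (P y - P 0) < e / 2) in H1. change (Rabs (Q y - Q 0) < e / 2) in H2.
  unfold Rminus in H1, H2. unfold cexp; simpl. fold (A y) (B y). unfold P, Q in *. unfold Rminus in *. lra.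
Qed.

Lemma exp_sq_bound (u v : R) : (u <= - v \/ v <= u) -> exp (- (u * u)) <= exp 1 * exp (- v).
Proof.
  intros H. rewrite <- exp_plus. apply exp_le_compat.
  generalize (Rle_0_sqr (u - 1)) (Rle_0_sqr (u + 1)) (Rle_0_sqr u). unfold Rsqr. lra.
Qed.

(** Above 1 and -1 the size of Re s is at least - ln y, and a Gaussian of that size is at most a
    multiple of y. *)
Lemma gfun_limit_singular (x : R) (e : R) : 0 < e -> Rabs x = 1 -> exists d, 0 < d /\
  forall y, 0 < y < d -> Cmod (gfun (x, y) - boundary_value x) <= e.
Proof.
  intros He Hx. rewrite boundary_value_in, kappa_out by lra.
  set (K := exp (PI * PI) * exp 1). assert (0 < K) by (apply Rmult_lt_0_compat; apply exp_pos).
  exists (e / K). split; [apply Rdiv_lt_0_compat; lra|]. intros y Hy.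
  replace (gfun (x, y) - 0)%C with (gfun (x, y)) by ring.
  assert (upper (x, y)) as Hu by (unfold upper; simpl; lra).
  eapply Rle_trans; [apply Cmod_gfun, Hu|]. unfold Rminus. rewrite exp_plus, Re_slogC_formula by lra.
  assert (y * K < e) as Hk.
  { apply Rmult_lt_reg_r with (/ K); [apply Rinv_0_lt_compat; auto|].
    rewrite Rmult_assoc, Rinv_r, Rmult_1_r by lra. apply Hy. }
  assert (exp (- (slog_re x y * slog_re x y)) <= exp 1 * y).
  { assert (- (- ln y) = ln y) as Eln by ring.
    replace y with (exp (- (- ln y))) at 3 by (rewrite Eln, exp_ln; lra).
    apply exp_sq_bound. rewrite Eln.
    assert (/ 2 * ln (0 ^ 2 + y ^ 2) = ln y) as E1.
    { rewrite Rplus_comm, half_ln_sq, Rabs_pos_eq by lra. reflexivity. }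
    assert (0 <= / 2 * ln (2 ^ 2 + y ^ 2)) as E2.
    { assert (0 < ln (2 ^ 2 + y ^ 2)); [|lra]. rewrite <- ln_1. apply ln_increasing; nra. }
    unfold slog_re. destruct (Rcase_abs x) as [N|N]; unfold Rabs in Hx; destruct Rcase_abs in Hx; try lra.
    - right. replace ((x - 1) ^ 2) with (2 ^ 2) by (replace x with (-1) by lra; ring).
      replace ((x + 1) ^ 2) with (0 ^ 2) by (replace x with (-1) by lra; ring). lra.
    - left. replace ((x - 1) ^ 2) with (0 ^ 2) by (replace x with 1 by lra; ring).
      replace ((x + 1) ^ 2) with (2 ^ 2) by (replace x with 1 by lra; ring). lra. }
  apply Rle_trans with (exp (PI * PI) * (exp 1 * y)).
  - apply Rmult_le_compat_l; [left; apply exp_pos|auto].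
  - unfold K in Hk. lra.
Qed.

Lemma gfun_limit (x : R) (e : R) : 0 < e -> exists d, 0 < d /\
  forall y, 0 < y < d -> Cmod (gfun (x, y) - boundary_value x) <= e.
Proof.
  destruct (Req_dec (Rabs x) 1); [intros; apply gfun_limit_singular|intros; apply gfun_limit_regular]; auto.
Qed.

(* Boundary values on the real axis, then even reflection: not holomorphic
   below the axis, but still Lipschitz on the whole plane. *)
Definition gext (z : C) : C :=
  if Rlt_dec 0 (Rabs (Im z)) then gfun (Re z, Rabs (Im z)) else boundary_value (Re z).

Lemma gext_upper (z : C) : upper z -> gext z = gfun z.
Proof.
  unfold upper. intros H. unfold gext. rewrite (Rabs_pos_eq (Im z)) by lra.
  destruct Rlt_dec; [|lra]. destruct z; reflexivity.
Qed.

Lemma gext_real (t : R) : gext (t, 0) = boundary_value t.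
Proof. unfold gext. simpl. rewrite Rabs_R0. destruct Rlt_dec; [lra|reflexivity]. Qed.

Section WithK.
Variable K : R.
Hypothesis HK : 0 < K.
Hypothesis Lip : forall z w, upper z -> upper w -> Cmod (gfun w - gfun z) <= K * Cmod (w - z).

Lemma gext_approx (z : C) (e : R) : 0 < e -> exists d, 0 < d /\
  forall h, 0 < h < d -> Cmod (gfun (Re z, Rabs (Im z) + h) - gext z) <= e.
Proof.
  intros He. unfold gext. destruct Rlt_dec as [P|P].
  - exists (e / K). split; [apply Rdiv_lt_0_compat; lra|]. intros h Hh.
    eapply Rle_trans; [apply Lip; unfold upper; simpl; lra|].
    replace ((Re z, (Rabs (Im z) + h)%R) - (Re z, Rabs (Im z)))%C with ((0, h) : C)
      by (unfold Cminus, Cplus, Copp; simpl; f_equal; ring).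
    apply Rle_trans with (K * h).
    + apply Rmult_le_compat_l; [lra|]. eapply Rle_trans; [apply Cmod_le_sum|]. simpl.
      rewrite Rabs_R0, Rabs_pos_eq; lra.
    + apply Rmult_le_reg_r with (/ K); [apply Rinv_0_lt_compat; lra|].
      replace (K * h * / K) with h by (field; lra). unfold Rdiv in Hh. lra.
  - assert (Rabs (Im z) = 0) as E by (generalize (Rabs_pos (Im z)); lra). rewrite E.
    destruct (gfun_limit (Re z) e He) as [d [Hd H]]. exists d. split; [exact Hd|].
    intros h Hh. rewrite Rplus_0_l. auto.
Qed.

(** Both values are limits of [gfun] at points raised by the same [h] above the reflected ones, and
    the reflection does not increase distances. *)
Lemma gext_lipschitz (z w : C) : Cmod (gext w - gext z) <= K * Cmod (w - z).
Proof.
  apply Rle_plus_epsilon. intros e He.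
  destruct (gext_approx z (e / 2)) as [d1 [Hd1 H1]]; [lra|].
  destruct (gext_approx w (e / 2)) as [d2 [Hd2 H2]]; [lra|].
  set (h := Rmin d1 d2 / 2). assert (0 < Rmin d1 d2) by (apply Rmin_pos; auto).
  generalize (Rmin_l d1 d2) (Rmin_r d1 d2). intros.
  specialize (H1 h ltac:(unfold h; lra)). specialize (H2 h ltac:(unfold h; lra)).
  assert (Cmod (gfun (Re w, Rabs (Im w) + h) - gfun (Re z, Rabs (Im z) + h)) <= K * Cmod (w - z)) as HL.
  { eapply Rle_trans.
    - apply Lip; unfold upper; simpl.
      + generalize (Rabs_pos (Im z)). unfold h. lra.
      + generalize (Rabs_pos (Im w)). unfold h. lra.
    - apply Rmult_le_compat_l; [lra|]. destruct z as [x y], w as [u v]. simpl.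
      unfold Cmod. apply sqrt_le_1_alt. simpl.
      apply Rplus_le_compat_l. rewrite !Rmult_1_r.
      replace (Rabs v + h + - (Rabs y + h)) with (Rabs v - Rabs y) by ring.
      apply Rsqr_le_abs_1. apply Rabs_triang_inv2. }
  replace (gext w - gext z)%C with
    ((gfun (Re w, (Rabs (Im w) + h)%R) - gfun (Re z, (Rabs (Im z) + h)%R))
     - (gfun (Re w, (Rabs (Im w) + h)%R) - gext w) + (gfun (Re z, (Rabs (Im z) + h)%R) - gext z))%C by ring.
  eapply Rle_trans; [apply Cmod_triangle|].
  eapply Rle_trans; [apply Rplus_le_compat_r, Cmod_sub_le|]. lra.
Qed.
End WithK.

Lemma gext_bounded : exists B, 0 < B /\ forall z, Cmod (gext z) <= B.
Proof.
  destruct gfun_bounded as [B HB]. destruct gfun_lipschitz_upper as [K [HK Lip]].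
  assert (0 <= B) as PB.
  { eapply Rle_trans; [apply Cmod_ge_0|apply (HB (0, 1))]. unfold upper; simpl; lra. }
  exists (B + 1). split; [lra|]. intros z.
  destruct (gext_approx K HK Lip z 1 Rlt_0_1) as [d [Hd H]]. specialize (H (d / 2) ltac:(lra)).
  assert (Cmod (gfun (Re z, Rabs (Im z) + d / 2)) <= B) as H1.
  { apply HB. unfold upper; simpl. generalize (Rabs_pos (Im z)); lra. }
  generalize (Cmod_sub_ge (gext z) (gfun (Re z, Rabs (Im z) + d / 2))). rewrite Cmod_sub_sym. lra.
Qed.

(** On the imaginary axis |Z - 1| = |Z + 1|, so s = i theta and g = exp(theta^2), with theta
    positive and strictly decreasing in y > 1. *)
Lemma gext_imaginary_axis (y y' : R) : 1 < y < y' -> gext (0, y) <> gext (0, y').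
Proof.
  intros H. assert (forall t, 1 < t -> gext (0, t) = RtoC (exp (atan (2 * t / (t ^ 2 - 1)) * atan (2 * t / (t ^ 2 - 1))))) as F.
  { intros t Ht. rewrite gext_upper by (unfold upper; simpl; lra). rewrite gfun_formula by (try lra; nra).
    destruct Rlt_dec as [Q|_]; [nra|].
    assert (slog_re 0 t = 0) as E.
    { unfold slog_re. replace ((0 - 1) ^ 2) with 1 by ring. replace ((0 + 1) ^ 2) with 1 by ring. ring. }
    rewrite E. replace (0 ^ 2 + t ^ 2 - 1) with (t ^ 2 - 1) by ring. rewrite Rplus_0_l.
    set (a := atan (2 * t / (t ^ 2 - 1))).
    unfold cexp, RtoC; simpl. replace (- (0 * a + a * 0)) with 0 by ring. rewrite cos_0, sin_0.
    replace (- (0 * 0 - a * a)) with (a * a) by ring. f_equal; ring. }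
  rewrite !F by lra. intro E. apply RtoC_inj in E.
  apply exp_inv in E.
  assert (forall t, 1 < t -> 0 < 2 * t / (t ^ 2 - 1)) as P by (intros; apply Rdiv_lt_0_compat; nra).
  assert (2 * y' / (y' ^ 2 - 1) < 2 * y / (y ^ 2 - 1)) as L.
  { apply Rmult_lt_reg_r with ((y ^ 2 - 1) * (y' ^ 2 - 1)); [apply Rmult_lt_0_compat; nra|].
    replace (2 * y' / (y' ^ 2 - 1) * ((y ^ 2 - 1) * (y' ^ 2 - 1))) with (2 * y' * (y ^ 2 - 1)) by (field; nra).
    replace (2 * y / (y ^ 2 - 1) * ((y ^ 2 - 1) * (y' ^ 2 - 1))) with (2 * y * (y' ^ 2 - 1)) by (field; nra).
    assert (0 < (y' - y) * (y * y' + 1)) by (apply Rmult_lt_0_compat; nra). nra. }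
  apply atan_increasing in L.
  assert (0 < atan (2 * y' / (y' ^ 2 - 1))) by (rewrite <- atan_0; apply atan_increasing, P; lra).
  nra.
Qed.

(** * The normalized perturbations *)

Definition bump (k1 k2 eta : R -> R) (z : C) : C := (k1 (Re z) * eta (Im z), k2 (Re z) * eta (Im z)).

(* [G] moves the half-plane holomorphically, [bump] by a compactly supported
   smooth field; both have the boundary values [(k1, k2)] on [-1, 1]. *)
Record profile (k1 k2 eta : R -> R) (G : C -> C) : Prop := {
  pr_smooth1 : forall k, Cn (V := R_NormedModule) k (fun _ => True) k1;
  pr_smooth2 : forall k, Cn (V := R_NormedModule) k (fun _ => True) k2;
  pr_smooth_eta : forall k, Cn (V := R_NormedModule) k (fun _ => True) eta;
  pr_k1_out : forall t, 1 <= Rabs t -> k1 t = 0;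
  pr_k2_out : forall t, 1 <= Rabs t -> k2 t = 0;
  pr_eta_0 : eta 0 = 1;
  pr_eta_out : forall t, 1 <= Rabs t -> eta t = 0;
  pr_bump_lip : forall z w, Cmod (bump k1 k2 eta w - bump k1 k2 eta z) <= / 4 * Cmod (w - z);
  pr_bump_bd : forall z, Cmod (bump k1 k2 eta z) <= / 4;
  pr_G_lip : forall z w, Cmod (G w - G z) <= / 4 * Cmod (w - z);
  pr_G_bd : forall z, Cmod (G z) <= / 4;
  pr_G_holo : forall z, upper z -> exists d, cderiv G z d;
  pr_G_in : forall t, Rabs t <= 1 -> G (t, 0) = (k1 t, k2 t);
  pr_G_out : forall t, 1 <= Rabs t -> Im (G (t, 0)) = 0;
  pr_G_axis : forall y y', 1 < y < y' -> G (0, y) <> G (0, y')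
}.

Arguments pr_smooth1 {k1 k2 eta G}.
Arguments pr_smooth2 {k1 k2 eta G}.
Arguments pr_smooth_eta {k1 k2 eta G}.
Arguments pr_k1_out {k1 k2 eta G}.
Arguments pr_k2_out {k1 k2 eta G}.
Arguments pr_eta_0 {k1 k2 eta G}.
Arguments pr_eta_out {k1 k2 eta G}.
Arguments pr_bump_lip {k1 k2 eta G}.
Arguments pr_bump_bd {k1 k2 eta G}.
Arguments pr_G_lip {k1 k2 eta G}.
Arguments pr_G_bd {k1 k2 eta G}.
Arguments pr_G_holo {k1 k2 eta G}.
Arguments pr_G_in {k1 k2 eta G}.
Arguments pr_G_out {k1 k2 eta G}.
Arguments pr_G_axis {k1 k2 eta G}.

(** An outside point may be replaced by the endpoint of [-1,1] on its side, which is closer to the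
    other point and where [f] vanishes too. *)
Lemma lipschitz_compact_support (f : R -> C) (K : R) : 0 <= K ->
  (forall t, 1 <= Rabs t -> f t = 0) ->
  (forall s t, Rabs s <= 1 -> Rabs t <= 1 -> Cmod (f s - f t) <= K * Rabs (s - t)) ->
  forall s t, Cmod (f s - f t) <= K * Rabs (s - t).
Proof.
  intros HK H0 HL.
  assert (forall s t, Rabs s <= 1 -> 1 <= Rabs t -> Cmod (f s - f t) <= K * Rabs (s - t)) as A.
  { intros s t Hs Ht. rewrite (H0 t Ht).
    assert (forall c, Rabs c = 1 -> Rabs (s - c) <= Rabs (s - t) -> Cmod (f s - 0) <= K * Rabs (s - t)) as B.
    { intros c Hc Hc'. rewrite <- (H0 c) by lra. eapply Rle_trans; [apply HL; lra|].
      apply Rmult_le_compat_l; auto. }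
    apply Rabs_le_between in Hs. destruct (Rle_dec 0 t) as [P|P].
    - rewrite Rabs_pos_eq in Ht by lra. apply (B 1); [apply Rabs_R1|]. rewrite !Rabs_left1; lra.
    - rewrite Rabs_left in Ht by lra. apply (B (- (1))); [rewrite Rabs_Ropp; apply Rabs_R1|].
      rewrite !Rabs_pos_eq; lra. }
  intros s t. destruct (Rle_dec (Rabs s) 1) as [P|P], (Rle_dec (Rabs t) 1) as [Q|Q].
  - auto.
  - apply A; lra.
  - rewrite Cmod_sub_sym, Rabs_minus_sym. apply A; lra.
  - rewrite (H0 s), (H0 t) by lra. replace (0 - 0)%C with (RtoC 0) by ring. rewrite Cmod_0.
    apply Rmult_le_pos; [auto|apply Rabs_pos].
Qed.

Definition plateau (y : R) : R := / flat_exp 1 * flat_exp (1 - y * y).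

Lemma plateau_out (y : R) : 1 <= Rabs y -> plateau y = 0.
Proof.
  intros H. unfold plateau. rewrite (flat_exp_neg (1 - y * y)); [ring|].
  assert (y * y = Rabs y * Rabs y) as -> by (rewrite <- Rabs_mult, Rabs_pos_eq; nra). nra.
Qed.

Lemma plateau_lipschitz : exists K, 0 < K /\ forall s t, Rabs (plateau s - plateau t) <= K * Rabs (s - t).
Proof.
  destruct flat_exp_derive_bound as [K [HK H]].
  assert (0 < / flat_exp 1) as Hi by (apply Rinv_0_lt_compat, flat_exp_pos; lra).
  exists (/ flat_exp 1 * (K * 2)). split; [apply Rmult_lt_0_compat; lra|]. intros s t.
  generalize (lipschitz_compact_support (fun t => RtoC (plateau t)) (/ flat_exp 1 * (K * 2))).
  intro L. rewrite <- Cmod_R, RtoC_minus. apply L.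
  - left; apply Rmult_lt_0_compat; lra.
  - intros u Hu. rewrite plateau_out by exact Hu. reflexivity.
  - clear s t. intros s t Hs Ht. rewrite <- RtoC_minus, Cmod_R. unfold plateau.
    rewrite <- Rmult_minus_distr_l, Rabs_mult, Rabs_pos_eq by lra.
    rewrite Rmult_assoc. apply Rmult_le_compat_l; [lra|].
    eapply Rle_trans; [apply H|]. rewrite Rmult_assoc. apply Rmult_le_compat_l; [lra|].
    replace (1 - s * s - (1 - t * t)) with (- ((s + t) * (s - t))) by ring.
    rewrite Rabs_Ropp, Rabs_mult. apply Rmult_le_compat_r; [apply Rabs_pos|].
    eapply Rle_trans; [apply Rabs_triang|]. lra.
Qed.

Lemma plateau_bounded (y : R) : Rabs (plateau y) <= / flat_exp 1.
Proof.
  unfold plateau. assert (0 < / flat_exp 1) as Hi by (apply Rinv_0_lt_compat, flat_exp_pos; lra).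
  generalize (flat_exp_range (1 - y * y)). intro. rewrite Rabs_mult, !Rabs_pos_eq by lra. nra.
Qed.

Lemma kappa_lipschitz (K : R) : 0 < K -> (forall z w, Cmod (gext w - gext z) <= K * Cmod (w - z)) ->
  forall s t, Cmod (kappa s - kappa t) <= K * Rabs (s - t).
Proof.
  intros HK L. apply lipschitz_compact_support; [lra|apply kappa_out|].
  intros s t Hs Ht. rewrite <- !boundary_value_in, <- !gext_real by auto.
  eapply Rle_trans; [apply L|]. apply Rmult_le_compat_l; [lra|]. apply hline_dist.
Qed.

Lemma bump_scal (c e : R) (k : C) : ((c * Re k) * e, (c * Im k) * e) = (c * (e * k))%C.
Proof. destruct k. unfold Cmult, RtoC; simpl. f_equal; ring. Qed.

Lemma profile_exists : exists k1 k2 eta G, profile k1 k2 eta G.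
Proof.
  destruct gfun_lipschitz_upper as [K [HK L0]].
  generalize (gext_lipschitz K HK L0). intro L. clear L0.
  destruct gext_bounded as [B [HB Bd]].
  destruct plateau_lipschitz as [K' [HK' L']].
  set (M := / flat_exp 1). assert (0 < M) as HM by (apply Rinv_0_lt_compat, flat_exp_pos; lra).
  (* [S] dominates every Lipschitz constant and every bound required by [profile], so the single
     factor [c] brings them all down to 1/4. *)
  set (S := K * M + B * K' + B * M + K + B).
  assert (0 < K * M) by nra. assert (0 < B * K') by nra. assert (0 < B * M) by nra.
  assert (0 < S) as HS by (unfold S; lra).
  set (c := / (4 * S)). assert (0 < c) as Hc by (apply Rinv_0_lt_compat; lra).
  assert (c * S = / 4) as Ec by (unfold c; field; lra).
  assert (forall t, Cmod (kappa t) <= B) as Bk.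
  { intros t. destruct (Rle_dec (Rabs t) 1) as [P|P].
    - rewrite <- boundary_value_in, <- gext_real by exact P. apply Bd.
    - rewrite kappa_out, Cmod_0; lra. }
  assert (forall a b u, a <= S -> 0 <= b -> u <= c * (a * b) -> u <= / 4 * b) as Use.
  { intros a b u Ha Hb Hu. rewrite <- Ec. eapply Rle_trans; [exact Hu|].
    rewrite Rmult_assoc. apply Rmult_le_compat_l; [lra|]. apply Rmult_le_compat_r; lra. }
  exists (fun t => c * Re (kappa t)), (fun t => c * Im (kappa t)), plateau, (fun z => c * gext z)%C.
  constructor.
  - intros k. apply Cn_scal. simpl. apply Cn_scal. apply Cn_gauss_slog.
  - intros k. apply Cn_scal. simpl. apply Cn_scal. apply Cn_gauss_slog.
  - intros k. unfold plateau. apply Cn_scal. apply (Cn_comp k (fun _ => True)); auto; [apply Cn_flat_exp|].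
    apply (Cn_ext k _ (fun y => 1 + -1 * (y * y))).
    + apply open_true.
    + intros; ring.
    + apply Cn_plus; [apply Cn_const|]. apply Cn_scal, Cn_mult; apply Cn_id.
  - intros t Ht. rewrite kappa_out by exact Ht. simpl. ring.
  - intros t Ht. rewrite kappa_out by exact Ht. simpl. ring.
  - unfold plateau. rewrite Rmult_0_r, Rminus_0_r. apply Rinv_l. apply Rgt_not_eq, flat_exp_pos. lra.
  - apply plateau_out.
  - intros z w. unfold bump. rewrite !bump_scal.
    apply (Use (K * M + B * K')); [unfold S; lra|apply Cmod_ge_0|].
    replace (c * (plateau (Im w) * kappa (Re w)) - c * (plateau (Im z) * kappa (Re z)))%C with
      (c * (plateau (Im w) * (kappa (Re w) - kappa (Re z)) + (plateau (Im w) - plateau (Im z))%R * kappa (Re z)))%C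
      by (rewrite RtoC_minus; ring).
    rewrite Cmod_mult, Cmod_R, (Rabs_pos_eq c) by lra. apply Rmult_le_compat_l; [lra|].
    eapply Rle_trans; [apply Cmod_triangle|]. rewrite !Cmod_mult, !Cmod_R.
    rewrite Rmult_plus_distr_r. apply Rplus_le_compat.
    + rewrite (Rmult_comm K M), Rmult_assoc. apply Rmult_le_compat; [apply Rabs_pos|apply Cmod_ge_0|apply plateau_bounded|].
      eapply Rle_trans; [apply (kappa_lipschitz K HK L)|]. apply Rmult_le_compat_l; [lra|].
      apply Re_dist.
    + rewrite (Rmult_comm B K'), (Rmult_comm (K' * B)), <- Rmult_assoc.
      apply Rmult_le_compat; [apply Rabs_pos|apply Cmod_ge_0| |apply Bk].
      rewrite Rmult_comm. eapply Rle_trans; [apply L'|]. apply Rmult_le_compat_l; [lra|]. apply Im_dist.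
  - intros z. unfold bump. rewrite bump_scal.
    rewrite <- (Rmult_1_r (/ 4)). apply (Use (B * M)); [unfold S; lra|lra|].
    rewrite !Cmod_mult, !Cmod_R, (Rabs_pos_eq c) by lra. apply Rmult_le_compat_l; [lra|].
    rewrite Rmult_1_r, Rmult_comm. apply Rmult_le_compat; [apply Cmod_ge_0|apply Rabs_pos|apply Bk|apply plateau_bounded].
  - intros z w. apply (Use K); [unfold S; lra|apply Cmod_ge_0|].
    replace (c * gext w - c * gext z)%C with (c * (gext w - gext z))%C by ring.
    rewrite Cmod_mult, Cmod_R, Rabs_pos_eq by lra. apply Rmult_le_compat_l; [lra|apply L].
  - intros z. rewrite <- (Rmult_1_r (/ 4)). apply (Use B); [unfold S; lra|lra|].
    rewrite Cmod_mult, Cmod_R, Rabs_pos_eq, Rmult_1_r by lra. apply Rmult_le_compat_l; [lra|apply Bd].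
  - intros z Hz. eexists. apply cderiv_scal. apply (cderiv_ext_loc gfun) with (r := Im z); [exact Hz| |apply cderiv_gfun, Hz].
    intros w Hw. symmetry. apply gext_upper. unfold upper.
    generalize (Im_dist w z). intro Q. apply Rle_lt_trans with (2 := Hw) in Q. apply Rabs_lt_between in Q. lra.
  - intros t Ht. rewrite gext_real, boundary_value_in by exact Ht. unfold Cmult, RtoC; simpl. f_equal; ring.
  - intros t Ht. rewrite gext_real. generalize (boundary_value_out t Ht). destruct (boundary_value t); simpl. intros ->. ring.
  - intros y y' Hy E. apply (gext_imaginary_axis y y' Hy).
    assert (RtoC c <> 0) as N by (intro Q; apply RtoC_inj in Q; lra).
    replace (gext (0, y)) with (/ c * (c * gext (0, y)))%C by (field; exact N).
    rewrite E. field. exact N.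
Qed.

(** * Lipschitz perturbations of the identity *)

(** Banach's iteration of [v -> W - Q v], started at 0. *)
Lemma contraction_surjective (Q : C -> C) :
  (forall z w, Cmod (Q w - Q z) <= / 2 * Cmod (w - z)) -> forall W, exists Z, (Z + Q Z)%C = W.
Proof.
  intros L W. set (z := fun n => Nat.iter n (fun v => (W - Q v)%C) 0%C).
  assert (forall n, z (S n) = W - Q (z n))%C as Hz by reflexivity.
  set (D := Cmod (z 1%nat - z O)).
  assert (0 <= D) as HD by apply Cmod_ge_0.
  assert (forall n, 0 < (/ 2) ^ n) as Hp by (intro n; apply pow_lt; lra).
  assert (forall n, Cmod (z (S n) - z n) <= D * (/ 2) ^ n) as H1.
  { induction n; [simpl; unfold D; simpl; lra|].
    replace (z (S (S n)) - z (S n))%C with (- (Q (z (S n)) - Q (z n)))%C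
      by (rewrite (Hz (S n)), (Hz n) at 1; rewrite (Hz n); ring).
    rewrite Cmod_opp. eapply Rle_trans; [apply L|]. simpl pow. lra. }
  (* The subtracted term makes the geometric bound reproduce itself exactly in the induction on
     [k]. *)
  assert (forall n k, Cmod (z (n + k)%nat - z n) <= 2 * D * (/ 2) ^ n - 2 * D * (/ 2) ^ (n + k)) as H2.
  { intros n k. induction k.
    - rewrite Nat.add_0_r. replace (z n - z n)%C with (RtoC 0) by ring. rewrite Cmod_0. lra.
    - rewrite Nat.add_succ_r. replace (z (S (n + k)) - z n)%C with
        ((z (S (n + k)) - z (n + k)%nat) + (z (n + k)%nat - z n))%C by ring.
      eapply Rle_trans; [apply Cmod_triangle|]. specialize (H1 (n + k)%nat). simpl pow. lra. }
  assert (forall e, 0 < e -> exists N, forall n, (N <= n)%nat -> 2 * D * (/ 2) ^ n < e) as Small.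
  { intros e He. assert (is_lim_seq (fun n => (/ 2) ^ n) 0) as G by (apply is_lim_seq_geom; rewrite Rabs_pos_eq; lra).
    apply is_lim_seq_spec in G.
    assert (0 < e / (2 * D + 1)) as He' by (apply Rdiv_lt_0_compat; lra).
    destruct (G (mkposreal _ He')) as [N HN]. exists N. intros n Hn. specialize (HN n Hn). simpl in HN.
    rewrite Rminus_0_r, Rabs_pos_eq in HN by (left; auto).
    apply (Rmult_lt_compat_l (2 * D + 1)) in HN; [|lra].
    replace ((2 * D + 1) * (e / (2 * D + 1))) with e in HN by (field; lra). specialize (Hp n). nra. }
  assert (forall e, 0 < e -> exists N, forall n m, (N <= n)%nat -> (N <= m)%nat -> Cmod (z n - z m) < e) as Cauchy.
  { intros e He. destruct (Small e He) as [N HN]. exists N.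
    assert (forall n m, (N <= n)%nat -> (n <= m)%nat -> Cmod (z m - z n) < e) as A.
    { intros n m Hn Hm. specialize (H2 n (m - n)%nat). replace (n + (m - n))%nat with m in H2 by lia.
      specialize (HN n Hn). specialize (Hp m). nra. }
    intros n m Hn Hm. destruct (Nat.le_ge_cases n m); [rewrite Cmod_sub_sym|]; auto. }
  assert (ex_finite_lim_seq (fun n => Re (z n))) as [x Hx].
  { apply ex_lim_seq_cauchy_corr. intros e. destruct (Cauchy e (cond_pos e)) as [N HN]. exists N.
    intros n m Hn Hm. eapply Rle_lt_trans; [apply Re_dist|auto]. }
  assert (ex_finite_lim_seq (fun n => Im (z n))) as [y Hy].
  { apply ex_lim_seq_cauchy_corr. intros e. destruct (Cauchy e (cond_pos e)) as [N HN]. exists N.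
    intros n m Hn Hm. eapply Rle_lt_trans; [apply Im_dist|auto]. }
  apply is_lim_seq_spec in Hx. apply is_lim_seq_spec in Hy.
  exists (x, y). apply NNPP. intro N.
  set (e := Cmod ((x, y) + Q (x, y) - W)%C).
  assert (0 < e) as He.
  { apply Cmod_gt_0. intro E. apply N. replace ((x, y) + Q (x, y))%C with ((x, y) + Q (x, y) - W + W)%C by ring.
    rewrite E. ring. }
  destruct (Hx (mkposreal (e / 4) ltac:(lra))) as [N1 HN1].
  destruct (Hy (mkposreal (e / 4) ltac:(lra))) as [N2 HN2]. simpl in HN1, HN2.
  assert (forall n, (N1 <= n)%nat -> (N2 <= n)%nat -> Cmod ((x, y) - z n) < e / 2) as B.
  { intros n A1 A2. rewrite Cmod_sub_sym. eapply Rle_lt_trans; [apply Cmod_le_sum|].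
    specialize (HN1 n A1). specialize (HN2 n A2). destruct (z n). simpl in *. unfold Rminus in *. lra. }
  set (n := (N1 + N2)%nat).
  generalize (B n ltac:(unfold n; lia) ltac:(unfold n; lia)) (B (S n) ltac:(unfold n; lia) ltac:(unfold n; lia)).
  rewrite Hz. intros B1 B2.
  assert (e <= Cmod ((x, y) - (W - Q (z n))) + Cmod (Q (x, y) - Q (z n))).
  { unfold e. replace ((x, y) + Q (x, y) - W)%C with (((x, y) - (W - Q (z n))) + (Q (x, y) - Q (z n)))%C by ring.
    apply Cmod_triangle. }
  generalize (L (z n) (x, y)). lra.
Qed.

Lemma perturbed_id_expansive (Q : C -> C) :
  (forall z w, Cmod (Q w - Q z) <= / 2 * Cmod (w - z)) ->
  forall z w, / 2 * Cmod (w - z) <= Cmod ((w + Q w) - (z + Q z)).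
Proof.
  intros L z w. generalize (Cmod_sub_ge (w - z) (- (Q w - Q z))). rewrite Cmod_opp.
  replace (w - z - - (Q w - Q z))%C with ((w + Q w) - (z + Q z))%C by ring. generalize (L z w). lra.
Qed.

Lemma perturbed_id_inj (Q : C -> C) :
  (forall z w, Cmod (Q w - Q z) <= / 2 * Cmod (w - z)) ->
  forall z w, (z + Q z)%C = (w + Q w)%C -> z = w.
Proof.
  intros L z w E. generalize (perturbed_id_expansive Q L z w). rewrite E.
  replace (w + Q w - (w + Q w))%C with (RtoC 0) by ring. rewrite Cmod_0. intro H.
  assert (Cmod (w - z) = 0) as H0 by (generalize (Cmod_ge_0 (w - z)); lra).
  apply Cmod_eq_0 in H0. replace w with (w - z + z)%C by ring. rewrite H0. ring.
Qed.

Section Sides.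
Variables (P : C -> C) (b : R -> R).
Hypothesis LP : forall z w, Cmod (P w - P z) <= / 2 * Cmod (w - z).
Hypothesis BP : forall z, Cmod (P z) <= / 2.
Hypothesis Cb : forall x, continuous b x.
Hypothesis Bb : forall x, Rabs (b x) <= / 2.
Hypothesis graph : forall t, Im (P (t, 0)) = b (t + Re (P (t, 0))).

(** The one-dimensional statement is the planar one for a real-valued map that depends only on
    [Re z]. *)
Lemma graph_surjective (X : R) : exists t, t + Re (P (t, 0)) = X.
Proof.
  destruct (contraction_surjective (fun z => RtoC (Re (P (Re z, 0))))) with (W := RtoC X) as [Z HZ].
  - intros z w. rewrite <- RtoC_minus, Cmod_R. eapply Rle_trans; [apply Re_dist|].
    eapply Rle_trans; [apply LP|]. apply Rmult_le_compat_l; [lra|].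
    eapply Rle_trans; [apply hline_dist|]. apply Re_dist.
  - exists (Re Z). apply (f_equal Re) in HZ. destruct Z; exact HZ.
Qed.

(** Follow the vertical ray from [Z] away from the axis. If the image began on the wrong side, it
    would meet the graph by the intermediate value theorem. But the graph is already the image of
    the real axis, and the map is injective. The sign [s] covers both half-planes. *)
Lemma side_sign (s : R) (Z : C) : (s = 1 \/ s = -1) -> 0 < s * Im Z ->
  0 < s * (Im (Z + P Z)%C - b (Re (Z + P Z)%C)).
Proof.
  intros Hs HZ. apply Rnot_le_lt. intro HN.
  set (W := fun t : R => ((Z + (0, (s * t)%R)) + P (Z + (0, (s * t)%R)))%C).
  set (D := fun t => s * (Im (W t) - b (Re (W t)))).
  assert (Rabs s = 1) as As by (destruct Hs as [-> | ->]; [apply Rabs_R1|rewrite Rabs_left; lra]).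
  assert (forall t t', Cmod (W t - W t') <= 2 * Rabs (t - t')) as LW.
  { intros t t'. unfold W.
    set (u := (Z + (0, (s * t)%R))%C). set (u' := (Z + (0, (s * t')%R))%C).
    assert (Cmod (u - u') <= Rabs (t - t')) as A.
    { unfold u, u'. replace (Z + (0, (s * t)%R) - (Z + (0, (s * t')%R)))%C with
        (((0, (s * t)%R) : C) - (0, (s * t')%R))%C by ring.
      eapply Rle_trans; [apply vline_dist|]. rewrite <- Rmult_minus_distr_l, Rabs_mult, As. lra. }
    replace (u + P u - (u' + P u'))%C with ((u - u') + (P u - P u'))%C by ring.
    eapply Rle_trans; [apply Cmod_triangle|]. generalize (LP u' u). generalize (Rabs_pos (t - t')). lra. }
  assert (forall F : C -> R, (forall z w, Rabs (F z - F w) <= Cmod (z - w)) -> forall t, continuous (fun t => F (W t)) t) as CW.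
  { intros F HF t. apply continuity_pt_filterlim. intros e He. exists (e / 2). split; [lra|].
    intros t' [_ Ht']. simpl in *. unfold R_dist in *.
    eapply Rle_lt_trans; [apply HF|]. eapply Rle_lt_trans; [apply LW|]. lra. }
  assert (continuity D) as CD.
  { intro t. apply continuity_pt_filterlim. unfold D.
    apply (continuous_scal_r (K := R_AbsRing) (V := R_NormedModule) s (fun t => Im (W t) - b (Re (W t)))).
    apply (continuous_minus (V := R_NormedModule) (fun t => Im (W t)) (fun t => b (Re (W t)))).
    - apply CW, Im_dist.
    - apply (continuous_comp (fun t => Re (W t)) b); [apply CW, Re_dist|apply Cb]. }
  assert (D 0 <= 0) as D0.
  { unfold D, W. replace (Z + (0, (s * 0)%R))%C with Z; [exact HN|]. destruct Z; unfold Cplus; simpl. f_equal; ring. }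
  (* At height more than 2 the bounds 1/2 on [P] and on [b] decide the side. *)
  assert (0 <= D 2) as D2.
  { unfold D. generalize (Bb (Re (W 2))). generalize (b (Re (W 2))). intros bb Hb. unfold W.
    set (p := P (Z + (0, (s * 2)%R))%C). generalize (im_le_Cmod p) (BP (Z + (0, (s * 2)%R))%C). fold p. intros A1 A2.
    assert (Rabs (Im p) <= / 2) as A3 by lra. apply Rabs_le_between in A3. apply Rabs_le_between in Hb.
    destruct Z as [x y]. clearbody p. destruct p as [p1 p2]. simpl in *.
    destruct Hs as [-> | ->]; lra. }
  destruct (IVT_gen D 0 2 0 CD) as [t [Ht E]].
  { split; [eapply Rle_trans; [apply Rmin_l|exact D0]|eapply Rle_trans; [exact D2|apply Rmax_r]]. }
  rewrite Rmin_left, Rmax_right in Ht by lra.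
  assert (Im (W t) = b (Re (W t))) as EG.
  { unfold D in E. destruct Hs as [-> | ->]; lra. }
  destruct (graph_surjective (Re (W t))) as [x Hx].
  assert ((Z + (0, (s * t)%R))%C = ((x, 0) : C)) as EZ.
  { apply (perturbed_id_inj P LP). fold (W t). rewrite (surjective_pairing (W t)).
    change (fst (W t)) with (Re (W t)). change (snd (W t)) with (Im (W t)). rewrite EG, <- Hx, <- graph.
    destruct (P (x, 0)). unfold Cplus; simpl. f_equal; ring. }
  apply (f_equal Im) in EZ. destruct Z as [z1 z2]. simpl in *. destruct Hs as [-> | ->]; lra.
Qed.

Lemma side_zero (Z : C) : Im Z = 0 -> Im (Z + P Z)%C = b (Re (Z + P Z)%C).
Proof.
  destruct Z as [x y]. intros H. simpl in H. subst y. generalize (graph x).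
  destruct (P (x, 0)). simpl. intros <-. ring.
Qed.

Lemma side_pos_iff (Z : C) : 0 < Im Z <-> b (Re (Z + P Z)%C) < Im (Z + P Z)%C.
Proof.
  split.
  - intros H. generalize (side_sign 1 Z). lra.
  - intros H. apply Rnot_le_lt. intros [N|N].
    + generalize (side_sign (-1) Z). lra.
    + generalize (side_zero Z N). lra.
Qed.

Lemma side_nonneg_iff (Z : C) : 0 <= Im Z <-> b (Re (Z + P Z)%C) <= Im (Z + P Z)%C.
Proof.
  split.
  - intros [H|H]; [left; apply side_pos_iff, H|right; symmetry; apply side_zero; auto].
  - intros H. apply Rnot_lt_le. intro N. generalize (side_sign (-1) Z). lra.
Qed.
End Sides.

(** * The boundary curve as a smooth graph *)

Lemma is_derive_inverse (f g : R -> R) (x d : R) : (forall y, f (g y) = y) ->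
  (forall y y', Rabs (g y - g y') <= 2 * Rabs (y - y')) -> d <> 0 ->
  is_derive f (g x) d -> is_derive g x (/ d).
Proof.
  intros E L Hd D. apply is_derive_Reals. intros e He.
  assert (0 < Rabs d) as Pd by (apply Rabs_pos_lt; exact Hd).
  destruct (is_derive_small f (g x) d (e * Rabs d / 4) D) as [dl [Hdl H]].
  { apply Rdiv_lt_0_compat; nra. }
  assert (0 < dl / 2) as Hdl' by lra. exists (mkposreal _ Hdl'). intros h Hh0 Hh. simpl in Hh.
  assert (0 < Rabs h) by (apply Rabs_pos_lt; exact Hh0).
  generalize (L (x + h) x). replace (x + h - x) with h by ring. intro Lh.
  set (k := g (x + h) - g x) in *. specialize (H k ltac:(lra)).
  replace (g x + k) with (g (x + h)) in H by (unfold k; ring). rewrite !E in H.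
  replace (k / h - / d) with (- (/ (h * d) * (x + h - x - d * k))) by (field; auto).
  rewrite Rabs_Ropp, Rabs_mult, Rabs_inv, Rabs_mult.
  apply Rmult_lt_reg_l with (Rabs h * Rabs d); [apply Rmult_lt_0_compat; auto|].
  rewrite <- Rmult_assoc, Rinv_r, Rmult_1_l by nra.
  eapply Rle_lt_trans; [exact H|].
  apply Rle_lt_trans with (e * Rabs d / 4 * (2 * Rabs h)); [apply Rmult_le_compat_l; [apply Rlt_le, Rdiv_lt_0_compat; nra|exact Lh]|].
  assert (0 < e * (Rabs d * Rabs h)) by (apply Rmult_lt_0_compat; [|apply Rmult_lt_0_compat]; auto). lra.
Qed.

Section Graph.
Context {k1 k2 eta : R -> R} {G : C -> C} (pr : profile k1 k2 eta G).
Variable e : R.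
Hypothesis He : 0 <= e <= 1.

Definition push (P : C -> C) (z : C) : C := (e * P z)%C.

Lemma push_lip (P : C -> C) : (forall z w, Cmod (P w - P z) <= / 4 * Cmod (w - z)) ->
  forall z w, Cmod (push P w - push P z) <= / 2 * Cmod (w - z).
Proof.
  intros L z w. unfold push. replace (e * P w - e * P z)%C with (e * (P w - P z))%C by ring.
  rewrite Cmod_mult, Cmod_R, Rabs_pos_eq by lra.
  generalize (L z w) (Cmod_ge_0 (P w - P z)) (Cmod_ge_0 (w - z)). nra.
Qed.

Lemma push_bd (P : C -> C) : (forall z, Cmod (P z) <= / 4) -> forall z, Cmod (push P z) <= / 2.
Proof.
  intros L z. unfold push. rewrite Cmod_mult, Cmod_R, Rabs_pos_eq by lra.
  generalize (L z) (Cmod_ge_0 (P z)). nra.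
Qed.

Lemma bump_real (t : R) : bump k1 k2 eta (t, 0) = (k1 t, k2 t).
Proof. unfold bump; simpl. rewrite (pr_eta_0 pr). f_equal; ring. Qed.

Definition psi (X : R) : R := epsilon (inhabits 0) (fun t => t + e * k1 t = X).

Lemma psi_spec (X : R) : psi X + e * k1 (psi X) = X.
Proof.
  unfold psi. apply (epsilon_spec (inhabits 0) (fun t => t + e * k1 t = X)).
  destruct (graph_surjective (push (bump k1 k2 eta)) (push_lip _ (pr_bump_lip pr)) X) as [t Ht].
  exists t. rewrite <- Ht. unfold push. rewrite bump_real. simpl. ring.
Qed.

Lemma k1_lip (s t : R) : Rabs (k1 s - k1 t) <= / 4 * Rabs (s - t).
Proof.
  generalize (pr_bump_lip pr (t, 0) (s, 0)). rewrite !bump_real. intro H.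
  eapply Rle_trans; [exact (Re_dist (k1 s, k2 s) (k1 t, k2 t))|]. eapply Rle_trans; [exact H|].
  apply Rmult_le_compat_l; [lra|]. apply hline_dist.
Qed.

Lemma k_bd (t : R) : Rabs (k1 t) <= / 4 /\ Rabs (k2 t) <= / 4.
Proof.
  generalize (pr_bump_bd pr (t, 0)). rewrite bump_real. intro H.
  split; (eapply Rle_trans; [|exact H]); [exact (re_le_Cmod (k1 t, k2 t))|exact (im_le_Cmod (k1 t, k2 t))].
Qed.

Lemma shift_expansive (s t : R) : / 2 * Rabs (s - t) <= Rabs ((s + e * k1 s) - (t + e * k1 t)).
Proof.
  replace ((s + e * k1 s) - (t + e * k1 t)) with ((s - t) - (- (e * (k1 s - k1 t)))) by ring.
  eapply Rle_trans; [|apply Rabs_triang_inv]. rewrite Rabs_Ropp, Rabs_mult, (Rabs_pos_eq e) by lra.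
  generalize (k1_lip s t) (Rabs_pos (k1 s - k1 t)) (Rabs_pos (s - t)). nra.
Qed.

Lemma psi_unique (t : R) : psi (t + e * k1 t) = t.
Proof.
  generalize (shift_expansive (psi (t + e * k1 t)) t). rewrite psi_spec, Rminus_diag, Rabs_R0. intro H.
  apply Rminus_diag_uniq, Rabs_eq_0. generalize (Rabs_pos (psi (t + e * k1 t) - t)). lra.
Qed.

Lemma psi_lip (X Y : R) : Rabs (psi X - psi Y) <= 2 * Rabs (X - Y).
Proof. generalize (shift_expansive (psi X) (psi Y)). rewrite !psi_spec. lra. Qed.

Lemma Cn_psi (k : nat) : Cn (V := R_NormedModule) k (fun _ => True) psi.
Proof.
  assert (forall k, Cn (V := R_NormedModule) k (fun _ => True) (Derive k1)) as CD.
  { intros n. destruct (Cn_R_inv n _ _ (pr_smooth1 pr (S n))) as [k1' [H1 H2]].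
    apply (Cn_ext n _ k1'); [apply open_true| |exact H2].
    intros x _. symmetry. apply is_derive_unique, H1, I. }
  assert (forall t, is_derive k1 t (Derive k1 t)) as DK.
  { intros t. apply Derive_correct. destruct (Cn_R_inv 0 _ _ (pr_smooth1 pr 1%nat)) as [k1' [H1 _]].
    exists (k1' t). apply H1, I. }
  assert (forall t, is_derive (fun t => t + e * k1 t) t (1 + e * Derive k1 t)) as DS.
  { intros t. auto_derive; [exists (Derive k1 t); apply DK|].
    change (Derive (fun x => k1 x) t) with (Derive k1 t). ring. }
  (* A zero derivative would let some short step shrink to a quarter of its length, while
     [shift_expansive] keeps at least half. *)
  assert (forall t, 1 + e * Derive k1 t <> 0) as NZ.
  { intros t E. destruct (is_derive_small _ t _ (/ 4) (DS t)) as [dl [Hdl H]]; [lra|].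
    specialize (H (dl / 2)). rewrite E, Rmult_0_l, Rminus_0_r in H.
    generalize (shift_expansive (t + dl / 2) t). replace (t + dl / 2 - t) with (dl / 2) by ring.
    rewrite Rabs_pos_eq in * by lra. specialize (H ltac:(lra)). lra. }
  assert (forall X, is_derive psi X (/ (1 + e * Derive k1 (psi X)))) as DP.
  { intros X. apply (is_derive_inverse (fun t => t + e * k1 t)).
    - apply psi_spec.
    - apply psi_lip.
    - apply NZ.
    - apply DS. }
  (* Bootstrap: the derivative of [psi] is a smooth function of [psi] itself, so each order of
     smoothness yields the next. *)
  induction k.
  - split; [|exact I]. intros X _. apply (ex_derive_continuous (V := R_NormedModule)). eexists; apply DP.
  - apply (Cn_R_derive k _ _ _ (fun X _ => DP X)).
    apply (Cn_comp k (fun x => x <> 0) (fun _ => True) Rinv (fun X => 1 + e * Derive k1 (psi X))).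
    + intros; apply NZ.
    + apply Cn_inv.
    + apply Cn_plus; [apply Cn_const|]. apply Cn_scal.
      apply (Cn_comp k (fun _ => True) (fun _ => True) (Derive k1) psi); auto.
Qed.

Definition graph_fun (X : R) : R := e * k2 (psi X).

Lemma Cn_graph_fun (k : nat) : Cn (V := R_NormedModule) k (fun _ => True) graph_fun.
Proof.
  apply Cn_scal. apply (Cn_comp k (fun _ => True) (fun _ => True) k2 psi); auto.
  - apply (pr_smooth2 pr).
  - apply Cn_psi.
Qed.

Lemma graph_fun_continuous (x : R) : continuous graph_fun x.
Proof. apply (Cn_continuous (V := R_NormedModule) 0 (fun _ => True)); [apply Cn_graph_fun|exact I]. Qed.

Lemma graph_fun_bd (x : R) : Rabs (graph_fun x) <= / 2.
Proof.
  unfold graph_fun. rewrite Rabs_mult, (Rabs_pos_eq e) by lra.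
  generalize (proj2 (k_bd (psi x))) (Rabs_pos (k2 (psi x))). nra.
Qed.

Lemma psi_out (t : R) : 1 <= Rabs t -> psi t = t.
Proof.
  intros H. rewrite <- (psi_unique t) at 2. rewrite (pr_k1_out pr t H). f_equal. ring.
Qed.

Lemma graph_fun_out (t : R) : 1 <= Rabs t -> graph_fun t = 0.
Proof.
  intros H. unfold graph_fun. rewrite psi_out, (pr_k2_out pr) by exact H. ring.
Qed.

Lemma bump_graph (t : R) : Im (push (bump k1 k2 eta) (t, 0)) = graph_fun (t + Re (push (bump k1 k2 eta) (t, 0))).
Proof.
  unfold push. rewrite bump_real. simpl. replace (t + (e * k1 t - 0 * k2 t)) with (t + e * k1 t) by ring.
  unfold graph_fun. rewrite psi_unique. ring.
Qed.

(** On [-1,1] [G] and [bump] agree. Outside, [G] is real on the axis, vanishes at 1 and -1 and has a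
    small Lipschitz constant, so it cannot carry [t] across the nearer endpoint, and the graph is
    flat beyond it. *)
Lemma G_graph (t : R) : Im (push G (t, 0)) = graph_fun (t + Re (push G (t, 0))).
Proof.
  destruct (Rle_dec (Rabs t) 1) as [H|H].
  - generalize (bump_graph t). unfold push. rewrite bump_real, (pr_G_in pr t H). auto.
  - assert (1 <= Rabs t) as H1 by lra.
    assert (Im (push G (t, 0)) = 0) as ->.
    { unfold push. generalize (pr_G_out pr t H1). destruct (G (t, 0)). simpl. intros ->. ring. }
    symmetry. apply graph_fun_out.
    assert (forall c, Rabs c = 1 -> Rabs (Re (push G (t, 0))) <= Rabs (t - c)) as B.
    { intros c Hc. generalize (push_lip G (pr_G_lip pr) (c, 0) (t, 0)).
      assert (push G (c, 0) = 0) as ->.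
      { unfold push. rewrite (pr_G_in pr), (pr_k1_out pr), (pr_k2_out pr) by lra.
        unfold Cmult, RtoC; simpl. f_equal; ring. }
      replace (push G (t, 0) - 0)%C with (push G (t, 0)) by ring.
      generalize (re_le_Cmod (push G (t, 0))) (hline_dist 0 t c) (Rabs_pos (t - c)). lra. }
    destruct (Rle_dec 0 t) as [P|P].
    + rewrite Rabs_pos_eq in H1 by lra. specialize (B 1 Rabs_R1). rewrite (Rabs_pos_eq (t - 1)) in B by lra.
      apply Rabs_le_between in B. rewrite Rabs_pos_eq; lra.
    + rewrite Rabs_left in H1 by lra. specialize (B (- (1))). rewrite Rabs_Ropp, Rabs_R1 in B.
      specialize (B eq_refl). rewrite (Rabs_left1 (t - - (1))) in B by lra.
      apply Rabs_le_between in B. rewrite Rabs_left1; lra.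
Qed.
End Graph.
Arguments psi : clear implicits.
Arguments graph_fun : clear implicits.

(** * The domains and their parametrizations *)

(** This is |z - 1|^2. The Cayley transform is written in real coordinates over this denominator,
    which reduces its smoothness to that of quotients; [cay_fraction] supplies the complex form. *)
Definition sq1 (z : C) : R := (Re z - 1) * (Re z - 1) + Im z * Im z.
Definition cayX (z : C) : R := -2 * Im z / sq1 z.
Definition cayY (z : C) : R := (1 - (Re z * Re z + Im z * Im z)) / sq1 z.
Definition cay (z : C) : C := (cayX z, cayY z).
Definition icay (w : C) : C := ((1 * w + - Ci) / (1 * w + Ci))%C.

Lemma sq1_pos (z : C) : z <> 1 -> 0 < sq1 z.
Proof.
  intros H. unfold sq1. destruct z as [x y]. simpl.
  destruct (Req_dec x 1) as [->|Hx]; [|nra].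
  destruct (Req_dec y 0) as [->|Hy]; [exfalso; apply H; reflexivity|]. nra.
Qed.

Lemma one_sub_ne (z : C) : z <> 1 -> (1 - z)%C <> 0.
Proof. intros H E. apply H. replace z with (1 - (1 - z))%C by ring. rewrite E. ring. Qed.

Lemma cay_fraction (z : C) : z <> 1 -> cay z = ((Ci * z + Ci) / (- (1) * z + 1))%C.
Proof.
  intros H. generalize (sq1_pos z H). unfold cay, cayX, cayY, sq1. destruct z as [x y]. simpl. intro P.
  unfold Cdiv, Cinv, Cmult, Cplus, Copp, Ci, RtoC; simpl.
  f_equal; field; repeat split; apply Rgt_not_eq; nra.
Qed.

Lemma cay_plus_i (z : C) : z <> 1 -> (cay z + Ci = 2 * Ci / (1 - z))%C.
Proof.
  intros H. rewrite cay_fraction by exact H.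
  replace (- (1) * z + 1)%C with (1 - z)%C by ring. field. apply one_sub_ne, H.
Qed.

Lemma Ci_ne : Ci <> 0.
Proof. intro E. apply (f_equal Im) in E. simpl in E. lra. Qed.

Lemma two_Ci_ne : (2 * Ci)%C <> 0.
Proof. apply Cmult_neq_0; [intro E; apply RtoC_inj in E; lra|apply Ci_ne]. Qed.

Lemma icay_cay (z : C) : z <> 1 -> icay (cay z) = z.
Proof.
  intros H. unfold icay.
  replace (1 * cay z + - Ci)%C with ((cay z + Ci) - 2 * Ci)%C by ring.
  rewrite Cmult_1_l, cay_plus_i by exact H.
  field. repeat split; try apply one_sub_ne, H; try apply Ci_ne.
Qed.

Lemma icay_ne (w : C) : (w + Ci)%C <> 0 -> icay w <> 1.
Proof.
  intros H E. unfold icay in E. apply two_Ci_ne.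
  replace (2 * Ci)%C with ((1 - (1 * w + - Ci) / (1 * w + Ci)) * (w + Ci))%C.
  - rewrite E. ring.
  - field. exact H.
Qed.

Lemma cay_icay (w : C) : (w + Ci)%C <> 0 -> cay (icay w) = w.
Proof.
  intros H. generalize (icay_ne w H). intro N. rewrite cay_fraction by exact N.
  unfold icay in *. field. split; [exact H|].
  intro E. apply two_Ci_ne. rewrite <- E. ring.
Qed.

Lemma cayY_pos_iff (z : C) : z <> 1 -> 0 < cayY z <-> Cmod z < 1.
Proof.
  intros H. generalize (sq1_pos z H). intro P. unfold cayY.
  replace (Re z * Re z + Im z * Im z) with (Cmod z ^ 2) by (rewrite Cmod2_alt; ring).
  generalize (Cmod_ge_0 z). intro Q. split; intro A.
  - apply (Rmult_lt_compat_r (sq1 z)) in A; [|exact P].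
    replace ((1 - Cmod z ^ 2) / sq1 z * sq1 z) with (1 - Cmod z ^ 2) in A by (field; lra). nra.
  - apply Rdiv_lt_0_compat; [nra|exact P].
Qed.

Lemma cayY_nonneg_iff (z : C) : z <> 1 -> 0 <= cayY z <-> Cmod z <= 1.
Proof.
  intros H. generalize (sq1_pos z H). intro P. unfold cayY.
  replace (Re z * Re z + Im z * Im z) with (Cmod z ^ 2) by (rewrite Cmod2_alt; ring).
  generalize (Cmod_ge_0 z). intro Q. split; intro A.
  - apply (Rmult_le_compat_r (sq1 z)) in A; [|lra].
    replace ((1 - Cmod z ^ 2) / sq1 z * sq1 z) with (1 - Cmod z ^ 2) in A by (field; lra). nra.
  - apply Rmult_le_pos; [nra|left; apply Rinv_0_lt_compat, P].
Qed.

(** The right side is |Z + i|^2 = 4 / |1 - z|^2. On the square [-1,1] x [-1,1], which contains the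
    support of [bump], it is at most 5. *)
Lemma cay_far (z : C) : z <> 1 -> sq1 z < / 2 -> 8 < cayX z ^ 2 + (cayY z + 1) ^ 2.
Proof.
  intros H1 H2. generalize (sq1_pos z H1). intro P.
  replace (cayX z ^ 2 + (cayY z + 1) ^ 2) with (4 / sq1 z).
  - apply Rmult_lt_reg_r with (sq1 z); [exact P|]. unfold Rdiv. rewrite Rmult_assoc, Rinv_l by lra. lra.
  - unfold cayX, cayY. revert P. unfold sq1. destruct z as [x y]; simpl. intros. field. lra.
Qed.

Section Domain.
Context {k1 k2 eta : R -> R} {G : C -> C} (pr : profile k1 k2 eta G).

Local Notation bmp := (bump k1 k2 eta).

Definition bump_disc (z : C) : C := ((1 - z) * bmp (cay z))%C.
(** The perturbation of the identity of the half-plane, conjugated by the Cayley transform, with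
    numerator and denominator multiplied by [1 - z]. In this form it makes sense at z = 1, and on
    all of |z| < 2. *)
Definition gamma (e : R) (z : C) : C := ((2 * Ci * z + e * bump_disc z) / (2 * Ci + e * bump_disc z))%C.

Lemma bump_disc_near_1 (z : C) : sq1 z < / 2 -> bump_disc z = 0.
Proof.
  intros H. unfold bump_disc. destruct (classic (z = 1)) as [->|N]; [ring|].
  assert (bmp (cay z) = 0) as ->; [|ring].
  generalize (cay_far z N H). intro F. unfold bump. simpl.
  destruct (Rle_dec 1 (Rabs (cayX z))) as [A|A].
  - rewrite (pr_k1_out pr), (pr_k2_out pr) by exact A. unfold RtoC. f_equal; ring.
  - rewrite (pr_eta_out pr); [unfold RtoC; f_equal; ring|].
    apply Rnot_lt_le. intro B. apply Rnot_le_lt in A. apply Rabs_lt_between in A, B. nra.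
Qed.

Lemma gamma_near_1 (e : R) (z : C) : sq1 z < / 2 -> gamma e z = z.
Proof.
  intros H. unfold gamma. rewrite bump_disc_near_1 by exact H.
  replace (e * 0)%C with (RtoC 0) by ring. rewrite !Cplus_0_r. field. apply Ci_ne.
Qed.

Section FixedE.
Variable e : R.
Hypothesis He : 0 <= e <= 1.

Local Notation b := (graph_fun k1 k2 e).

Lemma Cmod_bump_disc (z : C) : Cmod z < 2 -> Cmod (e * bump_disc z) <= 3 / 4.
Proof.
  intros H. unfold bump_disc. rewrite !Cmod_mult, Cmod_R, Rabs_pos_eq by lra.
  assert (Cmod (1 - z) <= 3).
  { eapply Rle_trans; [apply Cmod_sub_le|]. rewrite Cmod_1. lra. }
  generalize (pr_bump_bd pr (cay z)) (Cmod_ge_0 (1 - z)) (Cmod_ge_0 (bmp (cay z))).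
  set (a := Cmod (1 - z)%C) in *. set (c := Cmod (bmp (cay z))). intros.
  assert (a * c <= 3 * / 4) by (apply Rmult_le_compat; lra).
  assert (0 <= a * c) by nra. nra.
Qed.

Lemma Cmod_gamma_denom (z : C) : Cmod z < 2 -> 5 / 4 <= Cmod (2 * Ci + e * bump_disc z) <= 11 / 4.
Proof.
  intros H. generalize (Cmod_bump_disc z H). intro B.
  assert (Cmod (2 * Ci) = 2) as E by (rewrite Cmod_mult, Cmod_R, Cmod_Ci, Rabs_pos_eq; lra).
  split.
  - generalize (Cmod_sub_ge (2 * Ci) (- (e * bump_disc z))). rewrite Cmod_opp, E.
    replace (2 * Ci - - (e * bump_disc z))%C with (2 * Ci + e * bump_disc z)%C by ring. lra.
  - eapply Rle_trans; [apply Cmod_triangle|]. lra.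
Qed.

Lemma gamma_denom_ne (z : C) : Cmod z < 2 -> (2 * Ci + e * bump_disc z)%C <> 0.
Proof. intros H. apply Cmod_gt_0. generalize (Cmod_gamma_denom z H). lra. Qed.

Definition moved (z : C) : C := (cay z + push e bmp (cay z))%C.

Lemma gamma_denom_moved (z : C) : z <> 1 -> ((1 - z) * (moved z + Ci) = 2 * Ci + e * bump_disc z)%C.
Proof.
  intros H. unfold moved, push, bump_disc.
  replace (cay z + e * bmp (cay z) + Ci)%C with ((cay z + Ci) + e * bmp (cay z))%C by ring.
  rewrite cay_plus_i by exact H. field. apply one_sub_ne, H.
Qed.

Lemma moved_plus_i_ne (z : C) : z <> 1 -> Cmod z < 2 -> (moved z + Ci)%C <> 0.
Proof.
  intros H1 H2 E. apply (gamma_denom_ne z H2). rewrite <- gamma_denom_moved, E by exact H1. ring.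
Qed.

Lemma gamma_icay (z : C) : z <> 1 -> Cmod z < 2 -> gamma e z = icay (moved z).
Proof.
  intros H1 H2. unfold gamma. rewrite <- gamma_denom_moved by exact H1.
  replace (2 * Ci * z + e * bump_disc z)%C with ((1 - z) * (moved z + - Ci))%C.
  - unfold icay. rewrite !Cmult_1_l. field. split; [apply moved_plus_i_ne; auto|apply one_sub_ne, H1].
  - replace (moved z + - Ci)%C with (moved z + Ci - 2 * Ci)%C by ring.
    replace ((1 - z) * (moved z + Ci - 2 * Ci))%C with ((1 - z) * (moved z + Ci) - 2 * Ci * (1 - z))%C by ring.
    rewrite gamma_denom_moved by exact H1. ring.
Qed.

Lemma gamma_1 : gamma e 1 = 1.
Proof. apply gamma_near_1. unfold sq1. simpl. lra. Qed.

Lemma gamma_ne_1 (z : C) : z <> 1 -> Cmod z < 2 -> gamma e z <> 1.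
Proof. intros H1 H2. rewrite gamma_icay by auto. apply icay_ne, moved_plus_i_ne; auto. Qed.

Lemma cay_gamma (z : C) : z <> 1 -> Cmod z < 2 -> cay (gamma e z) = moved z.
Proof. intros H1 H2. rewrite gamma_icay by auto. apply cay_icay, moved_plus_i_ne; auto. Qed.

(** One lower bound gives injectivity and, later, the nonvanishing differential. The factors [1 - z]
    and [1 - w] from the two Cayley transforms combine into the denominators of [gamma], of modulus
    at most 11/4, and 2 / (11/4)^2 exceeds 1/4. *)
Lemma gamma_expansive (z w : C) : Cmod z < 2 -> Cmod w < 2 -> / 4 * Cmod (z - w) <= Cmod (gamma e z - gamma e w).
Proof.
  assert (forall z, Cmod z < 2 -> / 4 * Cmod (z - 1) <= Cmod (gamma e z - 1)) as A.
  { clear z w. intros z Hz. generalize (Cmod_gamma_denom z Hz) (gamma_denom_ne z Hz). intros B N.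
    unfold gamma. replace ((2 * Ci * z + e * bump_disc z) / (2 * Ci + e * bump_disc z) - 1)%C with
      (2 * Ci * (z - 1) / (2 * Ci + e * bump_disc z))%C by (field; exact N).
    rewrite Cmod_div, !Cmod_mult, Cmod_R, Cmod_Ci, Rabs_pos_eq by (try exact N; lra).
    set (d := Cmod (2 * Ci + e * bump_disc z)) in *.
    apply Rmult_le_reg_r with d; [lra|]. unfold Rdiv. rewrite (Rmult_assoc _ (/ d)), Rinv_l by lra.
    generalize (Cmod_ge_0 (z - 1)). nra. }
  intros Hz Hw.
  destruct (classic (w = 1)) as [->|Nw]; [rewrite gamma_1; auto|].
  destruct (classic (z = 1)) as [->|Nz].
  { rewrite gamma_1, (Cmod_sub_sym 1 w), (Cmod_sub_sym 1 (gamma e w)). auto. }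
  generalize (Cmod_gamma_denom z Hz) (Cmod_gamma_denom w Hw) (moved_plus_i_ne z Nz Hz) (moved_plus_i_ne w Nw Hw).
  rewrite <- !gamma_denom_moved by auto. intros Bz Bw Mz Mw.
  rewrite !gamma_icay by auto. unfold icay.
  replace ((1 * moved z + - Ci) / (1 * moved z + Ci) - (1 * moved w + - Ci) / (1 * moved w + Ci))%C with
    (2 * Ci * (moved z - moved w) / ((moved z + Ci) * (moved w + Ci)))%C
    by (field; repeat split; auto).
  rewrite Cmod_div, !Cmod_mult, Cmod_R, Cmod_Ci, Rabs_pos_eq by (try (apply Cmult_neq_0; auto); lra).
  rewrite !Cmod_mult in Bz, Bw.
  assert (/ 2 * Cmod (cay z - cay w) <= Cmod (moved z - moved w)) as E1.
  { apply (perturbed_id_expansive (push e bmp) (push_lip e He bmp (pr_bump_lip pr))). }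
  assert (Cmod (cay z - cay w) * (Cmod (1 - z) * Cmod (1 - w)) = 2 * Cmod (z - w)) as E2.
  { rewrite <- !Cmod_mult. replace (cay z - cay w)%C with ((cay z + Ci) - (cay w + Ci))%C by ring.
    rewrite !cay_plus_i by auto.
    replace ((2 * Ci / (1 - z) - 2 * Ci / (1 - w)) * ((1 - z) * (1 - w)))%C with (2 * Ci * (z - w))%C
      by (field; split; apply one_sub_ne; auto).
    rewrite !Cmod_mult, Cmod_R, Cmod_Ci, Rabs_pos_eq; lra. }
  assert (0 < Cmod (1 - z)) as Pz by (apply Cmod_gt_0, one_sub_ne, Nz).
  assert (0 < Cmod (1 - w)) as Pw by (apply Cmod_gt_0, one_sub_ne, Nw).
  assert (0 < Cmod (moved z + Ci)) as Qz by (apply Cmod_gt_0, Mz).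
  assert (0 < Cmod (moved w + Ci)) as Qw by (apply Cmod_gt_0, Mw).
  generalize (Cmod_ge_0 (z - w)) (Cmod_ge_0 (moved z - moved w)). intros P1 P2.
  set (a := Cmod (1 - z)%C) in *. set (c := Cmod (1 - w)%C) in *.
  set (mz := Cmod (moved z + Ci)%C) in *. set (mw := Cmod (moved w + Ci)%C) in *.
  set (X := Cmod (z - w)%C) in *. set (Y := Cmod (moved z - moved w)%C) in *. set (T := Cmod (cay z - cay w)%C) in *.
  apply Rmult_le_reg_r with (mz * mw); [apply Rmult_lt_0_compat; auto|].
  replace (2 * 1 * Y / (mz * mw) * (mz * mw)) with (2 * Y) by (field; split; lra).
  apply Rmult_le_reg_r with (a * c); [apply Rmult_lt_0_compat; auto|].
  apply Rle_trans with (2 * X).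
  - replace (/ 4 * X * (mz * mw) * (a * c)) with (X * (/ 4 * ((a * mz) * (c * mw)))) by ring.
    rewrite (Rmult_comm 2 X). apply Rmult_le_compat_l; [exact P1|].
    assert ((a * mz) * (c * mw) <= 11 / 4 * (11 / 4)) by (apply Rmult_le_compat; lra). lra.
  - rewrite <- E2.
    apply Rle_trans with (2 * Y * (a * c)); [|lra].
    assert (0 < a * c) by (apply Rmult_lt_0_compat; auto). nra.
Qed.

(** The point 1 stands for infinity in the half-plane; it is excluded explicitly because the
    coordinates [cayX] and [cayY] carry no meaning there. *)
Definition omega (p : C) : Prop := p <> 1 /\ b (cayX p) < cayY p.

Lemma bump_sides (Z : C) :
  (0 < Im Z <-> b (Re (Z + push e bmp Z)%C) < Im (Z + push e bmp Z)%C) /\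
  (0 <= Im Z <-> b (Re (Z + push e bmp Z)%C) <= Im (Z + push e bmp Z)%C).
Proof.
  split; [apply side_pos_iff|apply side_nonneg_iff];
    try (apply push_lip; [exact He|apply (pr_bump_lip pr)]);
    try (apply push_bd; [exact He|apply (pr_bump_bd pr)]);
    try (intro; eapply graph_fun_continuous; eauto);
    try (intro; eapply graph_fun_bd; eauto);
    try (intro; eapply bump_graph; eauto).
Qed.

Lemma G_sides (Z : C) : 0 < Im Z <-> b (Re (Z + push e G Z)%C) < Im (Z + push e G Z)%C.
Proof.
  apply side_pos_iff;
    try (apply push_lip; [exact He|apply (pr_G_lip pr)]);
    try (apply push_bd; [exact He|apply (pr_G_bd pr)]);
    try (intro; eapply graph_fun_continuous; eauto);
    try (intro; eapply graph_fun_bd; eauto);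
    try (intro; eapply G_graph; eauto).
Qed.

Lemma omega_gamma (z : C) : Cmod z < 1 -> omega (gamma e z).
Proof.
  intros H. assert (Cmod z < 2) as H2 by lra.
  assert (z <> 1) as N by (intros ->; rewrite Cmod_1 in H; lra).
  split; [apply gamma_ne_1; auto|].
  change (b (Re (cay (gamma e z))) < Im (cay (gamma e z))). rewrite cay_gamma by auto.
  apply bump_sides. apply (proj2 (cayY_pos_iff z N) H).
Qed.

Lemma upper_plus_i_ne (Z : C) : 0 <= Im Z -> (Z + Ci)%C <> 0.
Proof. intros H E. apply (f_equal Im) in E. destruct Z; simpl in *. lra. Qed.

(** The perturbation is onto the whole plane, and [bump_sides] places the preimage in the closed
    half-plane. The strict clause serves the open domain, the weak one its closure. *)
Lemma gamma_surjective (p : C) : p <> 1 -> b (cayX p) <= cayY p ->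
  exists z : C, z <> 1 /\ Cmod z <= 1 /\ gamma e z = p /\ (b (cayX p) < cayY p -> Cmod z < 1).
Proof.
  intros N H.
  destruct (contraction_surjective (push e bmp) (push_lip e He bmp (pr_bump_lip pr)) (cay p)) as [Z HZ].
  assert (0 <= Im Z) as IZ by (apply bump_sides; rewrite HZ; exact H).
  generalize (upper_plus_i_ne Z IZ). intro NZ.
  generalize (icay_ne Z NZ) (cay_icay Z NZ). intros N1 E1.
  assert (cayY (icay Z) = Im Z) as E2 by (rewrite <- E1 at 2; reflexivity).
  assert (Cmod (icay Z) <= 1) as H1 by (apply cayY_nonneg_iff; [exact N1|rewrite E2; exact IZ]).
  exists (icay Z). split; [exact N1|]. split; [exact H1|]. split.
  - rewrite gamma_icay by (auto; lra). unfold moved. rewrite E1, HZ. apply icay_cay, N.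
  - intros H2. apply cayY_pos_iff; [exact N1|]. rewrite E2. apply bump_sides. rewrite HZ. exact H2.
Qed.

Lemma omega_surjective (p : C) : omega p -> exists z, Cmod z < 1 /\ gamma e z = p.
Proof.
  intros [N H]. destruct (gamma_surjective p N (Rlt_le _ _ H)) as [z [_ [_ [E L]]]].
  exists z. auto.
Qed.

End FixedE.
End Domain.
Arguments bump_disc : clear implicits.
Arguments gamma : clear implicits.
Arguments omega : clear implicits.

(** * Smoothness of the parametrization *)

Lemma Cn_minus {V : NormedModule R_AbsRing} k (U : V -> Prop) (f g : V -> R) :
  Cn k U f -> Cn k U g -> Cn k U (fun p => f p - g p).
Proof.
  intros HF HG. replace (fun p => f p - g p) with (fun p => f p + -1 * g p).
  - apply Cn_plus; [exact HF|]. apply Cn_scal, HG.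
  - apply functional_extensionality. intros p. ring.
Qed.

Lemma open_pos {V : NormedModule R_AbsRing} (U : V -> Prop) (f : V -> R) : open U ->
  (forall p, U p -> continuous f p) -> open (fun p => U p /\ 0 < f p).
Proof.
  intros HU Hf p [H1 H2]. apply filter_and; [apply HU, H1|].
  apply (Hf p H1 (fun y => 0 < y)). apply (open_gt 0 (f p) H2).
Qed.

Ltac smooth_step := first [ assumption | apply Cn_const | apply Cn_minus | apply Cn_plus | apply Cn_mult ].

Section Smoothness.
Context {k1 k2 eta : R -> R} {G : C -> C} (pr : profile k1 k2 eta G).
Context {V : NormedModule R_AbsRing}.
Variables (U : V -> Prop) (fx fy fe : V -> R).
Hypothesis HU : open U.
Hypothesis Hx : forall k, Cn k U fx.
Hypothesis Hy : forall k, Cn k U fy.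
Hypothesis He : forall k, Cn k U fe.

Lemma Cn_sq1 k : Cn k U (fun p => sq1 (fx p, fy p)).
Proof. unfold sq1; simpl. repeat smooth_step; auto. Qed.

Lemma open_sq1_pos : open (fun p => U p /\ 0 < sq1 (fx p, fy p)).
Proof. apply open_pos; [exact HU|]. intros p. apply (Cn_continuous 0), Cn_sq1. Qed.

Lemma open_sq1_small : open (fun p => U p /\ 0 < / 2 - sq1 (fx p, fy p)).
Proof.
  apply open_pos; [exact HU|]. intros p. apply (Cn_continuous 0).
  apply Cn_minus; [apply Cn_const|apply Cn_sq1].
Qed.

Lemma Cn_cay k : Cn k (fun p => U p /\ 0 < sq1 (fx p, fy p)) (fun p => cayX (fx p, fy p)) /\
  Cn k (fun p => U p /\ 0 < sq1 (fx p, fy p)) (fun p => cayY (fx p, fy p)).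
Proof.
  assert (forall f, Cn k U f -> Cn k (fun p => U p /\ 0 < sq1 (fx p, fy p)) f) as S.
  { intros f. apply Cn_subset. tauto. }
  split; (apply Cn_div; [intros p [_ Hp]; lra| |apply S, Cn_sq1]); apply S; simpl;
    repeat smooth_step; auto.
Qed.

Lemma Cn_bump_disc k : Cn k U (fun p => Re (bump_disc k1 k2 eta (fx p, fy p))) /\
  Cn k U (fun p => Im (bump_disc k1 k2 eta (fx p, fy p))).
Proof.
  set (W := fun p => U p /\ 0 < sq1 (fx p, fy p)).
  assert (forall f, Cn k U f -> Cn k W f) as S.
  { intros f. apply Cn_subset. unfold W. tauto. }
  assert (Cn k W (fun p => k1 (cayX (fx p, fy p)) * eta (cayY (fx p, fy p))) /\
          Cn k W (fun p => k2 (cayX (fx p, fy p)) * eta (cayY (fx p, fy p)))) as [B1 B2].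
  { destruct (Cn_cay k) as [CX CY].
    split; (apply Cn_mult; [apply (Cn_comp k (fun _ => True)); auto|apply (Cn_comp k (fun _ => True)); auto]);
      first [apply (pr_smooth1 pr)|apply (pr_smooth2 pr)|apply (pr_smooth_eta pr)]. }
  assert (Cn k W (fun p => Re (bump_disc k1 k2 eta (fx p, fy p))) /\
          Cn k W (fun p => Im (bump_disc k1 k2 eta (fx p, fy p)))) as [M1 M2].
  { split.
    - apply (Cn_ext k W (fun p => (1 - fx p) * (k1 (cayX (fx p, fy p)) * eta (cayY (fx p, fy p)))
        + fy p * (k2 (cayX (fx p, fy p)) * eta (cayY (fx p, fy p))))).
      + apply open_sq1_pos.
      + intros p _. unfold bump_disc, bump, cay. simpl. ring.
      + repeat first [apply B1|apply B2|smooth_step]; apply S; auto.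
    - apply (Cn_ext k W (fun p => (1 - fx p) * (k2 (cayX (fx p, fy p)) * eta (cayY (fx p, fy p)))
        - fy p * (k1 (cayX (fx p, fy p)) * eta (cayY (fx p, fy p))))).
      + apply open_sq1_pos.
      + intros p _. unfold bump_disc, bump, cay. simpl. ring.
      + repeat first [apply B1|apply B2|smooth_step]; apply S; auto. }
  (* Two open sets cover [U]: away from z = 1 the explicit formula applies, and near z = 1 the
     function vanishes identically. *)
  assert (forall F : C -> R, F 0 = 0 -> Cn k W (fun p => F (bump_disc k1 k2 eta (fx p, fy p))) ->
    Cn k U (fun p => F (bump_disc k1 k2 eta (fx p, fy p)))) as L.
  { intros F F0 HF. apply Cn_local; [exact HU|]. intros p Hp.
    destruct (Rlt_dec 0 (sq1 (fx p, fy p))) as [P|P].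
    - exists W. split; [apply open_sq1_pos|]. split; [split; auto|exact HF].
    - exists (fun p => U p /\ 0 < / 2 - sq1 (fx p, fy p)). split; [apply open_sq1_small|].
      split; [split; [auto|lra]|].
      apply (Cn_ext k _ (fun _ => 0)); [apply open_sq1_small| |apply Cn_const].
      intros q [_ Hq]. rewrite (bump_disc_near_1 pr) by lra. auto. }
  split; [apply (L Re)|apply (L Im)]; auto.
Qed.

Hypothesis Hbd : forall p, U p -> Cmod (fx p, fy p) < 2.
Hypothesis Her : forall p, U p -> 0 <= fe p <= 1.

(** Arbitrary coordinate functions on [V] let one proof serve a fixed [e] on C and the varying
    [flat_exp lambda] on C x R. *)
Lemma gamma_smooth : Csmooth_on U (fun p => gamma k1 k2 eta (fe p) (fx p, fy p)).
Proof.
  assert (forall k, Cn k U (fun p => Re (gamma k1 k2 eta (fe p) (fx p, fy p))) /\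
    Cn k U (fun p => Im (gamma k1 k2 eta (fe p) (fx p, fy p)))) as H.
  { intros k. destruct (Cn_bump_disc k) as [M1 M2].
    set (m1 := fun p => Re (bump_disc k1 k2 eta (fx p, fy p))) in *.
    set (m2 := fun p => Im (bump_disc k1 k2 eta (fx p, fy p))) in *.
    set (n1 := fun p => -2 * fy p + fe p * m1 p). set (n2 := fun p => 2 * fx p + fe p * m2 p).
    set (d1 := fun p => fe p * m1 p). set (d2 := fun p => 2 + fe p * m2 p).
    assert (forall p, U p -> d1 p * d1 p + d2 p * d2 p <> 0) as ND.
    { intros p Hp E. apply (gamma_denom_ne pr (fe p) (Her p Hp) (fx p, fy p) (Hbd p Hp)).
      assert (d1 p = 0) as E1 by nra. assert (d2 p = 0) as E2 by nra.
      unfold d1, d2, m1, m2 in E1, E2.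
      destruct (bump_disc k1 k2 eta (fx p, fy p)) as [u v]. simpl in *.
      unfold Cplus, Cmult, RtoC, Ci; simpl. f_equal; lra. }
    assert (Cn k U n1 /\ Cn k U n2 /\ Cn k U d1 /\ Cn k U d2) as [N1 [N2 [D1 D2]]].
    { unfold n1, n2, d1, d2. repeat split; repeat smooth_step; auto. }
    assert (forall p, U p -> gamma k1 k2 eta (fe p) (fx p, fy p) =
      ((n1 p * d1 p + n2 p * d2 p) / (d1 p * d1 p + d2 p * d2 p),
       (n2 p * d1 p - n1 p * d2 p) / (d1 p * d1 p + d2 p * d2 p))) as E.
    { intros p Hp. specialize (ND p Hp). unfold gamma.
      replace (2 * Ci * (fx p, fy p) + fe p * bump_disc k1 k2 eta (fx p, fy p))%C with ((n1 p, n2 p) : C).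
      2:{ unfold n1, n2, m1, m2. destruct (bump_disc k1 k2 eta (fx p, fy p)) as [u v].
          unfold Cplus, Cmult, RtoC, Ci; simpl. f_equal; ring. }
      replace (2 * Ci + fe p * bump_disc k1 k2 eta (fx p, fy p))%C with ((d1 p, d2 p) : C).
      2:{ unfold d1, d2, m1, m2. destruct (bump_disc k1 k2 eta (fx p, fy p)) as [u v].
          unfold Cplus, Cmult, RtoC, Ci; simpl. f_equal; ring. }
      unfold Cdiv, Cinv, Cmult; simpl. f_equal; field; repeat split; intro Q; apply ND; rewrite <- Q; ring. }
    split.
    - apply (Cn_ext k U (fun p => (n1 p * d1 p + n2 p * d2 p) / (d1 p * d1 p + d2 p * d2 p))); [exact HU| |].
      + intros p Hp. rewrite E by exact Hp. reflexivity.
      + apply Cn_div; [exact ND| |]; repeat smooth_step.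
    - apply (Cn_ext k U (fun p => (n2 p * d1 p - n1 p * d2 p) / (d1 p * d1 p + d2 p * d2 p))); [exact HU| |].
      + intros p Hp. rewrite E by exact Hp. reflexivity.
      + apply Cn_div; [exact ND| |]; repeat smooth_step. }
  split; intros k; apply Cn_Ck_on; auto; apply H.
Qed.
End Smoothness.

Lemma Cn_Re k (U : CR2 -> Prop) : Cn k U (fun z => Re z).
Proof.
  apply Cn_linear.
  - intros p. apply continuous_fst.
  - intros. reflexivity.
Qed.

Lemma Cn_Im k (U : CR2 -> Prop) : Cn k U (fun z => Im z).
Proof.
  apply Cn_linear.
  - intros p. apply continuous_snd.
  - intros. reflexivity.
Qed.

Lemma Cn_Re_fst k (U : CxR -> Prop) : Cn k U (fun p => Re (fst p)).
Proof.
  apply Cn_linear.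
  - intros p. apply (continuous_comp (fun p : CxR => fst p) (fun z : C_UniformSpace => fst z)).
    + apply continuous_fst.
    + apply continuous_fst.
  - intros. reflexivity.
Qed.

Lemma Cn_Im_fst k (U : CxR -> Prop) : Cn k U (fun p => Im (fst p)).
Proof.
  apply Cn_linear.
  - intros p. apply (continuous_comp (fun p : CxR => fst p) (fun z : C_UniformSpace => snd z)).
    + apply continuous_fst.
    + apply continuous_snd.
  - intros. reflexivity.
Qed.

Lemma Cn_snd k (U : CxR -> Prop) : Cn k U (fun p => snd p).
Proof.
  apply Cn_linear.
  - intros p. apply continuous_snd.
  - intros. reflexivity.
Qed.

(** The conjunct [True] is the shape that [open_pos] produces for the whole space. *)
Definition disc2 (z : CR2) : Prop := True /\ 0 < 4 - (Re z * Re z + Im z * Im z).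
Definition tube2 (p : CxR) : Prop := True /\ 0 < 4 - (Re (fst p) * Re (fst p) + Im (fst p) * Im (fst p)).

Lemma disc2_open : open disc2.
Proof.
  apply (open_pos (V := CR2) (fun _ => True)); [apply open_true|]. intros p _.
  apply (Cn_continuous 0 (fun _ => True)); [|exact I].
  repeat first [apply Cn_Re|apply Cn_Im|smooth_step].
Qed.

Lemma tube2_open : open tube2.
Proof.
  apply (open_pos (V := CxR) (fun _ => True)); [apply open_true|]. intros p _.
  apply (Cn_continuous 0 (fun _ => True)); [|exact I].
  repeat first [apply Cn_Re_fst|apply Cn_Im_fst|smooth_step].
Qed.

Lemma disc2_Cmod (z : C) : 0 < 4 - (Re z * Re z + Im z * Im z) <-> Cmod z < 2.
Proof.
  generalize (Cmod2_alt z) (Cmod_ge_0 z). intros E P. split; nra.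
Qed.

Section GammaSmooth.
Context {k1 k2 eta : R -> R} {G : C -> C} (pr : profile k1 k2 eta G).

Lemma gamma_smooth_tube : Csmooth_on tube2 (fun p : C * R => gamma k1 k2 eta (flat_exp (snd p)) (fst p)).
Proof.
  generalize (gamma_smooth pr (V := CxR) tube2 (fun p => Re (fst p)) (fun p => Im (fst p))
    (fun p => flat_exp (snd p)) tube2_open).
  intro H. replace (fun p : C * R => gamma k1 k2 eta (flat_exp (snd p)) (fst p)) with
    (fun p : CxR => gamma k1 k2 eta (flat_exp (snd p)) (Re (fst p), Im (fst p))).
  - apply H.
    + intros. apply Cn_Re_fst.
    + intros. apply Cn_Im_fst.
    + intros k. apply (Cn_comp k (fun _ => True)); auto; [apply Cn_flat_exp|apply Cn_snd].
    + intros p [_ Hp]. apply disc2_Cmod. exact Hp.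
    + intros. apply flat_exp_range.
  - apply functional_extensionality. intros [[x y] t]. reflexivity.
Qed.

Variable e : R.
Hypothesis He : 0 <= e <= 1.

Lemma gamma_smooth_disc : Csmooth_on disc2 (gamma k1 k2 eta e).
Proof.
  generalize (gamma_smooth pr (V := CR2) disc2 (fun p => Re p) (fun p => Im p)
    (fun _ => e) disc2_open).
  intro H. replace (gamma k1 k2 eta e) with (fun p : CR2 => gamma k1 k2 eta e (Re p, Im p)).
  - apply H.
    + intros. apply Cn_Re.
    + intros. apply Cn_Im.
    + intros k. apply Cn_const.
    + intros p [_ Hp]. apply disc2_Cmod. exact Hp.
    + intros. exact He.
  - apply functional_extensionality. intros [x y]. reflexivity.
Qed.

Lemma gamma_continuous (z : C) : Cmod z < 2 ->
  @continuous C_UniformSpace C_UniformSpace (gamma k1 k2 eta e) z.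
Proof.
  intros Hz. assert (disc2 z) as Dz by (split; [exact I|apply disc2_Cmod, Hz]).
  destruct gamma_smooth_disc as [H1 H2]. destruct (H1 O) as [C1 _]. destruct (H2 O) as [C2 _].
  apply (proj2 (filterlim_locally (U := C_UniformSpace) (gamma k1 k2 eta e) (gamma k1 k2 eta e z))). intros d.
  generalize (proj1 (filterlim_locally _ _) (C1 z Dz) d) (proj1 (filterlim_locally _ _) (C2 z Dz) d).
  intros A B. generalize (filter_and _ _ A B). apply filter_imp. intros w [P Q]. split; assumption.
Qed.
End GammaSmooth.

(** * Topology and boundary of the domains *)

Lemma path_connected_connected (A : C -> Prop) :
  (forall a c, A a -> A c -> exists g : R -> C, g 0 = a /\ g 1 = c /\
     (forall t, 0 <= t <= 1 -> A (g t)) /\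
     (forall t, 0 <= t <= 1 -> @continuous R_UniformSpace C_UniformSpace g t)) ->
  @connected_set C_UniformSpace A.
Proof.
  intros H P Q OP OQ Cov [a [Aa Pa]] [c [Ac Qc]]. apply NNPP. intro N.
  destruct (H a c Aa Ac) as [g [g0 [g1 [gA gc]]]].
  (* Clamping extends the path to the whole line, as the intermediate value theorem is applied to a
     function continuous everywhere. *)
  set (cl := fun t => Rmax 0 (Rmin 1 t)).
  assert (forall t, 0 <= cl t <= 1) as Hcl.
  { intros t. unfold cl. split; [apply Rmax_l|]. apply Rmax_lub; [lra|apply Rmin_l]. }
  (* If [P] and [Q] were disjoint on [A], this indicator would be locally constant along the path
     and still pass from 0 to 1. *)
  set (f := fun t => if excluded_middle_informative (P (g (cl t))) then 0 else 1).
  assert (forall t, continuous (fun t => g (cl t)) t) as Cg.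
  { intros t. apply (continuous_comp cl g); [|apply gc, Hcl].
    apply continuity_pt_filterlim. unfold cl. intros e He. exists e. split; [exact He|].
    intros s [_ Hs]. simpl in *. unfold R_dist in *. eapply Rle_lt_trans; [|exact Hs].
    unfold Rmax, Rmin. repeat destruct Rle_dec; unfold Rabs; repeat destruct Rcase_abs; lra. }
  assert (continuity f) as Cf.
  { intros t. apply continuity_pt_filterlim.
    assert (locally t (fun s => f s = f t)) as L.
    { unfold f at 2. destruct excluded_middle_informative as [HP|HP].
      - assert (locally t (fun s => P (g (cl s)))) as L by exact (Cg t P (OP _ HP)).
        revert L. apply filter_imp. intros s Hs. unfold f.
        destruct excluded_middle_informative; [reflexivity|contradiction].
      - assert (Q (g (cl t))) as HQ by (destruct (Cov (g (cl t)) (gA _ (Hcl t))); [contradiction|assumption]).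
        assert (locally t (fun s => Q (g (cl s)))) as L by exact (Cg t Q (OQ _ HQ)).
        revert L. apply filter_imp. intros s Hs. unfold f.
        destruct excluded_middle_informative as [HP'|_]; [exfalso|reflexivity].
        apply N. exists (g (cl s)). auto. }
    apply (continuous_ext_loc f (fun _ => f t) t); [|apply continuous_const].
    generalize L. apply filter_imp. auto. }
  assert (cl 0 = 0) as C0 by (unfold cl; rewrite Rmin_right, Rmax_left; lra).
  assert (cl 1 = 1) as C1 by (unfold cl; rewrite Rmin_left, Rmax_right; lra).
  assert (f 0 = 0) as F0.
  { unfold f. rewrite C0, g0. destruct excluded_middle_informative; [reflexivity|contradiction]. }
  assert (f 1 = 1) as F1.
  { unfold f. rewrite C1, g1. destruct excluded_middle_informative as [HP|_]; [|reflexivity].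
    exfalso. apply N. exists c. auto. }
  destruct (IVT_gen f 0 1 (/ 2) Cf) as [t [_ Et]].
  { rewrite F0, F1, Rmin_left, Rmax_right; lra. }
  unfold f in Et. destruct excluded_middle_informative; lra.
Qed.

Lemma segment_continuous (a c : C) (t : R) :
  @continuous R_UniformSpace C_UniformSpace (fun t => (a + t * (c - a))%C) t.
Proof.
  apply (proj2 (filterlim_locally (U := C_UniformSpace) _ _)). intros d.
  assert (forall u v : R, locally t (fun s => Rabs (s * v - t * v) < d)) as L.
  { intros u v. set (K := Rabs v + 1). assert (0 < K) by (unfold K; generalize (Rabs_pos v); lra).
    assert (0 < d / K) as Hd by (apply Rdiv_lt_0_compat; [apply cond_pos|lra]).
    exists (mkposreal _ Hd). intros s Hs. change (Rabs (s - t) < d / K) in Hs.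
    rewrite <- Rmult_minus_distr_r, Rabs_mult.
    apply (Rmult_lt_compat_r K) in Hs; [|lra]. replace (d / K * K) with (pos d) in Hs by (field; lra).
    unfold K in Hs. generalize (Rabs_pos (s - t)) (Rabs_pos v). nra. }
  generalize (filter_and _ _ (L 0 (Re (c - a)%C)) (L 0 (Im (c - a)%C))). apply filter_imp.
  intros s [A B]. destruct a as [a1 a2], c as [c1 c2]. simpl in A, B.
  split.
  - change (Rabs ((a1 + (s * (c1 + - a1) - 0 * (c2 + - a2))) - (a1 + (t * (c1 + - a1) - 0 * (c2 + - a2)))) < d).
    replace ((a1 + (s * (c1 + - a1) - 0 * (c2 + - a2))) - (a1 + (t * (c1 + - a1) - 0 * (c2 + - a2))))
      with (s * (c1 + - a1) - t * (c1 + - a1)) by ring. exact A.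
  - change (Rabs ((a2 + (s * (c2 + - a2) + 0 * (c1 + - a1))) - (a2 + (t * (c2 + - a2) + 0 * (c1 + - a1)))) < d).
    replace ((a2 + (s * (c2 + - a2) + 0 * (c1 + - a1))) - (a2 + (t * (c2 + - a2) + 0 * (c1 + - a1))))
      with (s * (c2 + - a2) - t * (c2 + - a2)) by ring. exact B.
Qed.

Lemma convex_disc (a c : C) (t : R) : Cmod a < 1 -> Cmod c < 1 -> 0 <= t <= 1 -> Cmod (a + t * (c - a)) < 1.
Proof.
  intros Ha Hc Ht. replace (a + t * (c - a))%C with ((1 - t)%R * a + t * c)%C by (rewrite RtoC_minus; ring).
  eapply Rle_lt_trans; [apply Cmod_triangle|]. rewrite !Cmod_mult, !Cmod_R, !Rabs_pos_eq by lra.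
  generalize (Cmod_ge_0 a) (Cmod_ge_0 c). intros. destruct (Req_dec t 0) as [->|N]; nra.
Qed.

Definition not_one (z : CR2) : Prop := True /\ 0 < sq1 (Re z, Im z).

Lemma not_one_iff (z : C) : not_one z <-> z <> 1.
Proof.
  unfold not_one. split.
  - intros [_ H] ->. unfold sq1 in H. simpl in H. lra.
  - intros H. split; [exact I|]. destruct z. apply (sq1_pos _ H).
Qed.

Lemma not_one_open : open not_one.
Proof.
  apply (open_sq1_pos (V := CR2) (fun _ => True) (fun z => Re z) (fun z => Im z)).
  - apply open_true.
  - intros; apply Cn_Re.
  - intros; apply Cn_Im.
Qed.

Section DomainRegularity.
Context {k1 k2 eta : R -> R} {G : C -> C} (pr : profile k1 k2 eta G).
Variable e : R.
Hypothesis He : 0 <= e <= 1.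

Local Notation b := (graph_fun k1 k2 e).
Local Notation Om := (omega k1 k2 e).
Local Notation gam := (gamma k1 k2 eta e).

Definition height (z : C) : R := b (cayX z) - cayY z.

Lemma Cn_height k : Cn (V := CR2) k not_one height.
Proof.
  destruct (Cn_cay (V := CR2) (fun _ => True) (fun z => Re z) (fun z => Im z)
    (fun k => Cn_Re k _) (fun k => Cn_Im k _) k) as [CX CY].
  apply (Cn_ext k not_one (fun z : CR2 => b (cayX (Re z, Im z)) - cayY (Re z, Im z))).
  - apply not_one_open.
  - intros [x y] _. reflexivity.
  - apply Cn_minus; [|exact CY].
    apply (Cn_comp k (fun _ => True)); auto. apply (Cn_graph_fun pr e He).
Qed.

Lemma height_continuous (z : CR2) : not_one z -> continuous height z.
Proof. intros H. apply (Cn_continuous (V := CR2) 0 not_one); [apply Cn_height|exact H]. Qed.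

Lemma omega_open : @open C_UniformSpace Om.
Proof.
  intros p [N H]. assert (not_one p) as Np by (apply not_one_iff; exact N).
  assert (locally (T := CR2) p (fun q => height q < 0)) as L.
  { apply (height_continuous p Np (fun y => y < 0)). apply (open_lt 0 (height p)). unfold height. lra. }
  generalize (filter_and _ _ (not_one_open p Np) L). apply filter_imp. intros q [A B]. split; [apply not_one_iff, A|]. unfold height in B. lra.
Qed.

Lemma omega_bounded_domain : bounded_domain Om.
Proof.
  split; [apply omega_open|]. split; [|split].
  - exists (gam 0). apply (omega_gamma pr e He). rewrite Cmod_0. lra.
  - apply path_connected_connected. intros p q Hp Hq.
    destruct (omega_surjective pr e He p Hp) as [a [Ha <-]].
    destruct (omega_surjective pr e He q Hq) as [c [Hc <-]].
    exists (fun t : R => gam (a + t * (c - a))%C). split; [f_equal; ring|]. split; [f_equal; ring|]. split.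
    + intros t Ht. apply (omega_gamma pr e He), convex_disc; auto.
    + intros t Ht. apply (continuous_comp (U := R_UniformSpace) (V := C_UniformSpace) (W := C_UniformSpace)
        (fun t : R => (a + t * (c - a))%C) gam).
      * apply segment_continuous.
      * apply (gamma_continuous pr e He). generalize (convex_disc a c t Ha Hc Ht). lra.
  (* The numerator of [gamma] is at most 2 + 3/4 and its denominator at least 5/4. *)
  - exists 3. intros p Hp. destruct (omega_surjective pr e He p Hp) as [z [Hz <-]].
    assert (Cmod z < 2) as Hz2 by lra.
    generalize (Cmod_gamma_denom pr e He z Hz2)
      (Cmod_bump_disc pr e He z Hz2). intros B1 B2.
    unfold gamma. rewrite Cmod_div by (apply (gamma_denom_ne pr e He); exact Hz2).
    apply Rmult_le_reg_r with (Cmod (2 * Ci + e * bump_disc k1 k2 eta z)); [lra|].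
    unfold Rdiv. rewrite Rmult_assoc, Rinv_l, Rmult_1_r by lra.
    eapply Rle_trans; [apply Cmod_triangle|]. rewrite !(Cmod_mult _ z), (Cmod_mult 2), Cmod_R, Cmod_Ci, Rabs_pos_eq by lra.
    generalize (Cmod_ge_0 z). nra.
Qed.

(** Either |X| >= 1, where the graph is the axis, or [cay_far] puts the height Y so far from 0 that
    the graph, within 1/2 of the axis, cannot matter. *)
Lemma omega_near_1 (z : C) : sq1 z < / 2 -> (Om z <-> Cmod z < 1).
Proof.
  intros H. destruct (classic (z = 1)) as [->|N].
  { split; [intros [Q _]; exfalso; apply Q; reflexivity|rewrite Cmod_1; lra]. }
  generalize (cay_far z N H). intro F. rewrite <- (cayY_pos_iff z N). unfold omega.
  destruct (Rle_dec 1 (Rabs (cayX z))) as [A|A].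
  - rewrite (graph_fun_out pr e He) by exact A. tauto.
  - apply Rnot_le_lt, Rabs_lt_between in A.
    generalize (graph_fun_bd pr e He (cayX z)). intro B. apply Rabs_le_between in B.
    split; [intros [_ Q]|intros Q; split; [exact N|]]; nra.
Qed.

(** Around 1, where [cay] has its pole, the domain is the unit disc and |z|^2 - 1 defines it;
    elsewhere [height] does. *)
Lemma omega_smooth_boundary : smooth_boundary Om.
Proof.
  intros p _. destruct (classic (p = 1)) as [->|N].
  - exists (fun z : CR2 => True /\ 0 < / 2 - sq1 (Re z, Im z)), (fun z : CR2 => Re z * Re z + Im z * Im z - 1).
    assert (open (fun z : CR2 => True /\ 0 < / 2 - sq1 (Re z, Im z))) as O.
    { apply (open_sq1_small (V := CR2) (fun _ => True) (fun z => Re z) (fun z => Im z));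
        [apply open_true|intros; apply Cn_Re|intros; apply Cn_Im]. }
    split; [exact O|]. split; [split; [exact I|unfold sq1; simpl; lra]|]. split; [|split].
    + intros k. apply Cn_Ck_on; [exact O|]. repeat first [apply Cn_Re|apply Cn_Im|smooth_step].
    + intros q [_ Hq]. destruct q as [x y]. simpl in *. rewrite omega_near_1 by lra.
      generalize (Cmod2_alt (x, y)) (Cmod_ge_0 (x, y)). simpl. intros. split; nra.
    + intros q _ Hq. exists q. unfold dir_derive. destruct q as [x y]. simpl in Hq.
      rewrite (is_derive_unique _ 0 (2 * (x * x + y * y))); [lra|].
      apply (is_derive_ext (fun s => (x + s * x) * (x + s * x) + (y + s * y) * (y + s * y) - 1)); [reflexivity|].
      auto_derive; [auto|ring].
  - exists not_one, height. split; [apply not_one_open|]. split; [apply not_one_iff, N|]. split; [|split].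
    + intros k. apply Cn_Ck_on; [apply not_one_open|apply Cn_height].
    + intros q Hq. apply not_one_iff in Hq. unfold omega, height. split; [intros [_ A]; lra|intros A; split; [exact Hq|lra]].
    + intros q Hq _. apply not_one_iff in Hq. destruct q as [x y].
      (* the image under (d cay)^-1 of the vertical direction i *)
      exists (((1 - x) * (1 - x) - y * y) / 2, - (1 - x) * y). unfold dir_derive.
      rewrite (is_derive_unique _ 0 (-1)); [lra|].
      set (v1 := ((1 - x) * (1 - x) - y * y) / 2). set (v2 := - (1 - x) * y).
      generalize (sq1_pos _ Hq). intro P.
      assert (is_derive (fun s => cayX (x + s * v1, y + s * v2)) 0 0) as DX.
      { unfold cayX, sq1 in *. simpl in *. unfold v1, v2. auto_derive.
        - rewrite !Rmult_0_l, !Rplus_0_r. unfold Rminus in P. lra.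
        - field. lra. }
      assert (is_derive (fun s => cayY (x + s * v1, y + s * v2)) 0 1) as DY.
      { unfold cayY, sq1 in *. simpl in *. unfold v1, v2. auto_derive.
        - rewrite !Rmult_0_l, !Rplus_0_r. unfold Rminus in P. lra.
        - field. lra. }
      assert (ex_derive b (cayX (x + 0 * v1, y + 0 * v2))) as [d Db].
      { destruct (Cn_R_inv 0 _ _ (Cn_graph_fun pr e He 1%nat)) as [b' [D _]].
        exists (b' (cayX (x + 0 * v1, y + 0 * v2))). apply D, I. }
      replace (-1) with (minus (scal 0 d) 1) by (unfold minus, plus, opp, scal; simpl; unfold mult; simpl; ring).
      apply (is_derive_minus (V := R_NormedModule) (fun s : R => b (cayX (x + s * v1, y + s * v2)))
        (fun s : R => cayY (x + s * v1, y + s * v2))); [|exact DY].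
      apply (is_derive_comp (V := R_NormedModule) b (fun s : R => cayX (x + s * v1, y + s * v2))); [exact Db|exact DX].
Qed.

Lemma gamma_image_closure (w : C) :
  @closure C_UniformSpace Om w <-> exists z, closed_unit_disc z /\ gam z = w.
Proof.
  split.
  - intros Hc. destruct (classic (w = 1)) as [->|N].
    { exists 1. split; [unfold closed_unit_disc; rewrite Cmod_1; lra|]. apply (gamma_1 pr). }
    destruct (Rle_dec (b (cayX w)) (cayY w)) as [L|L].
    + destruct (gamma_surjective pr e He w N L) as [z [_ [Hz [E _]]]]. exists z. auto.
    + exfalso. assert (not_one w) as Nw by (apply not_one_iff; exact N).
      destruct (Hc (fun q => 0 < height q)) as [y [Hy1 [_ Hy2]]].
      * apply (height_continuous w Nw (fun y => 0 < y) (open_gt 0 (height w) ltac:(unfold height; lra))).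
      * unfold height in Hy1. lra.
  - intros [z [Hz <-]] P HP. unfold closed_unit_disc in Hz.
    generalize (gamma_continuous pr e He z ltac:(lra) P HP). intros [d Hd].
    (* Radial approach: [(1 - t) * z] lies in the open disc and differs from [z] by less than [d] in
       each coordinate. *)
    set (t := Rmin 1 (d / 2 / 2)). assert (0 < t).
    { apply Rmin_pos; [lra|]. generalize (cond_pos d). lra. }
    assert (t <= 1) by apply Rmin_l. assert (t <= d / 2 / 2) by apply Rmin_r.
    exists (gam ((1 - t)%R * z)%C). split.
    + apply Hd. generalize (re_le_Cmod z) (im_le_Cmod z). destruct z as [x y]. simpl. intros A B.
      split.
      * change (Rabs (((1 - t) * x - 0 * y) - x) < d).
        replace (((1 - t) * x - 0 * y) - x) with (- (t * x)) by ring.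
        rewrite Rabs_Ropp, Rabs_mult, (Rabs_pos_eq t) by lra. generalize (cond_pos d) (Rabs_pos x). nra.
      * change (Rabs (((1 - t) * y + 0 * x) - y) < d).
        replace (((1 - t) * y + 0 * x) - y) with (- (t * y)) by ring.
        rewrite Rabs_Ropp, Rabs_mult, (Rabs_pos_eq t) by lra. generalize (cond_pos d) (Rabs_pos y). nra.
    + apply (omega_gamma pr e He). rewrite Cmod_mult, Cmod_R, Rabs_pos_eq by lra.
      generalize (Cmod_ge_0 z). nra.
Qed.

(** If both components of the derivative vanished, each would vary by at most a quarter of the
    guaranteed displacement on a short step, together half of it. *)
Lemma expansive_derive_ne (F : C -> C) (z v : C) (c : R) : 0 < c -> v <> 0 ->
  locally 0 (fun s : R => c * Cmod (s * v) <= Cmod (F (z + s * v) - F z)%C) ->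
  dir_ex_derive (V := CR2) (fun q => Re (F q)) v z -> dir_ex_derive (V := CR2) (fun q => Im (F q)) v z ->
  Cdir_derive (V := CR2) F v z <> 0.
Proof.
  intros Hc Hv [d1 Hloc] D1 D2 E. unfold Cdir_derive in E.
  assert (0 < Cmod v) as Pv by (apply Cmod_gt_0; exact Hv).
  assert (forall s : R, @plus CR2 z (scal s v) = (z + s * v)%C) as EL.
  { intros s. destruct z as [x y], v as [v1 v2]. unfold Cplus, Cmult, RtoC; simpl.
    change (((x + s * v1), (y + s * v2)) = ((x + (s * v1 - 0 * v2)), (y + (s * v2 + 0 * v1)))). f_equal; ring. }
  assert (forall f : C -> R, dir_ex_derive (V := CR2) f v z -> dir_derive (V := CR2) f v z = 0 ->
    exists dl, 0 < dl /\ forall s, Rabs s < dl -> Rabs (f (z + s * v)%C - f z) <= c * Cmod v / 4 * Rabs s) as Small.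
  { intros f Df E0. apply Derive_correct in Df. unfold dir_derive in E0. rewrite E0 in Df.
    destruct (is_derive_small _ 0 0 (c * Cmod v / 4) Df) as [dl [Hdl H]].
    { apply Rdiv_lt_0_compat; [apply Rmult_lt_0_compat; auto|lra]. }
    exists dl. split; [exact Hdl|]. intros s Hs. specialize (H s Hs).
    rewrite Rplus_0_l, Rmult_0_l, Rminus_0_r in H. rewrite !EL in H.
    replace (z + 0 * v)%C with z in H by ring. exact H. }
  destruct (Small (fun q => Re (F q)) D1) as [e1 [He1 S1]]; [exact (f_equal fst E)|].
  destruct (Small (fun q => Im (F q)) D2) as [e2 [He2 S2]]; [exact (f_equal snd E)|].
  set (s := Rmin d1 (Rmin e1 e2) / 2).
  assert (0 < Rmin d1 (Rmin e1 e2)) as Hm by (repeat apply Rmin_pos; auto; apply cond_pos).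
  generalize (Rmin_l d1 (Rmin e1 e2)) (Rmin_r d1 (Rmin e1 e2)) (Rmin_l e1 e2) (Rmin_r e1 e2). intros.
  assert (0 < s) as Ps by (unfold s; lra).
  assert (Rabs s = s) as As by (apply Rabs_pos_eq; lra).
  assert (c * Cmod (s * v) <= Cmod (F (z + s * v) - F z)%C) as L.
  { apply Hloc. change (Rabs (s - 0) < d1). rewrite Rminus_0_r, As. unfold s. lra. }
  rewrite Cmod_mult, Cmod_R, As in L.
  specialize (S1 s ltac:(rewrite As; unfold s; lra)). specialize (S2 s ltac:(rewrite As; unfold s; lra)).
  rewrite As in S1, S2.
  assert (Cmod (F (z + s * v) - F z)%C <= c * Cmod v / 4 * s + c * Cmod v / 4 * s) as U.
  { eapply Rle_trans; [apply Cmod_le_sum|].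
    replace (Re (F (z + s * v) - F z)%C) with (Re (F (z + s * v)%C) - Re (F z)) by (destruct (F (z + s * v)%C), (F z); reflexivity).
    replace (Im (F (z + s * v) - F z)%C) with (Im (F (z + s * v)%C) - Im (F z)) by (destruct (F (z + s * v)%C), (F z); reflexivity).
    lra. }
  assert (0 < c * (s * Cmod v)) by (apply Rmult_lt_0_compat; [exact Hc|apply Rmult_lt_0_compat; [exact Ps|exact Pv]]). lra.
Qed.

Lemma gamma_embedding : smooth_embedding_onto gam (@closure C_UniformSpace Om).
Proof.
  split; [|split].
  - intros z w Hz Hw E. unfold closed_unit_disc in *.
    generalize (gamma_expansive pr e He z w ltac:(lra) ltac:(lra)).
    rewrite E. replace (gam w - gam w)%C with (RtoC 0) by ring. rewrite Cmod_0. intro L.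
    assert (Cmod (z - w) = 0) as Z0 by (generalize (Cmod_ge_0 (z - w)); lra).
    apply Cmod_eq_0 in Z0. replace z with (z - w + w)%C by ring. rewrite Z0. ring.
  - apply gamma_image_closure.
  - exists gam. split.
    + exists disc2. split; [apply disc2_open|]. split; [|split; [|reflexivity]].
      * intros z Hz. split; [exact I|]. apply disc2_Cmod. unfold closed_unit_disc in Hz. lra.
      * apply (gamma_smooth_disc pr e He).
    + intros z v Hz Hv. unfold closed_unit_disc in Hz.
      assert (disc2 z) as Dz by (split; [exact I|apply disc2_Cmod; lra]).
      destruct (gamma_smooth_disc pr e He) as [S1 S2].
      destruct (S1 1%nat) as [_ T1]. destruct (S2 1%nat) as [_ T2].
      apply (expansive_derive_ne gam z v (/ 4)); [lra|exact Hv| |apply T1, Dz|apply T2, Dz].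
      assert (0 < / (Cmod v + 1)) as Hd by (apply Rinv_0_lt_compat; generalize (Cmod_ge_0 v); lra).
      exists (mkposreal _ Hd). intros s Hs. change (Rabs (s - 0) < / (Cmod v + 1)) in Hs.
      rewrite Rminus_0_r in Hs.
      assert (Cmod (s * v) < 1) as B.
      { rewrite Cmod_mult, Cmod_R. generalize (Cmod_ge_0 v) (Rabs_pos s). intros.
        apply (Rmult_lt_compat_r (Cmod v + 1)) in Hs; [|lra]. rewrite Rinv_l in Hs by lra. nra. }
      generalize (gamma_expansive pr e He (z + s * v) z).
      replace (z + s * v - z)%C with (s * v)%C by ring. intro X. apply X; [|lra].
      eapply Rle_lt_trans; [apply Cmod_triangle|]. lra.
Qed.
End DomainRegularity.

(** * Germs of analytic functions of the parameter *)

Lemma ex_pseries_radius (a : nat -> R) (x : R) : 0 < x -> ex_pseries a x -> Rbar_le x (CV_radius a).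
Proof.
  intros Hx H. destruct (Rbar_le_lt_dec x (CV_radius a)) as [L|L]; [exact L|exfalso].
  apply (CV_disk_outside a x).
  - rewrite Rabs_pos_eq by lra. exact L.
  - apply ex_series_lim_0. destruct H as [l H]. exists l. apply is_pseries_R, H.
Qed.

(** One-sided, since the parameter ranges over [0,1]. Convergence strictly beyond [r] leaves room
    for sums and products. *)
Definition right_analytic (h : R -> R) : Prop :=
  exists (a : nat -> R) (r : R), 0 < r /\ Rbar_lt r (CV_radius a) /\
    forall t, 0 <= t < r -> h t = PSeries a t.

Lemma inside_radius (a : nat -> R) (r t : R) : Rbar_lt r (CV_radius a) -> 0 <= t <= r -> Rbar_lt (Rabs t) (CV_radius a).
Proof.
  intros H Ht. apply Rbar_le_lt_trans with (2 := H). simpl. rewrite Rabs_pos_eq; lra.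
Qed.

Lemma right_analytic_ext (f g : R -> R) : (exists r, 0 < r /\ forall t, 0 <= t < r -> f t = g t) ->
  right_analytic f -> right_analytic g.
Proof.
  intros [r [Hr E]] [a [s [Hs [HC H]]]]. exists a, (Rmin r s). split; [apply Rmin_pos; auto|].
  generalize (Rmin_l r s) (Rmin_r r s). intros. split.
  - apply Rbar_le_lt_trans with (2 := HC). simpl. lra.
  - intros t Ht. rewrite <- E by lra. apply H. lra.
Qed.

Lemma right_analytic_const (c : R) : right_analytic (fun _ => c).
Proof.
  set (a := fun n => match n with O => c | S _ => 0 end).
  assert (forall t, is_pseries a t c) as H.
  { intros t. apply is_pseries_R.
    apply (filterlim_ext (fun _ => c)); [|apply filterlim_const].
    intros n. induction n.
    - rewrite sum_O. unfold a. simpl. ring.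
    - rewrite sum_Sn, <- IHn. unfold a, plus; simpl. ring. }
  exists a, 1. split; [lra|]. split.
  - apply Rbar_lt_le_trans with 2; [simpl; lra|]. apply ex_pseries_radius; [lra|]. exists c. apply H.
  - intros t _. symmetry. apply is_pseries_unique, H.
Qed.

Lemma right_analytic_mult (f g : R -> R) : right_analytic f -> right_analytic g ->
  right_analytic (fun t => f t * g t).
Proof.
  intros [a [r [Hr [HC H]]]] [c [s [Hs [HD K]]]].
  set (m := Rmin r s). assert (0 < m) as Hm by (apply Rmin_pos; auto).
  generalize (Rmin_l r s) (Rmin_r r s). fold m. intros.
  exists (PS_mult a c), (m / 2). split; [lra|]. split.
  - apply Rbar_lt_le_trans with m; [simpl; lra|]. apply ex_pseries_radius; [lra|].
    apply ex_pseries_mult; eapply inside_radius; eauto; lra.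
  - intros t Ht. rewrite PSeries_mult.
    + rewrite H, K; lra.
    + eapply inside_radius; eauto; lra.
    + eapply inside_radius; eauto; lra.
Qed.

Lemma right_analytic_plus (f g : R -> R) : right_analytic f -> right_analytic g ->
  right_analytic (fun t => f t + g t).
Proof.
  intros [a [r [Hr [HC H]]]] [c [s [Hs [HD K]]]].
  set (m := Rmin r s). assert (0 < m) as Hm by (apply Rmin_pos; auto).
  generalize (Rmin_l r s) (Rmin_r r s). fold m. intros.
  assert (forall t, 0 <= t <= m -> ex_pseries a t /\ ex_pseries c t) as EX.
  { intros t Ht. split; apply CV_radius_inside; eapply inside_radius; eauto; lra. }
  exists (PS_plus a c), (m / 2). split; [lra|]. split.
  - apply Rbar_lt_le_trans with m; [simpl; lra|]. apply ex_pseries_radius; [lra|].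
    apply ex_pseries_plus; apply EX; lra.
  - intros t Ht. destruct (EX t ltac:(lra)). rewrite PSeries_plus by auto. rewrite H, K; lra.
Qed.

Lemma right_analytic_minus (f g : R -> R) : right_analytic f -> right_analytic g ->
  right_analytic (fun t => f t - g t).
Proof.
  intros F K. apply (right_analytic_ext (fun t => f t + -1 * g t)).
  - exists 1. split; [lra|]. intros; ring.
  - apply right_analytic_plus; [exact F|]. apply right_analytic_mult; [apply right_analytic_const|exact K].
Qed.

Definition flat_at_0 (f : R -> R) : Prop :=
  forall m : nat, exists K r, 0 < r /\ forall t, 0 < t < r -> Rabs (f t) <= K * t ^ m.

(** Continuity kills the constant term. Dividing by t then shifts the coefficients and preserves
    flatness, which gives the induction. *)
Lemma flat_coefficients (n : nat) (a : nat -> R) : Rbar_lt 0 (CV_radius a) -> flat_at_0 (PSeries a) -> a n = 0.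
Proof.
  assert (forall a, Rbar_lt 0 (CV_radius a) -> flat_at_0 (PSeries a) -> a O = 0) as H0.
  { clear. intros a HC F. rewrite <- (PSeries_0 a). apply NNPP. intro N.
    assert (continuity_pt (PSeries a) 0) as C by (apply PSeries_continuity; rewrite Rabs_R0; exact HC).
    assert (0 < Rabs (PSeries a 0)) as P by (apply Rabs_pos_lt; exact N).
    destruct (C (Rabs (PSeries a 0) / 2)) as [d [Hd H]]; [lra|].
    destruct (F 1%nat) as [K [r [Hr FK]]].
    set (K' := Rabs K + 1). assert (0 < K') by (unfold K'; generalize (Rabs_pos K); lra).
    set (q := Rabs (PSeries a 0) / 2 / K'). assert (0 < q) by (repeat apply Rdiv_lt_0_compat; lra).
    set (t := Rmin (Rmin d r) q / 2).
    generalize (Rmin_l (Rmin d r) q) (Rmin_r (Rmin d r) q) (Rmin_l d r) (Rmin_r d r). intros.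
    assert (0 < Rmin (Rmin d r) q) by (apply Rmin_pos; [apply Rmin_pos; auto|auto]).
    assert (0 < t) by (unfold t; lra).
    specialize (FK t ltac:(unfold t; lra)). simpl in FK. rewrite Rmult_1_r in FK.
    assert (Rabs (PSeries a t - PSeries a 0) < Rabs (PSeries a 0) / 2) as D.
    { apply H. split; [split; [exact I|lra]|]. simpl. unfold R_dist. rewrite Rminus_0_r, Rabs_pos_eq; unfold t; lra. }
    assert (K * t < K' * q).
    { apply Rle_lt_trans with (K' * t); [apply Rmult_le_compat_r; [lra|]; unfold K'; generalize (Rle_abs K); lra|].
      apply Rmult_lt_compat_l; [auto|]. unfold t; lra. }
    assert (K' * q = Rabs (PSeries a 0) / 2) by (unfold q; field; lra).
    generalize (Rabs_triang_inv (PSeries a 0) (PSeries a t)). rewrite Rabs_minus_sym. lra. }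
  revert a. induction n; intros a HC F; [auto|].
  change (PS_decr_1 a n = 0). apply IHn.
  - rewrite CV_radius_decr_1. exact HC.
  - intros m. destruct (F (S m)) as [K [r [Hr FK]]]. exists K, r. split; [exact Hr|].
    intros t Ht. specialize (FK t Ht). rewrite PSeries_decr_1_aux in FK by auto.
    rewrite Rabs_mult, (Rabs_pos_eq t) in FK by lra. simpl in FK.
    apply Rmult_le_reg_l with t; [lra|]. lra.
Qed.

Lemma right_analytic_flat (h : R -> R) : right_analytic h -> flat_at_0 h ->
  exists r, 0 < r /\ forall t, 0 <= t < r -> h t = 0.
Proof.
  intros [a [r [Hr [HC H]]]] F. exists r. split; [exact Hr|]. intros t Ht. rewrite H by exact Ht.
  assert (forall n, a n = 0) as Z.
  { intros n. apply flat_coefficients.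
    - apply Rbar_lt_trans with r; [exact Hr|exact HC].
    - intros m. destruct (F m) as [K [s [Hs FK]]]. exists K, (Rmin r s). split; [apply Rmin_pos; auto|].
      generalize (Rmin_l r s) (Rmin_r r s). intros. rewrite <- H by lra. apply FK. lra. }
  rewrite (PSeries_ext _ (fun _ => 0)) by exact Z. apply PSeries_const_0.
Qed.

Definition Cright_analytic (h : R -> C) : Prop :=
  right_analytic (fun t => Re (h t)) /\ right_analytic (fun t => Im (h t)).

Lemma Cright_analytic_const (c : C) : Cright_analytic (fun _ => c).
Proof. split; apply right_analytic_const. Qed.

Lemma Cright_analytic_minus (f g : R -> C) : Cright_analytic f -> Cright_analytic g ->
  Cright_analytic (fun t => f t - g t)%C.
Proof.
  intros [F1 F2] [G1 G2]. split.
  - apply (right_analytic_minus _ _ F1 G1).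
  - apply (right_analytic_minus _ _ F2 G2).
Qed.

Lemma Cright_analytic_mult (f g : R -> C) : Cright_analytic f -> Cright_analytic g ->
  Cright_analytic (fun t => f t * g t)%C.
Proof.
  intros [F1 F2] [G1 G2]. split; simpl.
  - apply right_analytic_minus; apply right_analytic_mult; auto.
  - apply right_analytic_plus; apply right_analytic_mult; auto.
Qed.

Lemma Cright_analytic_flat (h : R -> C) : Cright_analytic h -> flat_at_0 (fun t => Cmod (h t)) ->
  exists r, 0 < r /\ forall t, 0 <= t < r -> h t = 0.
Proof.
  intros [A1 A2] F.
  assert (forall p : C -> R, (forall z, Rabs (p z) <= Cmod z) -> flat_at_0 (fun t => p (h t))) as Q.
  { intros p Hp m. destruct (F m) as [K [r [Hr FK]]]. exists K, r. split; [exact Hr|].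
    intros t Ht. eapply Rle_trans; [apply Hp|]. specialize (FK t Ht).
    rewrite Rabs_pos_eq in FK by apply Cmod_ge_0. exact FK. }
  destruct (right_analytic_flat _ A1 (Q Re re_le_Cmod)) as [r1 [Hr1 Z1]].
  destruct (right_analytic_flat _ A2 (Q Im im_le_Cmod)) as [r2 [Hr2 Z2]].
  exists (Rmin r1 r2). split; [apply Rmin_pos; auto|]. intros t Ht.
  generalize (Rmin_l r1 r2) (Rmin_r r1 r2). intros.
  apply injective_projections; [apply Z1; lra|apply Z2; lra].
Qed.

Lemma sum_n_stationary {V : AbelianMonoid} (b : nat -> V) (N n : nat) :
  (forall k, (N < k)%nat -> b k = zero) -> (N <= n)%nat -> sum_n b n = sum_n b N.
Proof.
  intros H. induction n; intros Hn.
  - replace N with O by lia. reflexivity.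
  - destruct (Nat.eq_dec N (S n)) as [->|Ne]; [reflexivity|].
    rewrite sum_Sn, H, plus_zero_r by lia. apply IHn. lia.
Qed.

Lemma cube_sum_axis {V : AbelianMonoid} (b : nat -> nat -> nat -> V) (n : nat) :
  (forall i j k, (0 < i)%nat \/ (0 < j)%nat -> b i j k = zero) ->
  cube_sum n b = sum_n (fun k => b O O k) n.
Proof.
  intros H. unfold cube_sum.
  assert (forall c : nat -> V, (forall k, c k = zero) -> sum_n c n = zero) as Z.
  { intros c Hc. rewrite (sum_n_stationary c O) by (auto; lia). rewrite sum_O. auto. }
  rewrite (sum_n_stationary _ O n); [rewrite sum_O|intros k Hk; apply Z; intros; apply Z; intros; apply H; lia|lia].
  rewrite (sum_n_stationary _ O n); [rewrite sum_O; reflexivity|intros k Hk; apply Z; intros; apply H; lia|lia].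
Qed.

Lemma Re_sum_n (c : nat -> C) (n : nat) : Re (sum_n (G := C_AbelianMonoid) c n) = sum_n (fun k => Re (c k)) n.
Proof. induction n; [rewrite !sum_O; reflexivity|]. rewrite !sum_Sn, <- IHn. reflexivity. Qed.

Lemma Im_sum_n (c : nat -> C) (n : nat) : Im (sum_n (G := C_AbelianMonoid) c n) = sum_n (fun k => Im (c k)) n.
Proof. induction n; [rewrite !sum_O; reflexivity|]. rewrite !sum_Sn, <- IHn. reflexivity. Qed.

Lemma right_analytic_pseries (a : nat -> R) (h : R -> R) (r : R) : 0 < r ->
  (forall t, 0 <= t < r -> is_series (fun k => a k * t ^ k) (h t)) -> right_analytic h.
Proof.
  intros Hr H. exists a, (r / 4). split; [lra|]. split.
  - apply Rbar_lt_le_trans with (r / 2); [simpl; lra|]. apply ex_pseries_radius; [lra|].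
    exists (h (r / 2)). apply is_pseries_R, H. lra.
  - intros t Ht. symmetry. apply is_pseries_unique, is_pseries_R, H. lra.
Qed.

(** Along the vertical line the increments x and y are 0; as [0 ^ 0 = 1], exactly the terms with i =
    j = 0 survive, and the triple series is a power series in t. *)
Lemma real_analytic_on_vertical (U : C * R -> Prop) (F : C * R -> C) (z : C) :
  real_analytic_on U F -> U (z, 0) -> Cright_analytic (fun t => F (z, t)).
Proof.
  intros H Hz. destruct z as [z1 z2]. destruct (H ((z1, z2) : C, 0) Hz) as [a [r [Hr Ha]]].
  assert (forall t, 0 <= t < r -> filterlim (fun n => sum_n (G := C_AbelianMonoid)
    (fun k => (a O O k * RtoC (t ^ k))%C) n) eventually (locally (T := C_UniformSpace) (F ((z1, z2), t)))) as L.
  { intros t Ht. destruct (Ha 0 0 t) as [_ L]; [rewrite Rabs_R0; lra|rewrite Rabs_R0; lra|rewrite Rabs_pos_eq; lra|].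
    simpl in L. rewrite !Rplus_0_r, Rplus_0_l in L.
    revert L. apply filterlim_ext. intros n. rewrite cube_sum_axis.
    - apply sum_n_ext. intros k. unfold monomial. simpl. replace (1 * 1 * t ^ k) with (t ^ k) by ring. reflexivity.
    - intros i j k Hij. unfold monomial. change (@zero C_AbelianMonoid) with (RtoC 0).
      replace (0 ^ i * 0 ^ j * t ^ k) with 0; [apply Cmult_0_r|].
      destruct Hij as [Hi|Hj]; [destruct i; [lia|]|destruct j; [lia|]]; simpl; ring. }
  split.
  - apply (right_analytic_pseries (fun k => Re (a O O k)) _ r Hr). intros t Ht.
    assert (@continuous C_UniformSpace R_UniformSpace (fun z : C => Re z) (F ((z1, z2), t))) as CP by apply continuous_fst.
    generalize (filterlim_comp _ _ _ _ (fun z : C => Re z) _ _ (locally (Re (F ((z1, z2), t)))) (L t Ht) CP).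
    apply filterlim_ext. intros n. rewrite Re_sum_n. apply sum_n_ext. intros k.
    destruct (a O O k). simpl. ring.
  - apply (right_analytic_pseries (fun k => Im (a O O k)) _ r Hr). intros t Ht.
    assert (@continuous C_UniformSpace R_UniformSpace (fun z : C => Im z) (F ((z1, z2), t))) as CP by apply continuous_snd.
    generalize (filterlim_comp _ _ _ _ (fun z : C => Im z) _ _ (locally (Im (F ((z1, z2), t)))) (L t Ht) CP).
    apply filterlim_ext. intros n. rewrite Im_sum_n. apply sum_n_ext. intros k.
    destruct (a O O k). simpl. ring.
Qed.

Lemma cube_sum_small {V : AbelianMonoid} (b : nat -> nat -> nat -> V) (n : nat) :
  (forall i j k, (1 < i)%nat \/ (1 < j)%nat \/ (0 < k)%nat -> b i j k = zero) -> (1 <= n)%nat ->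
  cube_sum n b = plus (plus (b O O O) (b O 1%nat O)) (plus (b 1%nat O O) (b 1%nat 1%nat O)).
Proof.
  intros H Hn. unfold cube_sum.
  assert (forall c : nat -> V, (forall k, c k = zero) -> sum_n c n = zero) as Z.
  { intros c Hc. rewrite (sum_n_stationary c O) by (auto; lia). rewrite sum_O. auto. }
  rewrite (sum_n_stationary _ 1 n); [rewrite sum_Sn, sum_O|intros k Hk; apply Z; intros; apply Z; intros; apply H; lia|lia].
  rewrite !(sum_n_stationary (fun j => sum_n (fun k => b _ j k) n) 1 n) by
    first [lia | intros k Hk; apply Z; intros; apply H; lia].
  rewrite !sum_Sn, !sum_O.
  rewrite !(sum_n_stationary (fun k => b _ _ k) O n) by first [lia | intros k Hk; apply H; lia].
  rewrite !sum_O. reflexivity.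
Qed.

(** For every [lambda] the parametrization is the identity near z = 1, so its analyticity at (1,0)
    is that of the projection, with the expansion z0 + x + i y. *)
Lemma real_analytic_fst (U : C * R -> Prop) : real_analytic_on U fst.
Proof.
  intros [z0 t0] _.
  set (a := fun i j k : nat => match i, j, k with
    | O, O, O => z0 | S O, O, O => RtoC 1 | O, S O, O => Ci | _, _, _ => RtoC 0 end).
  exists a, 1. split; [lra|]. intros x y t _ _ _.
  assert (forall i j k, (1 < i)%nat \/ (1 < j)%nat \/ (0 < k)%nat -> monomial a x y t i j k = RtoC 0) as Z.
  { intros i j k Hijk. unfold monomial. replace (a i j k) with (RtoC 0); [ring|].
    unfold a. destruct i as [|[|i]], j as [|[|j]], k; try reflexivity; lia. }
  split.
  - set (c := fun i j k => Cmod (monomial a x y t i j k)).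
    exists (plus (plus (c O O O) (c O 1%nat O)) (plus (c 1%nat O O) (c 1%nat 1%nat O))). intros n.
    assert (forall i j k, 0 <= c i j k) as P by (intros; apply Cmod_ge_0).
    destruct n as [|n].
    + unfold cube_sum. rewrite !sum_O. unfold plus; simpl.
      generalize (P O O O) (P O 1%nat O) (P 1%nat O O) (P 1%nat 1%nat O). unfold c. lra.
    + right. apply cube_sum_small; [|lia]. intros i j k Hijk. unfold c. rewrite Z by exact Hijk. apply Cmod_0.
  - apply (filterlim_ext_loc (fun _ => (Re z0 + x, Im z0 + y) : C)).
    + exists 1%nat. intros n Hn. rewrite cube_sum_small; [|exact Z|exact Hn].
      unfold plus; simpl. unfold monomial, a, Ci. destruct z0 as [u v].
      unfold Cplus, Cmult, RtoC; simpl. f_equal; ring.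
    + apply filterlim_const.
Qed.

(** * Riemann mappings and cross ratios *)

Section Riemann.
Context {k1 k2 eta : R -> R} {G : C -> C} (pr : profile k1 k2 eta G).
Variable e : R.
Hypothesis He : 0 <= e <= 1.

Local Notation b := (graph_fun k1 k2 e).
Local Notation Om := (omega k1 k2 e).

(** The map F of the overview, with c absorbed in [G]. As [G] is Lipschitz on the whole plane,
    [flow] is bijective there, and its inverse is defined without reference to the half-plane. *)
Definition flow (Z : C) : C := (Z + push e G Z)%C.
Definition unflow (W : C) : C := epsilon (inhabits (RtoC 0)) (fun Z : C => flow Z = W).

Lemma push_G_lip (z w : C) : Cmod (push e G w - push e G z) <= / 2 * Cmod (w - z).
Proof. apply push_lip; [exact He|apply (pr_G_lip pr)]. Qed.

Lemma flow_unflow (W : C) : flow (unflow W) = W.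
Proof.
  apply (epsilon_spec (inhabits (RtoC 0)) (fun Z : C => flow Z = W)).
  apply (contraction_surjective (push e G) push_G_lip).
Qed.

Lemma flow_expansive (z w : C) : / 2 * Cmod (w - z) <= Cmod (flow w - flow z).
Proof. apply (perturbed_id_expansive (push e G) push_G_lip). Qed.

Lemma flow_inj (z w : C) : flow z = flow w -> z = w.
Proof. apply (perturbed_id_inj (push e G) push_G_lip). Qed.

Lemma unflow_flow (Z : C) : unflow (flow Z) = Z.
Proof. apply flow_inj, flow_unflow. Qed.

Lemma flow_cderiv (Z : C) : upper Z -> exists d : C, d <> 0 /\ cderiv flow Z d.
Proof.
  intros H. destruct (pr_G_holo pr Z H) as [d Hd].
  assert (cderiv flow Z (1 + e * d)%C) as D.
  { apply cderiv_plus; [apply cderiv_id|]. apply cderiv_scal, Hd. }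
  (* With derivative 0 a short step would be mapped to at most a quarter of its length, against
     [flow_expansive]. *)
  exists (1 + e * d)%C. split; [|exact D]. intro E. rewrite E in D.
  destruct (D (/ 4)) as [dl [Hdl H1]]; [lra|].
  specialize (H1 (Z + (dl / 2)%R)%C). replace (Z + (dl / 2)%R - Z)%C with (RtoC (dl / 2)) in H1 by ring.
  rewrite Cmod_R, Rabs_pos_eq in H1 by lra. specialize (H1 ltac:(lra)).
  generalize (flow_expansive Z (Z + (dl / 2)%R)%C).
  replace (Z + (dl / 2)%R - Z)%C with (RtoC (dl / 2)) by ring.
  rewrite Cmod_R, Rabs_pos_eq by lra.
  replace (flow (Z + (dl / 2)%R) - flow Z - 0 * (dl / 2)%R)%C with (flow (Z + (dl / 2)%R) - flow Z)%C in H1 by ring. lra.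
Qed.

Lemma unflow_ccont (W : C) : ccont unflow W.
Proof.
  intros r Hr. exists (r / 2). split; [lra|]. intros V HV.
  generalize (flow_expansive (unflow W) (unflow V)). rewrite !flow_unflow. lra.
Qed.

Lemma unflow_cderiv (W : C) : upper (unflow W) -> exists d, cderiv unflow W d.
Proof.
  intros H. destruct (flow_cderiv _ H) as [d [Nd Hd]]. exists (/ d)%C.
  apply (cderiv_inverse flow unflow W d 1); [lra|intros; apply flow_unflow|apply unflow_ccont|exact Nd|exact Hd].
Qed.

Lemma flow_plus_i_ne (Z : C) : upper Z -> (flow Z + Ci)%C <> 0.
Proof.
  intros HZ E. generalize (push_bd e He G (pr_G_bd pr) Z) (im_le_Cmod (push e G Z)).
  unfold upper, flow in *. apply (f_equal Im) in E. destruct Z as [x y], (push e G (x, y)) as [u v]. simpl in *. intros A B.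
  assert (Rabs v <= / 2) as D by lra. apply Rabs_le_between in D. lra.
Qed.

Lemma flow_omega (Z : C) : upper Z -> Om (icay (flow Z)).
Proof.
  intros H. generalize (flow_plus_i_ne Z H). intro N. split; [apply icay_ne, N|].
  change (b (Re (cay (icay (flow Z)))) < Im (cay (icay (flow Z)))). rewrite cay_icay by exact N.
  apply (G_sides pr e He Z). exact H.
Qed.

Lemma unflow_omega (p : C) : Om p -> upper (unflow (cay p)).
Proof.
  intros [N H]. apply (G_sides pr e He). fold (flow (unflow (cay p))). rewrite flow_unflow. exact H.
Qed.

Lemma upper_cay (z : C) : Cmod z < 1 -> upper (cay z) /\ z <> 1.
Proof.
  intros H. assert (z <> 1) as N by (intros ->; rewrite Cmod_1 in H; lra).
  split; [|exact N]. apply (proj2 (cayY_pos_iff z N) H).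
Qed.

Lemma icay_disc (Z : C) : upper Z -> Cmod (icay Z) < 1.
Proof.
  intros H. assert ((Z + Ci)%C <> 0) as N by (apply upper_plus_i_ne; left; exact H).
  apply cayY_pos_iff; [apply icay_ne, N|]. change (0 < Im (cay (icay Z))). rewrite cay_icay by exact N. exact H.
Qed.

Lemma cay_cderiv (z : C) : z <> 1 -> exists d, cderiv cay z d.
Proof.
  intros H. eexists. assert (0 < Cmod (z - 1)) as P.
  { apply Cmod_gt_0. intro E. apply H. replace z with (z - 1 + 1)%C by ring. rewrite E. ring. }
  apply (cderiv_ext_loc (fun z => (Ci * z + Ci) / (- (1) * z + 1))%C) with (r := Cmod (z - 1)); [exact P| |].
  - intros w Hw. symmetry. apply cay_fraction. intros ->. rewrite Cmod_sub_sym in Hw. lra.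
  - apply cderiv_mobius. replace (- (1) * z + 1)%C with (1 - z)%C by ring. apply one_sub_ne, H.
Qed.

Lemma icay_cderiv (W : C) : (W + Ci)%C <> 0 -> exists d, cderiv icay W d.
Proof. intros H. eexists. apply cderiv_mobius. rewrite Cmult_1_l. exact H. Qed.

(** Conjugated by the Cayley transform, [f] after [flow] is an automorphism of the disc, whose
    inverse is built from [unflow] and the inverse of [f]. The last two clauses bound the
    differences of values and keep them from vanishing. *)
Lemma riemann_mobius (f : C -> C) : riemann_mapping Om f ->
  mobius_like upper (fun Z => f (icay (flow Z))) /\
  (forall Z, upper Z -> Cmod (f (icay (flow Z))) < 1) /\
  (forall Z Z', upper Z -> upper Z' -> f (icay (flow Z)) = f (icay (flow Z')) -> Z = Z').
Proof.
  intros [[Hf [g [[I1 I2] Hg]]] _].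
  assert (forall Z Z', upper Z -> upper Z' -> f (icay (flow Z)) = f (icay (flow Z')) -> Z = Z') as Inj.
  { intros Z Z' HZ HZ' E. apply flow_inj.
    rewrite <- (cay_icay (flow Z)), <- (cay_icay (flow Z')) by (apply flow_plus_i_ne; auto). f_equal.
    rewrite <- (proj2 (I1 _ (flow_omega Z HZ))), E. apply I1, flow_omega, HZ'. }
  split; [|split; [intros Z HZ; apply I1, flow_omega, HZ|exact Inj]].
  set (A := fun z => f (icay (flow (cay z)))). set (B := fun w => icay (unflow (cay (g w)))).
  assert (mobius_like (fun z => Cmod z < 1) A) as MA.
  { apply (automorphism_mobius A B).
    - intros z Hz. destruct (upper_cay z Hz) as [U N].
      destruct (cay_cderiv z N) as [d1 D1]. destruct (flow_cderiv _ U) as [d2 [_ D2]].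
      destruct (icay_cderiv _ (flow_plus_i_ne _ U)) as [d3 D3].
      destruct (proj1 (ex_derive_cderiv f _) (Hf _ (flow_omega _ U))) as [d4 D4].
      exists (d4 * (d3 * (d2 * d1)))%C.
      apply (cderiv_comp f (fun z => icay (flow (cay z)))); [|exact D4].
      apply (cderiv_comp icay (fun z => flow (cay z))); [|exact D3].
      apply (cderiv_comp flow cay); auto.
    - intros w Hw. destruct (I2 w Hw) as [Hgw _]. generalize (unflow_omega _ Hgw). intro U.
      destruct (proj1 (ex_derive_cderiv g _) (Hg w Hw)) as [d1 D1].
      destruct (cay_cderiv (g w) (proj1 Hgw)) as [d2 D2].
      destruct (unflow_cderiv _ U) as [d3 D3].
      destruct (icay_cderiv (unflow (cay (g w)))) as [d4 D4]; [apply upper_plus_i_ne; left; exact U|].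
      exists (d4 * (d3 * (d2 * d1)))%C.
      apply (cderiv_comp icay (fun w => unflow (cay (g w)))); [|exact D4].
      apply (cderiv_comp unflow (fun w => cay (g w))); [|exact D3].
      apply (cderiv_comp cay g); auto.
    - intros z Hz. destruct (upper_cay z Hz) as [U N]. destruct (I1 _ (flow_omega _ U)) as [D E].
      split; [exact D|]. unfold B, A. rewrite E, cay_icay by (apply flow_plus_i_ne, U).
      rewrite unflow_flow. apply icay_cay, N.
    - intros w Hw. apply icay_disc, unflow_omega. apply I2, Hw. }
  apply (mobius_like_ext upper (fun Z => A (icay Z))).
  - intros Z HZ. unfold A. rewrite cay_icay; [reflexivity|]. apply upper_plus_i_ne. left. exact HZ.
  - apply (mobius_like_comp upper (fun z => Cmod z < 1)); [exact MA| |apply icay_disc].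
    apply mobius_like_fraction. intros Z HZ. rewrite Cmult_1_l. apply upper_plus_i_ne. left. exact HZ.
Qed.

(** Near infinity the half-plane and the region above the graph coincide, so points there are
    genuine images of upper points under [flow]. *)
Lemma unflow_near_1 (Z : C) : upper Z -> sq1 (icay Z) < / 2 -> upper (unflow Z).
Proof.
  intros HZ H. assert ((Z + Ci)%C <> 0) as N by (apply upper_plus_i_ne; left; exact HZ).
  rewrite <- (cay_icay Z N). apply unflow_omega. apply (omega_near_1 pr e He _ H). apply icay_disc, HZ.
Qed.

Lemma unflow_close (Z : C) : Cmod (Z - unflow Z) <= e / 4.
Proof.
  rewrite <- (flow_unflow Z) at 1. unfold flow.
  replace (unflow Z + push e G (unflow Z) - unflow Z)%C with (push e G (unflow Z)) by ring.
  unfold push. rewrite Cmod_mult, Cmod_R, Rabs_pos_eq by lra.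
  generalize (pr_G_bd pr (unflow Z)). nra.
Qed.

Definition slope (z w : C) : C := ((G z - G w) / (z - w))%C.

Lemma sub_ne (z w : C) : z <> w -> (z - w)%C <> 0.
Proof. intros N E. apply N. replace z with (z - w + w)%C by ring. rewrite E. ring. Qed.

Lemma slope_bound (z w : C) : z <> w -> Cmod (slope z w) <= / 4.
Proof.
  intros N. assert (0 < Cmod (z - w)) as P by (apply Cmod_gt_0, sub_ne, N).
  unfold slope. rewrite Cmod_div by (apply sub_ne, N).
  apply Rmult_le_reg_r with (Cmod (z - w)); [exact P|]. unfold Rdiv. rewrite Rmult_assoc, Rinv_l, Rmult_1_r by lra.
  apply (pr_G_lip pr).
Qed.

Lemma flow_diff (z w : C) : z <> w -> (flow z - flow w = (z - w) * (1 + e * slope z w))%C.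
Proof. intros N. unfold flow, push, slope. field. apply sub_ne, N. Qed.

(** Equality of the cross ratios of the [f] and of the [z], with denominators cleared: a polynomial
    in the [f], hence analytic in [lambda] whenever they are. *)
Definition cross_defect (f1 f2 f3 f4 z1 z2 z3 z4 : C) : C :=
  ((f1 - f2) * (f3 - f4) * ((z1 - z3) * (z2 - z4)) - (f1 - f3) * (f2 - f4) * ((z1 - z2) * (z3 - z4)))%C.

(** The factors [d] and [h] of [A] cancel, so its values have the cross ratio of the [w]; [flow]
    multiplies each difference by [1 + e * slope], and the constant terms cancel, leaving a factor
    [e]. *)
Lemma cross_defect_flow (A : C -> C) (w1 w2 w3 w4 : C) : mobius_like upper A ->
  upper w1 -> upper w2 -> upper w3 -> upper w4 ->
  w1 <> w2 -> w1 <> w3 -> w2 <> w4 -> w3 <> w4 ->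
  cross_defect (A w1) (A w2) (A w3) (A w4) (flow w1) (flow w2) (flow w3) (flow w4) =
  ((A w1 - A w3) * (A w2 - A w4) * ((w1 - w2) * (w3 - w4)) *
   (e * (slope w1 w3 + slope w2 w4 - slope w1 w2 - slope w3 w4
         + e * (slope w1 w3 * slope w2 w4 - slope w1 w2 * slope w3 w4))))%C.
Proof.
  intros [d [h M]] U1 U2 U3 U4 N12 N13 N24 N34. unfold cross_defect.
  rewrite !flow_diff by auto. rewrite (M w1 w2), (M w3 w4), (M w1 w3), (M w2 w4) by auto. ring.
Qed.
End Riemann.
Arguments flow : clear implicits.
Arguments unflow : clear implicits.
Arguments slope : clear implicits.

(** * The cross ratio defect at four points near infinity *)

Section CrossRatio.
Context {k1 k2 eta : R -> R} {G : C -> C} (pr : profile k1 k2 eta G).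
Variable e : R.
Hypothesis He : 0 <= e <= 1.
Variable f : C -> C.
Hypothesis Hf : riemann_mapping (omega k1 k2 e) f.
Variables z1 z2 z3 z4 : C.
Hypothesis U1 : upper z1. Hypothesis U2 : upper z2. Hypothesis U3 : upper z3. Hypothesis U4 : upper z4.
Hypothesis S1 : sq1 (icay z1) < / 2. Hypothesis S2 : sq1 (icay z2) < / 2.
Hypothesis S3 : sq1 (icay z3) < / 2. Hypothesis S4 : sq1 (icay z4) < / 2.
Hypothesis N12 : z1 <> z2. Hypothesis N13 : z1 <> z3.
Hypothesis N24 : z2 <> z4. Hypothesis N34 : z3 <> z4.

Local Notation w z := (unflow G e z).
Local Notation Phi z := (f (icay z)).
Local Notation sl z z' := (slope G (w z) (w z')).

Lemma unflow_ne (z z' : C) : z <> z' -> w z <> w z'.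
Proof.
  intros N E. apply N. rewrite <- (flow_unflow pr e He z), <- (flow_unflow pr e He z'), E. reflexivity.
Qed.

Lemma unflow_contract (z z' : C) : Cmod (w z - w z') <= 2 * Cmod (z - z').
Proof.
  generalize (flow_expansive pr e He (w z') (w z)). rewrite !(flow_unflow pr e He). lra.
Qed.

Definition slope_defect : C :=
  (sl z1 z3 + sl z2 z4 - sl z1 z2 - sl z3 z4 + e * (sl z1 z3 * sl z2 z4 - sl z1 z2 * sl z3 z4))%C.

(** The bound on [F] makes the defect as small as [e]; its nonvanishing lets a zero defect be
    divided down to a relation between slopes. *)
Lemma cross_defect_factor : exists F : C, F <> 0 /\ Cmod F <= 16 * (Cmod (z1 - z2) * Cmod (z3 - z4)) /\
  cross_defect (Phi z1) (Phi z2) (Phi z3) (Phi z4) z1 z2 z3 z4 = (F * (e * slope_defect))%C.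
Proof.
  destruct (riemann_mobius pr e He f Hf) as [M [B I]].
  set (A := fun Z => f (icay (flow G e Z))) in *.
  assert (forall z, Phi z = A (w z)) as EA.
  { intros z. unfold A. rewrite (flow_unflow pr e He). reflexivity. }
  assert (forall z, upper z -> sq1 (icay z) < / 2 -> upper (w z)) as UW.
  { intros z Uz Sz. apply (unflow_near_1 pr e He); auto. }
  exists ((A (w z1) - A (w z3)) * (A (w z2) - A (w z4)) * ((w z1 - w z2) * (w z3 - w z4)))%C.
  split; [|split].
  - repeat apply Cmult_neq_0; apply sub_ne; try (apply unflow_ne; auto).
    + intro E. apply I in E; auto. revert E. apply unflow_ne; auto.
    + intro E. apply I in E; auto. revert E. apply unflow_ne; auto.
  - rewrite !Cmod_mult.
    assert (forall z z', upper z -> upper z' -> sq1 (icay z) < / 2 -> sq1 (icay z') < / 2 ->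
      Cmod (A (w z) - A (w z')) <= 2) as D.
    { intros z z' Uz Uz' Sz Sz'. eapply Rle_trans; [apply Cmod_sub_le|].
      generalize (B (w z) (UW z Uz Sz)) (B (w z') (UW z' Uz' Sz')). unfold A. lra. }
    generalize (D z1 z3 U1 U3 S1 S3) (D z2 z4 U2 U4 S2 S4) (unflow_contract z1 z2) (unflow_contract z3 z4). intros D1 D2 C1 C2.
    (* Two values in the unit disc differ by at most 2, and [unflow] is 2-Lipschitz. *)
    apply Rle_trans with (2 * 2 * (2 * Cmod (z1 - z2) * (2 * Cmod (z3 - z4)))); [|right; ring].
    apply Rmult_le_compat.
    + apply Rmult_le_pos; apply Cmod_ge_0.
    + apply Rmult_le_pos; apply Cmod_ge_0.
    + apply Rmult_le_compat; try apply Cmod_ge_0; auto.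
    + apply Rmult_le_compat; try apply Cmod_ge_0; auto.
  - rewrite !EA.
    generalize (cross_defect_flow (G := G) e A (w z1) (w z2) (w z3) (w z4) M (UW _ U1 S1) (UW _ U2 S2) (UW _ U3 S3) (UW _ U4 S4)
      (unflow_ne _ _ N12) (unflow_ne _ _ N13) (unflow_ne _ _ N24) (unflow_ne _ _ N34)).
    rewrite !(flow_unflow pr e He). intros ->. reflexivity.
Qed.

Lemma slope_products_bound : Cmod (sl z1 z3 * sl z2 z4 - sl z1 z2 * sl z3 z4) <= / 8.
Proof.
  eapply Rle_trans; [apply Cmod_sub_le|]. rewrite !Cmod_mult.
  assert (forall z z', z <> z' -> 0 <= Cmod (sl z z') <= / 4) as S.
  { intros z z' N. split; [apply Cmod_ge_0|]. apply (slope_bound pr). apply unflow_ne, N. }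
  generalize (S _ _ N13) (S _ _ N24) (S _ _ N12) (S _ _ N34). intros A1 A2 A3 A4.
  assert (Cmod (sl z1 z3) * Cmod (sl z2 z4) <= / 4 * / 4) by (apply Rmult_le_compat; lra).
  assert (Cmod (sl z1 z2) * Cmod (sl z3 z4) <= / 4 * / 4) by (apply Rmult_le_compat; lra). lra.
Qed.

Lemma cross_defect_small :
  Cmod (cross_defect (Phi z1) (Phi z2) (Phi z3) (Phi z4) z1 z2 z3 z4) <= 32 * (Cmod (z1 - z2) * Cmod (z3 - z4)) * e.
Proof.
  destruct cross_defect_factor as [F [_ [BF ->]]].
  rewrite !Cmod_mult, Cmod_R, Rabs_pos_eq by lra.
  assert (Cmod slope_defect <= 2) as BD.
  { unfold slope_defect. eapply Rle_trans; [apply Cmod_triangle|]. rewrite Cmod_mult, Cmod_R, Rabs_pos_eq by lra.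
    generalize slope_products_bound. intro P.
    assert (forall z z', z <> z' -> Cmod (sl z z') <= / 4) as S.
    { intros z z' N. apply (slope_bound pr). apply unflow_ne, N. }
    generalize (S _ _ N13) (S _ _ N24) (S _ _ N12) (S _ _ N34). intros.
    assert (Cmod (sl z1 z3 + sl z2 z4 - sl z1 z2 - sl z3 z4) <= 1).
    { eapply Rle_trans; [apply Cmod_sub_le|].
      generalize (Cmod_sub_le (sl z1 z3 + sl z2 z4) (sl z1 z2)) (Cmod_triangle (sl z1 z3) (sl z2 z4)). lra. }
    generalize (Cmod_ge_0 (sl z1 z3 * sl z2 z4 - sl z1 z2 * sl z3 z4)). nra. }
  apply Rle_trans with (16 * (Cmod (z1 - z2) * Cmod (z3 - z4)) * (e * 2)); [|right; ring].
  apply Rmult_le_compat; [apply Cmod_ge_0|apply Rmult_le_pos; [lra|apply Cmod_ge_0]|exact BF|].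
  apply Rmult_le_compat_l; lra.
Qed.

(** [G] is bounded by 1/4, so its differences stay below 1/2, while [unflow] shrinks distances at
    most by a factor 2. *)
Lemma slope_far (z z' : C) : z <> z' -> Cmod (sl z z') <= / Cmod (z - z').
Proof.
  intros N. generalize (unflow_ne _ _ N). intro N'.
  assert (0 < Cmod (w z - w z')) as P by (apply Cmod_gt_0, sub_ne, N').
  assert (0 < Cmod (z - z')) as Q by (apply Cmod_gt_0, sub_ne, N).
  assert (Cmod (z - z') <= 2 * Cmod (w z - w z')) as L.
  { rewrite <- (flow_unflow pr e He z) at 1. rewrite <- (flow_unflow pr e He z') at 1.
    unfold flow. replace (w z + push e G (w z) - (w z' + push e G (w z')))%C with
      ((w z - w z') + (push e G (w z) - push e G (w z')))%C by ring.
    eapply Rle_trans; [apply Cmod_triangle|]. generalize (push_G_lip pr e He (w z') (w z)). lra. }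
  unfold slope. rewrite Cmod_div by (apply sub_ne, N').
  apply Rmult_le_reg_r with (Cmod (w z - w z')); [exact P|]. unfold Rdiv. rewrite Rmult_assoc, Rinv_l, Rmult_1_r by lra.
  apply Rle_trans with (/ 2).
  - eapply Rle_trans; [apply Cmod_sub_le|]. generalize (pr_G_bd pr (w z)) (pr_G_bd pr (w z')). lra.
  - apply Rmult_le_reg_l with (Cmod (z - z')); [exact Q|].
    rewrite <- Rmult_assoc, Rinv_r, Rmult_1_l by lra. lra.
Qed.

(** [unflow] displaces points by at most [e / 4], so each value of [G] changes by less than [e / 8]
    at most; this compares the slope at the moved points with fixed data independent of [e]. *)
Lemma slope_near (z z' : C) : z <> z' -> (Cmod (G z - G z') - e / 4) / (2 * Cmod (z - z')) <= Cmod (sl z z').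
Proof.
  intros N. generalize (unflow_ne _ _ N). intro N'.
  assert (0 < Cmod (w z - w z')) as P by (apply Cmod_gt_0, sub_ne, N').
  assert (0 < Cmod (z - z')) as Q by (apply Cmod_gt_0, sub_ne, N).
  unfold slope. rewrite Cmod_div by (apply sub_ne, N').
  assert (Cmod (G z - G z') - e / 4 <= Cmod (G (w z) - G (w z'))) as L.
  { assert (forall z, Cmod (G z - G (w z)) <= e / 8) as A.
    { intros u. generalize (pr_G_lip pr (w u) u) (unflow_close pr e He u). lra. }
    generalize (A z) (A z'). intros A1 A2. rewrite Cmod_sub_sym in A2.
    replace (G z - G z')%C with ((G z - G (w z)) + (G (w z) - G (w z')) + (G (w z') - G z'))%C by ring.
    generalize (Cmod_triangle ((G z - G (w z)) + (G (w z) - G (w z'))) (G (w z') - G z'))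
      (Cmod_triangle (G z - G (w z)) (G (w z) - G (w z'))). lra. }
  assert (Cmod (w z - w z') <= 2 * Cmod (z - z')) as C by apply unflow_contract.
  destruct (Rle_dec (Cmod (G z - G z') - e / 4) 0) as [Neg|Pos].
  - apply Rle_trans with 0.
    + unfold Rdiv. assert (0 < / (2 * Cmod (z - z'))) by (apply Rinv_0_lt_compat; lra). nra.
    + apply Rmult_le_pos; [apply Cmod_ge_0|left; apply Rinv_0_lt_compat, P].
  - apply Rmult_le_compat; [lra|left; apply Rinv_0_lt_compat; lra|exact L|].
    apply Rinv_le_contravar; auto.
Qed.

(** Solving the relation for the slope between [z1] and [z2] leaves on the right three slopes that
    decay with the distance, and a term of order [e]. *)
Lemma cross_defect_zero : 0 < e -> cross_defect (Phi z1) (Phi z2) (Phi z3) (Phi z4) z1 z2 z3 z4 = 0 ->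
  (Cmod (G z1 - G z2) - e / 4) / (2 * Cmod (z1 - z2)) <=
  / Cmod (z1 - z3) + / Cmod (z2 - z4) + / Cmod (z3 - z4) + e / 8.
Proof.
  intros Pe Z. destruct cross_defect_factor as [F [NF [_ E]]]. rewrite Z in E.
  assert (slope_defect = 0) as D.
  { apply NNPP. intro N. apply (Cmult_neq_0 F (e * slope_defect) NF); [|auto].
    apply Cmult_neq_0; [intro Q; apply RtoC_inj in Q; lra|exact N]. }
  unfold slope_defect in D.
  eapply Rle_trans; [apply slope_near, N12|].
  assert (sl z1 z2 = sl z1 z3 + sl z2 z4 - sl z3 z4 + e * (sl z1 z3 * sl z2 z4 - sl z1 z2 * sl z3 z4))%C as ES.
  { rewrite <- (Cplus_0_r (sl z1 z2)) at 1. rewrite <- D. ring. }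
  rewrite ES. eapply Rle_trans; [apply Cmod_triangle|].
  rewrite Cmod_mult, Cmod_R, Rabs_pos_eq by lra.
  generalize slope_products_bound (slope_far _ _ N13) (slope_far _ _ N24) (slope_far _ _ N34)
    (Cmod_sub_le (sl z1 z3 + sl z2 z4) (sl z3 z4)) (Cmod_triangle (sl z1 z3) (sl z2 z4)). intros. nra.
Qed.
End CrossRatio.

(** * Failure of analyticity *)

Lemma icay_axis (y : R) : 0 < y -> icay (0, y) = RtoC ((y - 1) / (y + 1)).
Proof.
  intros H. unfold icay.
  replace (1 * (0, y) + - Ci)%C with (Ci * RtoC (y - 1))%C by (unfold Ci, Cplus, Cmult, Copp, RtoC; simpl; f_equal; ring).
  replace (1 * (0, y) + Ci)%C with (Ci * RtoC (y + 1))%C by (unfold Ci, Cplus, Cmult, RtoC; simpl; f_equal; ring).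
  assert (RtoC (y + 1) <> 0) as N by (intro E; apply RtoC_inj in E; lra).
  unfold Rdiv. rewrite RtoC_mult, RtoC_inv by lra. field. split; [exact N|apply Ci_ne].
Qed.

Lemma axis_dist (y y' : R) : Cmod (((0, y) : C) - (0, y')) = Rabs (y - y').
Proof.
  replace (((0, y) : C) - (0, y'))%C with (Ci * RtoC (y - y'))%C by (unfold Ci, Cminus, Cplus, Cmult, Copp, RtoC; simpl; f_equal; ring).
  rewrite Cmod_mult, Cmod_Ci, Cmod_R. ring.
Qed.

Section NotAnalytic.
Context {k1 k2 eta : R -> R} {G : C -> C} (pr : profile k1 k2 eta G).

Lemma transported_map_not_analytic (Rmap : C * R -> C) :
  (forall lambda : R, 0 <= lambda <= 1 ->
     riemann_mapping (omega k1 k2 (flat_exp lambda)) (fun w : C => Rmap (w, lambda))) ->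
  ~ real_analytic_at cylinder
      (fun p : C * R => Rmap (gamma k1 k2 eta (flat_exp (snd p)) (fst p), snd p)) (RtoC 1, 0).
Proof.
  intros HR [_ [U [F [OU [U1 [RA Agree]]]]]].
  destruct (OU _ U1) as [d Hd].
  (* The point iy corresponds to 1 - 2 / (y + 1). The value 3 puts it where [gamma] is the identity,
     and 2 / d puts it in the neighbourhood of analyticity. *)
  set (Y := Rmax 3 (2 / d)).
  assert (3 <= Y) as HY3 by apply Rmax_l. assert (2 / d <= Y) as HYd by apply Rmax_r.
  assert (forall y, Y < y -> 0 < y /\ sq1 (icay (0, y)) < / 2 /\ Cmod (icay (0, y)) < 1 /\
    (forall t, Rabs t < d -> U (icay (0, y), t))) as Near.
  { intros y Hy. assert (0 < y) as Py by lra. rewrite icay_axis by exact Py.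
    assert ((y - 1) / (y + 1) = 1 - 2 / (y + 1)) as E by (field; lra).
    assert (0 < 2 / (y + 1) < / 2) as B.
    { split; [apply Rdiv_lt_0_compat; lra|]. apply Rmult_lt_reg_r with (y + 1); [lra|].
      unfold Rdiv. rewrite Rmult_assoc, Rinv_l by lra. lra. }
    assert (2 / (y + 1) < d) as Bd.
    { apply Rmult_lt_reg_r with (y + 1); [lra|]. unfold Rdiv at 1. rewrite Rmult_assoc, Rinv_l by lra.
      generalize (cond_pos d). intro Pd.
      assert (2 <= Y * d) by (apply (Rmult_le_compat_r d) in HYd; [|lra]; unfold Rdiv in HYd; rewrite Rmult_assoc, Rinv_l in HYd; lra).
      nra. }
    split; [exact Py|]. rewrite E. split; [|split].
    - unfold sq1. simpl. nra.
    - rewrite Cmod_R. apply Rabs_lt_between. lra.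
    - intros t Ht. apply Hd. split; [split|].
      + change (Rabs (1 - 2 / (y + 1) - 1) < d). replace (1 - 2 / (y + 1) - 1) with (- (2 / (y + 1))) by ring.
        rewrite Rabs_Ropp, Rabs_pos_eq; lra.
      + change (Rabs (0 - 0) < d). rewrite Rminus_0_r, Rabs_R0. apply cond_pos.
      + change (Rabs (t - 0) < d). rewrite Rminus_0_r. exact Ht. }
  set (y1 := Y + 1). set (y2 := Y + 2).
  set (D := Cmod (G (0, y1) - G (0, y2))).
  assert (0 < D) as PD.
  { apply Cmod_gt_0, sub_ne. apply (pr_G_axis pr). unfold y1, y2. lra. }
  (* The spacing of the distant points: each of the three slopes on the right is then at most D /
     24. [D] itself depends only on the close pair, so the choice is not circular. *)
  set (L := 24 / D). assert (0 < L) as PL by (apply Rdiv_lt_0_compat; lra).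
  set (y3 := y2 + L). set (y4 := y3 + L).
  set (C0 := 32 * (Cmod (((0, y1) : C) - (0, y2)) * Cmod (((0, y3) : C) - (0, y4)))).
  set (N := fun t => cross_defect (F (icay (0, y1), t)) (F (icay (0, y2), t)) (F (icay (0, y3), t)) (F (icay (0, y4), t))
    (0, y1) (0, y2) (0, y3) (0, y4)).
  assert (0 < d) as Pd by apply cond_pos.
  set (r0 := Rmin d 1). assert (0 < r0) as Pr0 by (apply Rmin_pos; lra).
  assert (r0 <= d) by apply Rmin_l. assert (r0 <= 1) by apply Rmin_r.
  (* Near z = 1 the parametrization disappears, and the analytic extension gives values of the
     Riemann mappings themselves; [r0 <= 1] keeps the parameter in the cylinder. *)
  assert (forall y t, Y < y -> 0 <= t < r0 -> F (icay (0, y), t) = Rmap (icay (0, y), t)) as EF.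
  { intros y t Hy Ht. destruct (Near y Hy) as [_ [Q1 [Q2 Q3]]]. rewrite Agree.
    - simpl. rewrite (gamma_near_1 pr) by exact Q1. reflexivity.
    - split; [unfold closed_unit_disc; simpl; lra|simpl; lra].
    - apply Q3. rewrite Rabs_pos_eq; lra. }
  assert (forall t, 0 <= t < r0 -> N t = cross_defect (Rmap (icay (0, y1), t)) (Rmap (icay (0, y2), t))
    (Rmap (icay (0, y3), t)) (Rmap (icay (0, y4), t)) (0, y1) (0, y2) (0, y3) (0, y4)) as EN.
  { intros t Ht. unfold N. rewrite !EF by (auto; unfold y4, y3, y2, y1; lra). reflexivity. }
  assert (forall y y' : R, y <> y' -> ((0, y) : C) <> (0, y')) as Ne.
  { intros y y' Q E. apply Q. exact (f_equal snd E). }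
  assert (forall y, Y < y -> upper (0, y) /\ sq1 (icay (0, y)) < / 2) as Up.
  { intros y Hy. destruct (Near y Hy) as [Q1 [Q2 _]]. split; [exact Q1|exact Q2]. }
  destruct (Up y1 ltac:(unfold y1; lra)) as [A1 B1]. destruct (Up y2 ltac:(unfold y2; lra)) as [A2 B2].
  destruct (Up y3 ltac:(unfold y3, y2; lra)) as [A3 B3]. destruct (Up y4 ltac:(unfold y4, y3, y2; lra)) as [A4 B4].
  assert (((0, y1) : C) <> (0, y2)) as N12 by (apply Ne; unfold y1, y2; lra).
  assert (((0, y1) : C) <> (0, y3)) as N13 by (apply Ne; unfold y1, y3, y2; lra).
  assert (((0, y2) : C) <> (0, y4)) as N24 by (apply Ne; unfold y4, y3; lra).
  assert (((0, y3) : C) <> (0, y4)) as N34 by (apply Ne; unfold y4; lra).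
  assert (Cright_analytic N) as AN.
  { assert (forall y, Y < y -> Cright_analytic (fun t => F (icay (0, y), t))) as AF.
    { intros y Hy. apply (real_analytic_on_vertical U); [exact RA|]. apply Near; [exact Hy|]. rewrite Rabs_R0. exact Pd. }
    unfold N, cross_defect.
    repeat first [apply Cright_analytic_minus | apply Cright_analytic_mult | apply Cright_analytic_const
      | apply AF; unfold y4, y3, y2, y1; lra]. }
  assert (flat_at_0 (fun t => Cmod (N t))) as FN.
  { intros m. destruct (flat_exp_flat m) as [K [HK HF]].
    assert (0 <= C0) as PC by (unfold C0; repeat apply Rmult_le_pos; try apply Cmod_ge_0; lra).
    exists (C0 * K), r0. split; [exact Pr0|]. intros t Ht. rewrite Rabs_pos_eq by apply Cmod_ge_0.
    rewrite EN by lra.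
    eapply Rle_trans; [apply (cross_defect_small pr (flat_exp t) (flat_exp_range t) (fun w => Rmap (w, t)) (HR t ltac:(lra))
      (0, y1) (0, y2) (0, y3) (0, y4)); auto|]. fold C0.
    rewrite Rmult_assoc. apply Rmult_le_compat_l; [exact PC|]. specialize (HF t). rewrite Rabs_pos_eq in HF by lra. exact HF. }
  destruct (Cright_analytic_flat N AN FN) as [r [Hr ZN]].
  destruct (flat_exp_flat 1) as [K [HK HF]].
  (* Below [q] the linear bound [K * t] on [flat_exp t] is at most [D / 4]. *)
  set (q := D / 4 / K). assert (0 < q) as Hq by (repeat apply Rdiv_lt_0_compat; lra).
  set (t := Rmin (Rmin r r0) q / 2).
  assert (0 < Rmin (Rmin r r0) q) by (apply Rmin_pos; [apply Rmin_pos; auto|exact Hq]).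
  generalize (Rmin_l (Rmin r r0) q) (Rmin_r (Rmin r r0) q) (Rmin_l r r0) (Rmin_r r r0). intros.
  assert (0 < t) as Pt by (unfold t; lra).
  assert (t < r0) as Ht0 by (unfold t; lra). assert (t < r) as Htr by (unfold t; lra). assert (t < q) as Htq by (unfold t; lra).
  assert (flat_exp t <= D / 4) as Es.
  { eapply Rle_trans; [apply HF|]. rewrite Rabs_pos_eq by lra. simpl. rewrite Rmult_1_r.
    apply (Rmult_lt_compat_l K) in Htq; [|exact HK]. replace (K * q) with (D / 4) in Htq by (unfold q; field; lra). lra. }
  generalize (cross_defect_zero pr (flat_exp t) (flat_exp_range t) (fun w => Rmap (w, t)) (HR t ltac:(lra))
    (0, y1) (0, y2) (0, y3) (0, y4) A1 A2 A3 A4 B1 B2 B3 B4 N12 N13 N24 N34 (flat_exp_pos t Pt)).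
  rewrite <- EN by lra. intro Q. specialize (Q (ZN t ltac:(lra))). revert Q. fold D. rewrite !axis_dist.
  assert (Rabs (y1 - y2) = 1) as -> by (unfold y1, y2; rewrite Rabs_left; lra).
  assert (Rabs (y1 - y3) = 1 + L) as -> by (unfold y1, y3, y2; rewrite Rabs_left; lra).
  assert (Rabs (y2 - y4) = L + L) as -> by (unfold y4, y3; rewrite Rabs_left; lra).
  assert (Rabs (y3 - y4) = L) as -> by (unfold y4; rewrite Rabs_left; lra).
  assert (/ L = D / 24) as EL by (unfold L; field; lra).
  assert (/ (1 + L) <= / L) by (apply Rinv_le_contravar; lra).
  assert (/ (L + L) <= / L) by (apply Rinv_le_contravar; lra).
  (* The left side is at least 15 D / 32 and the right side at most 3 D / 24 + D / 32 = 5 D / 32. *)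
  rewrite EL in *. intro Q. replace ((D - flat_exp t / 4) / (2 * 1)) with (/ 2 * (D - flat_exp t / 4)) in Q by field. lra.
Qed.
End NotAnalytic.

Theorem theorem1p2 :
  exists (Omega : R -> C -> Prop) (Gamma : C * R -> C),
    (forall lambda : R, 0 <= lambda <= 1 ->
       bounded_domain (Omega lambda) /\
       smooth_boundary (Omega lambda) /\
       smooth_embedding_onto (fun z : C => Gamma (z, lambda))
         (@closure C_UniformSpace (Omega lambda))) /\
    smooth_on_closed (V := CxR) cylinder Gamma /\
    real_analytic_at cylinder Gamma (RtoC 1, 0) /\
    forall Rmap : C * R -> C,
      (forall lambda : R, 0 <= lambda <= 1 ->
         riemann_mapping (Omega lambda) (fun w : C => Rmap (w, lambda))) ->
      ~ real_analytic_at cylinder (fun p : C * R => Rmap (Gamma p, snd p))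
          (RtoC 1, 0).
Proof.
  destruct profile_exists as [k1 [k2 [eta [G pr]]]].
  exists (fun lambda => omega k1 k2 (flat_exp lambda)), (fun p => gamma k1 k2 eta (flat_exp (snd p)) (fst p)).
  split; [|split; [|split]].
  - intros lambda _. generalize (flat_exp_range lambda). intro He. split; [|split].
    + apply (omega_bounded_domain pr _ He).
    + apply (omega_smooth_boundary pr _ He).
    + apply (gamma_embedding pr _ He).
  - eexists. exists tube2. split; [apply tube2_open|]. split; [|split].
    + intros p [Hp _]. unfold closed_unit_disc in Hp. split; [exact I|]. apply (proj2 (disc2_Cmod (fst p))). apply Rle_lt_trans with 1; [exact Hp|lra].
    + apply (gamma_smooth_tube pr).
    + reflexivity.
  - split.
    + split; simpl; [unfold closed_unit_disc; rewrite Cmod_1; lra|lra].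
    (* The extension of Gamma is the projection itself, on a neighbourhood of z = 1 that is uniform
       in the parameter. *)
    + exists (fun p : CxR => True /\ 0 < / 2 - sq1 (Re (fst p), Im (fst p))), fst. split; [|split; [|split]].
      * apply (open_sq1_small (V := CxR) (fun _ => True) (fun p => Re (fst p)) (fun p => Im (fst p)));
          [apply open_true|intros; apply Cn_Re_fst|intros; apply Cn_Im_fst].
      * split; [exact I|]. unfold sq1. simpl. lra.
      * apply real_analytic_fst.
      * intros [[x y] t] _ [_ Hq]. symmetry. apply (gamma_near_1 pr). simpl in *. lra.
  - intros Rmap HR. apply (transported_map_not_analytic pr Rmap HR).
Qed.
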